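(* For each $n$ let $1\le p(n)\le n$ be an integer and let $X_1,\dots,X_{p(n)+1}$ be independent random points in $\mathbb{R}^n$, each distributed according to the standard Gaussian density $(2\pi)^{-n/2}\exp(-\frac12|x|^2)$, $x\in\mathbb{R}^n$. Let $VS_{n,p(n)}$ be the $p(n)$-dimensional volume of the simplex with vertices $X_1,\dots,X_{p(n)+1}$, and put $$Z_n:=\frac{\log VS_{n,p(n)}-\mathbb{E}(\log VS_{n,p(n)})}{\sqrt{\mathbb{V}(\log VS_{n,p(n)})}}.$$ Let $N$ be a standard normally distributed random variable and let $k$ be an even positive integer. (a) If $p(n)=o(n)$, or $p(n)\sim c\,n$ for a fixed $c\in(0,1)$, as $n\to\infty$, then there is a constant $C_1(k)$, not depending on $n$, such that for all sufficiently large $n$ $$\bigl|\mathbb{E}(Z_n^k)-\mathbb{E}(N^k)\bigr|\le C_1(k)\,\frac1{p(n)\,n}.$$ (b) If $n-p(n)=o(n)$ as $n\to\infty$ (including the case $p(n)=n$), then there is a constant $C_1(k)$, not depending on $n$, such that for all sufficiently large $n$ $$\bigl|\mathbb{E}(Z_n^k)-\mathbb{E}(N^k)\bigr|\le C_1(k)\,\frac1{\log\frac n{n-p(n)+1}}.$$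
   Context: $\mathbb{V}$ denotes variance. *)

(* Defs.v *)
(* MathComp-Analysis: everything is over an abstract [R : realType]. *)
From HB Require Import structures.
From mathcomp Require Import all_boot all_order all_algebra.
From mathcomp Require Import all_classical all_reals all_analysis.

Set Implicit Arguments.
Unset Strict Implicit.
Unset Printing Implicit Defensive.

Import Order.TTheory GRing.Theory Num.Theory.
Import numFieldNormedType.Exports.

Local Open Scope classical_set_scope.
Local Open Scope ring_scope.

(* R^n, in the form of the library's measurable type of n-tuples of reals, whose
   sigma-algebra is generated by the coordinate maps (the Borel sets of R^n). *)
Notation Rn R n := (n.-tuple (measurableTypeR R)).

Section LebesgueRn.
Context {R : realType}.
Local Open Scope ereal_scope.

Definition cons_Rn n (z : (measurableTypeR R * Rn R n)%type) : Rn R n.+1 :=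
  [tuple of z.1 :: z.2].

Lemma measurable_cons_Rn n : measurable_fun setT (@cons_Rn n).
Proof. by apply: measurable_cons; [exact: measurable_fst|exact: measurable_snd]. Qed.

Section step.
Variables (n : nat) (mu : {sigma_finite_measure set (Rn R n) -> \bar R}).

Definition lebesgue_step : set (Rn R n.+1) -> \bar R :=
  pushforward (lebesgue_measure \x mu) (@cons_Rn n).

Let measurable_preimage_cons A : measurable A -> measurable (@cons_Rn n @^-1` A).
Proof.
by move=> mA; rewrite -[X in measurable X]setTI; exact: measurable_cons_Rn.
Qed.

Let lebesgue_step0 : lebesgue_step set0 = 0.
Proof. by rewrite /lebesgue_step /pushforward preimage_set0 measure0. Qed.

Let lebesgue_step_ge0 A : 0 <= lebesgue_step A.
Proof. by rewrite /lebesgue_step /pushforward measure_ge0. Qed.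

Let lebesgue_step_sigma_additive : semi_sigma_additive lebesgue_step.
Proof.
move=> F mF tF mUF; rewrite /lebesgue_step /pushforward preimage_bigcup.
apply: measure_semi_sigma_additive.
- by move=> i; exact: measurable_preimage_cons.
- apply/trivIsetP => /= i j _ _ ij; rewrite -preimage_setI.
  by move/trivIsetP : tF => /(_ _ _ _ _ ij) ->//; rewrite preimage_set0.
- by rewrite -preimage_bigcup; exact: measurable_preimage_cons.
Qed.

HB.instance Definition _ := isMeasure.Build _ _ _ lebesgue_step
  lebesgue_step0 lebesgue_step_ge0 lebesgue_step_sigma_additive.

Let lebesgue_step_sigma_finite : sigma_finite setT lebesgue_step.
Proof.
have /sigma_finiteP[F [FT ndF Foo]] := sigma_finiteT (@lebesgue_measure R).
have /sigma_finiteP[G [GT ndG Goo]] := sigma_finiteT mu.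
pose B i : set (Rn R n.+1) :=
  [set x | F i (tnth x ord0) /\ G i [tuple of behead x]].
have consB i : @cons_Rn n @^-1` B i = F i `*` G i.
  apply/seteqP; split=> -[a t]/=; rewrite /B/= /cons_Rn/=;
    rewrite (_ : [tuple of behead (a :: t)] = t)//; exact/val_inj.
exists B.
  apply/seteqP; split=> // x _.
  have : [set: measurableTypeR R] (tnth x ord0) by [].
  have : [set: Rn R n] [tuple of behead x] by [].
  rewrite GT FT => -[j _ Gj] [i _ Fi]; exists (maxn i j) => //; split.
    by move: Fi; exact/subsetPset/ndF/leq_maxl.
  by move: Gj; exact/subsetPset/ndG/leq_maxr.
move=> i; have [mF Fi] := Foo i; have [mG Gi] := Goo i; split.
  apply: measurableI.
    by rewrite -[X in measurable X]setTI; exact: measurable_tnth.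
  by rewrite -[X in measurable X]setTI; exact: measurable_behead.
rewrite /lebesgue_step /pushforward consB product_measure1E//.
by rewrite lte_mul_pinfty// ge0_fin_numE.
Qed.

HB.instance Definition _ := Measure_isSigmaFinite.Build _ _ _ lebesgue_step
  lebesgue_step_sigma_finite.

End step.

Fixpoint lebesgue_Rn n : {sigma_finite_measure set (Rn R n) -> \bar R} :=
  match n with
  | 0 => dirac ([tuple] : Rn R 0)
  | n'.+1 => lebesgue_step (lebesgue_Rn n')
  end.

End LebesgueRn.

Section Volume.
Context {R : realType}.

Definition row_of_Rn n (x : Rn R n) : 'rV[R]_n := \row_(i < n) tnth x i.

(* When the rows of [U] are orthonormal, [affine_chart a U] is an isometry of
   the Euclidean space R^p onto a p-dimensional affine subspace of R^n. *)
Definition affine_chart p n (a : 'rV[R]_n) (U : 'M[R]_(p, n)) (t : Rn R p) :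
    'rV[R]_n := a + row_of_Rn t *m U.

(* The p-dimensional volume of a set lying in a p-dimensional affine subspace:
   its Lebesgue measure in Cartesian coordinates of such a subspace. This value
   does not depend on the subspace and coordinates; [ereal_inf] only extracts it. *)
Definition volume p n (S : set 'rV[R]_n) : \bar R :=
  ereal_inf [set v | exists (a : 'rV[R]_n) (U : 'M[R]_(p, n)),
    [/\ U *m U^T = 1%:M, S `<=` range (affine_chart a U) &
        v = lebesgue_Rn p (affine_chart a U @^-1` S)]].

(* The convex hull of the points [x i]. *)
Definition simplex p n (x : 'I_p.+1 -> 'rV[R]_n) : set 'rV[R]_n :=
  [set y | exists w : 'I_p.+1 -> R,
    [/\ forall i, 0 <= w i, \sum_i w i = 1 & y = \sum_i w i *: x i]].

Definition simplex_volume p n (x : 'I_p.+1 -> Rn R n) : R :=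
  fine (volume p (simplex (fun i => row_of_Rn (x i)))).

End Volume.

Section Probability.
Context {R : realType}.

Definition gaussian_density n (x : Rn R n) : R :=
  (2 * pi) `^ (- (n%:R / 2)) * expR (- (1 / 2 * \sum_(i < n) tnth x i ^+ 2)).

Definition standard_gaussian n d (T : measurableType d) (P : probability T R)
    (X : {RV P >-> Rn R n}) : Prop :=
  forall A : set (Rn R n), measurable A ->
    distribution P X A = (\int[lebesgue_Rn n]_(x in A) (gaussian_density x)%:E)%E.

Definition standard_normal d (T : measurableType d) (P : probability T R)
    (N : {RV P >-> measurableTypeR R}) : Prop :=
  forall A : set (measurableTypeR R), measurable A ->
    distribution P N A = normal_prob 0 1 A.

Definition mutually_independent (I : finType) d d' (T : measurableType d)
    (E : measurableType d') (P : probability T R) (X : I -> {RV P >-> E}) : Prop :=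
  forall (J : {set I}) (A : I -> set E), (forall i, measurable (A i)) ->
    P (\bigcap_(i in [set` J]) X i @^-1` A i) =
    (\prod_(i in J) P (X i @^-1` A i))%E.

Definition standardize d (T : measurableType d) (P : probability T R)
    (Y : T -> R) : T -> R :=
  fun w => (Y w - fine 'E_P[Y]) / Num.sqrt (fine 'V_P[Y]).

End Probability.

Arguments standard_gaussian {R n d T} P X.
Arguments standard_normal {R d T} P N.
Arguments mutually_independent {R I d d' T E} P X.

(* Main.v *)
(** The squared volume of the simplex is, up to a constant factor, the Gram
    determinant of a Gaussian matrix with [p] rows, so by successive Householder
    reductions the logarithm of the volume is, up to an affine map, distributed
    as a sum of independent log-chi-square variables with [n], ..., [n - p + 1]
    degrees of freedom. Gamma (a + 1) = a Gamma a gives a recurrence for the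
    cumulants of the summands, which yields c_1(a) >= 1/a and
    c_m(a) = O(a^-m) (cumulants being shifted by one: c_0 is the mean). After
    standardization the cumulant of order [i >= 3] is O(eps), and even O(eps^2)
    when [i] is even, with eps = 1 / sqrt(p n), resp. eps = 1 / sqrt(log(n / (n - p + 1))).
    An even moment is a polynomial in the cumulants in which every non-Gaussian
    monomial has either a factor of even order or two factors of odd order, hence
    the rate eps^2. *)
From HB Require Import structures.
Require Import Defs.
From mathcomp Require Import all_boot all_order all_algebra.
From mathcomp Require Import all_classical all_reals all_analysis.
From mathcomp Require Import measurable_realfun ring lra.

Set Implicit Arguments.
Unset Strict Implicit.
Unset Printing Implicit Defensive.

Import Order.TTheory GRing.Theory Num.Theory.
Import numFieldNormedType.Exports.

Local Open Scope classical_set_scope.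
Local Open Scope ring_scope.


(** * Integration on R^n *)

(** Up to the moments everything is phrased through integrals of nonnegative measurable functions:
    Tonelli and monotone convergence then apply at once, and laws are compared by comparing all such
    integrals. The Householder reflection depends on the row that it straightens, so it is used only
    after Tonelli has frozen this row.

    The functional equation of Gamma determines c_m(a), m >= 1, only up to a function of period 1 in
    a. The missing datum is that c_m(a + N) tends to 0; it follows from a bound on the moments about
    log(2a). A one-step inequality together with this limit replaces the summation of a series.

    The two rates come from homogeneity. Far from full dimension all p parameters are of order n, so
    the summed c_i is O(p n^-i) against a variance of at least p/n, and p n^-i / (p/n)^((i+1)/2) =
    (p n)^(-(i-1)/2). Near full dimension the summed c_i with i >= 2 stay bounded, inverse squares
    being summable, whereas the variance is at least of order log(n / (n-p+1)). *)

Lemma measurable_preimage d d' (T : measurableType d) (T' : measurableType d')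
    (f : T -> T') (A : set T') :
  measurable_fun setT f -> measurable A -> measurable (f @^-1` A).
Proof. by move=> mf mA; rewrite -[X in measurable X]setTI; exact: mf. Qed.

Section RnVectors.
Context {R : realType}.

Definition Rn_of_row n (r : 'rV[R]_n) : Rn R n := [tuple r 0 i | i < n].

Lemma row_of_RnK n : cancel (@row_of_Rn R n) (@Rn_of_row n).
Proof. by move=> x; apply: eq_from_tnth => i; rewrite tnth_mktuple mxE. Qed.

Lemma Rn_of_rowK n : cancel (@Rn_of_row n) (@row_of_Rn R n).
Proof. by move=> x; apply/rowP => i; rewrite mxE tnth_mktuple. Qed.

Lemma row_of_Rn_cons n (x : R) (t : Rn R n) :
  row_of_Rn (cons_Rn (x, t)) = row_mx x%:M (row_of_Rn t) :> 'rV[R]_(1 + n).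
Proof.
apply/rowP => i; rewrite !mxE (tnth_nth 0); case: splitP => j ->.
  by rewrite !ord1 mxE eqxx.
by rewrite mxE (tnth_nth 0).
Qed.

Lemma Rn_of_row_cons n (x : R) (r : 'rV[R]_n) :
  Rn_of_row (row_mx x%:M r : 'rV[R]_(1 + n)) = cons_Rn (x, Rn_of_row r).
Proof.
by apply: (can_inj (@row_of_RnK _)); rewrite row_of_Rn_cons !Rn_of_rowK.
Qed.

Definition mx_measurable d (T : measurableType d) m n (g : T -> 'M[R]_(m, n)) :=
  forall i j, measurable_fun setT (fun w => g w i j).

Section mx_measurable_lemmas.
Context d (T : measurableType d).

Lemma measurable_Rn_of_row n (g : T -> 'rV[R]_n) :
  mx_measurable g -> measurable_fun setT (fun w => Rn_of_row (g w)).
Proof.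
move=> mg; apply/measurable_fun_tnthP => i.
rewrite (_ : _ \o _ = fun w => g w 0 i); first exact: mg.
by apply/funext => w/=; rewrite tnth_mktuple.
Qed.

Lemma mx_measurable_row_of_Rn n (g : T -> Rn R n) :
  measurable_fun setT g -> mx_measurable (fun w => row_of_Rn (g w)).
Proof.
move=> mg i j; rewrite (_ : (fun _ => _) = (@tnth n R ^~ j) \o g).
  by apply: measurableT_comp => //; exact: measurable_tnth.
by apply/funext => w; rewrite mxE.
Qed.

Lemma mx_measurable_cst m n (A : 'M[R]_(m, n)) : mx_measurable (fun _ : T => A).
Proof. by move=> i j; exact: measurable_cst. Qed.

Lemma mx_measurableD m n (f g : T -> 'M[R]_(m, n)) :
  mx_measurable f -> mx_measurable g -> mx_measurable (fun w => f w + g w).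
Proof.
move=> mf mg i j; under eq_fun do rewrite mxE.
exact: measurable_funD.
Qed.

Lemma mx_measurableM m n p (f : T -> 'M[R]_(m, n)) (g : T -> 'M[R]_(n, p)) :
  mx_measurable f -> mx_measurable g -> mx_measurable (fun w => f w *m g w).
Proof.
move=> mf mg i j; under eq_fun do rewrite mxE.
by apply: measurable_sum => k; exact: measurable_funM.
Qed.

Lemma mx_measurable_tr m n (f : T -> 'M[R]_(m, n)) :
  mx_measurable f -> mx_measurable (fun w => (f w)^T).
Proof. by move=> mf i j; under eq_fun do rewrite mxE; exact: mf. Qed.

Lemma mx_measurable_det n (f : T -> 'M[R]_n) :
  mx_measurable f -> measurable_fun setT (fun w => \det (f w)).
Proof.
move=> mf; rewrite /determinant; apply: measurable_sum => s.
by apply: measurable_funM => //; apply: measurable_prod => i _.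
Qed.

End mx_measurable_lemmas.
End RnVectors.

(** * Linear change of variables for Lebesgue measure *)

Section LebesgueLinear.
Context {R : realType}.
Local Open Scope ereal_scope.
Local Notation leb := (@lebesgue_measure R).

Lemma ge0_integral_lebesgue_RnS n (f : Rn R n.+1 -> \bar R) :
  measurable_fun setT f -> (forall x, 0 <= f x) ->
  \int[lebesgue_Rn n.+1]_x f x = \int[leb]_x \int[lebesgue_Rn n]_t f (cons_Rn (x, t)).
Proof.
move=> mf f0; rewrite /= ge0_integral_pushforward//; last exact: measurable_cons_Rn.
rewrite preimage_setT fubini_tonelli1//; last by move=> x; exact: f0.
by apply: measurableT_comp => //; exact: measurable_cons_Rn.
Qed.

(** Tonelli in the other order: a shear moves the first coordinate by an amount depending on the
    others, so that coordinate has to be innermost. *)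
Lemma ge0_integral_lebesgue_RnS2 n (f : Rn R n.+1 -> \bar R) :
  measurable_fun setT f -> (forall x, 0 <= f x) ->
  \int[lebesgue_Rn n.+1]_x f x = \int[lebesgue_Rn n]_t \int[leb]_x f (cons_Rn (x, t)).
Proof.
move=> mf f0; rewrite /= ge0_integral_pushforward//; last exact: measurable_cons_Rn.
rewrite preimage_setT fubini_tonelli2//; last by move=> x; exact: f0.
by apply: measurableT_comp => //; exact: measurable_cons_Rn.
Qed.

(** By uniqueness of Lebesgue measure on left-open intervals. For negative [a] the preimage of such
    an interval is right-open, hence the two cases. *)
Lemma lebesgue_measure_affine (a b : R) (A : set (measurableTypeR R)) : a != 0%R ->
  measurable A ->
  `|a|%:E * leb ((fun x => a * x + b)%R @^-1` A) = leb A.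
Proof.
move=> a0 mA.
have mh : measurable_fun setT (fun x : measurableTypeR R => (a * x + b)%R : measurableTypeR R).
  by apply: measurable_funD => //; exact: measurable_funM.
pose h : {mfun measurableTypeR R >-> measurableTypeR R} :=
  HB.pack (fun x : measurableTypeR R => (a * x + b)%R : measurableTypeR R)
    (isMeasurableFun.Build _ _ _ _ _ mh).
pose m : {measure set (measurableTypeR R) -> \bar R} :=
  mscale (NngNum (normr_ge0 a)) (pushforward leb h).
rewrite (_ : _ * _ = m mh A)//; apply/esym; apply: lebesgue_measure_unique => //.
move=> _ [[c d] /= _ <-]; rewrite /m /mscale/= /pushforward/=.
have [a_gt0|a_lt0|/eqP] := ltgtP a 0%R; last by rewrite (negbTE a0).
  rewrite (_ : _ @^-1` _ = `[((d - b) / a)%R, ((c - b) / a)%R[%classic); last first.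
    apply/seteqP; split => x /=; rewrite !in_itv/=;
    by rewrite ler_ndivrMr// ltr_ndivlMr// lerBrDr ltrBlDr (mulrC x a) andbC.
  rewrite !lebesgue_measure_itv/= !lte_fin ltr_nM2r ?invr_lt0// ltrD2r.
  case: ifPn => cd; last by rewrite mule0.
  rewrite -!EFinB -EFinM ltr0_norm//; congr (_%:E).
  by field.
rewrite (_ : _ @^-1` _ = `]((c - b) / a)%R, ((d - b) / a)%R]%classic); last first.
  apply/seteqP; split => x /=; rewrite !in_itv/=;
  by rewrite ltr_pdivrMr// ler_pdivlMr// ltrBlDr lerBrDr (mulrC x a).
rewrite !lebesgue_measure_itv/= !lte_fin ltr_pM2r ?invr_gt0// ltrD2r.
case: ifPn => cd; last by rewrite mule0.
rewrite -!EFinB -EFinM gtr0_norm//; congr (_%:E).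
by field.
Qed.

Lemma ge0_integral_affine (a b : R) (f : R -> \bar R) : a != 0%R ->
  measurable_fun setT f -> (forall x, 0 <= f x) ->
  `|a|%:E * \int[leb]_x f (a * x + b)%R = \int[leb]_x f x.
Proof.
move=> a0 mf f0.
have mh : measurable_fun setT (fun x : measurableTypeR R => (a * x + b)%R : measurableTypeR R).
  by apply: measurable_funD => //; exact: measurable_funM.
pose h : {mfun measurableTypeR R >-> measurableTypeR R} :=
  HB.pack (fun x : measurableTypeR R => (a * x + b)%R : measurableTypeR R)
    (isMeasurableFun.Build _ _ _ _ _ mh).
rewrite (_ : \int[leb]_x f (a * x + b)%R = \int[pushforward leb h]_x f x); last first.
  by rewrite ge0_integral_pushforward.
rewrite -(@ge0_integral_mscale _ _ _ _ setT measurableT (NngNum (normr_ge0 a)))//.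
by apply: eq_measure_integral => A mA _; exact: lebesgue_measure_affine.
Qed.

Lemma ge0_integral_translation n (c : 'rV[R]_n) (f : Rn R n -> \bar R) :
  measurable_fun setT f -> (forall x, 0 <= f x) ->
  \int[lebesgue_Rn n]_x f (Rn_of_row (c + row_of_Rn x)%R) = \int[lebesgue_Rn n]_x f x.
Proof.
elim: n => [|n IH] in c f *.
  by move=> mf f0; apply: eq_integral => x _; rewrite tuple0 [x]tuple0.
move=> mf f0.
have mt : measurable_fun setT (fun x : Rn R n.+1 => f (Rn_of_row (c + row_of_Rn x)%R)).
  apply: measurableT_comp => //; apply: measurable_Rn_of_row.
  by apply: mx_measurableD; [exact: mx_measurable_cst|exact: mx_measurable_row_of_Rn].
have mf' : measurable_fun setT (fun z => f (cons_Rn z)).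
  by apply: measurableT_comp => //; exact: measurable_cons_Rn.
rewrite !ge0_integral_lebesgue_RnS//.
pose c0 := c 0%R 0%R; pose c' := rsubmx (c : 'rV[R]_(1 + n)).
have cE : c = row_mx c0%:M c' :> 'rV[R]_(1 + n).
  rewrite -[LHS](@hsubmxK _ 1 1 n); congr row_mx; apply/rowP => i.
  by rewrite !ord1 !mxE eqxx/=; congr (c _ _); exact: val_inj.
have E x : \int[lebesgue_Rn n]_t f (Rn_of_row (c + row_of_Rn (cons_Rn (x, t)))%R) =
    \int[lebesgue_Rn n]_t f (cons_Rn (1 * x + c0, t)%R).
  rewrite -(IH c' (fun t => f (cons_Rn (1 * x + c0, t)%R)))//; last first.
    by apply: (measurableT_comp mf'); exact: measurable_pair1.
  apply: eq_integral => t _; rewrite row_of_Rn_cons cE (@add_row_mx _ 1 1 n).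
  by rewrite -raddfD/= Rn_of_row_cons addrC mul1r.
under eq_integral do rewrite E.
rewrite -[RHS](@ge0_integral_affine 1 c0)//=.
- by rewrite normr1 mul1e.
- by apply: (@measurable_fun_fubini_tonelli_F _ _ _ _ _ (lebesgue_Rn n) (fun z => f (cons_Rn z))).
- by move=> x; exact: integral_ge0.
Qed.

Opaque lebesgue_Rn.

(** The change of variables formula for one matrix, isolated as a predicate because it is stable
    under products and can be checked on elementary factors. *)
Definition linear_scaling n (A : 'M[R]_n) := forall f : Rn R n -> \bar R,
  measurable_fun setT f -> (forall x, 0 <= f x) ->
  `|\det A|%:E * \int[lebesgue_Rn n]_x f (Rn_of_row (row_of_Rn x *m A)) =
  \int[lebesgue_Rn n]_x f x.

Lemma measurable_mulmx_Rn m n (A : 'M[R]_(m, n)) :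
  measurable_fun setT (fun x : Rn R m => Rn_of_row (row_of_Rn x *m A)).
Proof.
apply: measurable_Rn_of_row; apply: mx_measurableM; last exact: mx_measurable_cst.
exact: mx_measurable_row_of_Rn.
Qed.

Lemma linear_scaling_mul n (A B : 'M[R]_n) :
  linear_scaling A -> linear_scaling B -> linear_scaling (A *m B).
Proof.
move=> hA hB f mf f0; rewrite det_mulmx normrM mulrC EFinM -muleA.
under eq_integral do rewrite mulmxA -[X in X *m B]Rn_of_rowK.
rewrite (hA (fun x => f (Rn_of_row (row_of_Rn x *m B)))) ?hB//.
by apply: measurableT_comp => //; exact: measurable_mulmx_Rn.
Qed.

(** This map translates the first coordinate by [t *m c] and keeps the others [t], so translation
    invariance on the line suffices. *)
Lemma linear_scaling_lower n (c : 'cV[R]_n) :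
  linear_scaling (block_mx 1%:M 0 c 1%:M : 'M[R]_(1 + n)).
Proof.
move=> f mf f0; rewrite det_lblock !det1 mulr1 normr1 mul1e.
have mf' : measurable_fun setT (fun z => f (cons_Rn z)).
  by apply: measurableT_comp => //; exact: measurable_cons_Rn.
have mfA : measurable_fun setT (fun x : Rn R n.+1 =>
    f (Rn_of_row (row_of_Rn x *m (block_mx 1%:M 0 c 1%:M : 'M[R]_(1 + n))))).
  by apply: measurableT_comp => //; exact: measurable_mulmx_Rn.
rewrite !ge0_integral_lebesgue_RnS2//; apply: eq_integral => t _.
rewrite -[RHS](@ge0_integral_affine 1 ((row_of_Rn t *m c) 0%R 0%R)%R)//=.
- rewrite normr1 mul1e; apply: eq_integral => x _.
  rewrite row_of_Rn_cons mul_row_block mulmx1 mulmx0 add0r mulmx1.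
  rewrite [X in (_ + X)%R]mx11_scalar -raddfD/= Rn_of_row_cons mul1r row_of_RnK.
  by [].
- by apply: (measurableT_comp mf'); exact: measurable_pair2.
Qed.

(** For a fixed first coordinate [x] the others undergo [A] and a translation by [x b]; afterwards
    only the scaling of [x] by [a] remains. *)
Lemma linear_scaling_upper n (a : R) (b : 'rV[R]_n) (A : 'M[R]_n) :
  a != 0%R -> linear_scaling A ->
  linear_scaling (block_mx a%:M b 0 A : 'M[R]_(1 + n)).
Proof.
move=> a0 hA f mf f0; rewrite det_ublock det_scalar1.
have mf' : measurable_fun setT (fun z => f (cons_Rn z)).
  by apply: measurableT_comp => //; exact: measurable_cons_Rn.
have mfA : measurable_fun setT (fun x : Rn R n.+1 =>
    f (Rn_of_row (row_of_Rn x *m (block_mx a%:M b 0 A : 'M[R]_(1 + n))))).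
  by apply: measurableT_comp => //; exact: measurable_mulmx_Rn.
rewrite !ge0_integral_lebesgue_RnS// normrM EFinM -muleA -ge0_integralZl//; last 2 first.
- apply: (@measurable_fun_fubini_tonelli_F _ _ _ _ _ (lebesgue_Rn n) (fun z =>
    f (Rn_of_row (row_of_Rn (cons_Rn z) *m (block_mx a%:M b 0 A : 'M[R]_(1 + n))))))=> //.
  by apply: (measurableT_comp mfA); exact: measurable_cons_Rn.
- by move=> x _; exact: integral_ge0.
have E x : `|\det A|%:E * \int[lebesgue_Rn n]_t
      f (Rn_of_row ((row_of_Rn (cons_Rn (x, t)) : 'rV[R]_(1 + n)) *m
        block_mx a%:M b 0 A)) =
    \int[lebesgue_Rn n]_t f (cons_Rn (a * x + 0, t)%R).
  have mg : measurable_fun setT (fun y => f (cons_Rn (a * x + 0, y)%R)).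
    by apply: (measurableT_comp mf'); exact: measurable_pair1.
  rewrite -(ge0_integral_translation (x%:M *m b) mg)// -[RHS]hA//; last first.
    apply: (measurableT_comp mg); apply: measurable_Rn_of_row.
    by apply: mx_measurableD; [exact: mx_measurable_cst|exact: mx_measurable_row_of_Rn].
  congr (_ * _); apply: eq_integral => t _.
  rewrite row_of_Rn_cons mul_row_block mulmx0 addr0 -scalar_mxM Rn_of_row_cons.
  by rewrite Rn_of_rowK mulrC addr0.
under eq_integral do rewrite E.
rewrite (@ge0_integral_affine a 0 (fun x => \int[lebesgue_Rn n]_t f (cons_Rn (x, t))))//.
- by apply: (@measurable_fun_fubini_tonelli_F _ _ _ _ _ (lebesgue_Rn n) (fun z => f (cons_Rn z))).
- by move=> x; exact: integral_ge0.
Qed.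

(** Gaussian elimination by induction on the size: a nonzero pivot splits off a lower shear and
    leaves a block triangular factor. *)
Lemma unitmx_linear_scaling n (A : 'M[R]_n) : A \in unitmx -> linear_scaling A.
Proof.
elim: n => [|n IH] in A *.
  move=> _ f mf f0; rewrite det_mx00 normr1 mul1e.
  by apply: eq_integral => x _; rewrite tuple0 [x]tuple0.
move: A; change ('M[R]_n.+1) with ('M[R]_(1 + n)) => A uA.
suff main : forall B : 'M[R]_(1 + n), B \in unitmx -> ulsubmx B 0%R 0%R != 0%R ->
    linear_scaling B.
  have [a0|a0] := eqVneq (ulsubmx A 0%R 0%R) 0%R; last exact: main.
  (* If the pivot vanishes, a shear by [b^T] replaces it by the squared norm of the rest [b] of the
     first row; this is nonzero, since otherwise the first row would vanish. *)
  pose b := ursubmx A.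
  pose S (c : 'cV[R]_n) := block_mx 1%:M 0 c 1%:M : 'M[R]_(1 + n).
  have SK c : S c *m S (- c)%R = 1%:M.
    by rewrite mulmx_block !mulmx1 !mulmx0 !mul0mx !mul1mx !addr0 add0r addrN -scalar_mx_block.
  have -> : A = (A *m S b^T) *m S (- b^T)%R by rewrite -mulmxA SK mulmx1.
  apply: linear_scaling_mul; last exact: linear_scaling_lower.
  apply: main.
    by rewrite unitmx_mul uA/=; have /mulmx1_unit[] := SK b^T.
  rewrite -{1}[A]submxK mulmx_block block_mxKul mulmx1 mxE a0 add0r.
  rewrite mxE psumr_neq0; last by move=> i _; rewrite !mxE -expr2 sqr_ge0.
  apply/hasP => /=.
  have [b0|/rV0Pn[j bj]] := eqVneq b 0%R; last first.
    exists j; first by rewrite mem_index_enum.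
    by rewrite [_^T _ _]mxE -expr2 exprn_even_gt0.
  exfalso; move: uA; rewrite unitmxE -[A]submxK -/b b0.
  rewrite [ulsubmx A]mx11_scalar a0 raddf0 det_lblock.
  by rewrite det_mx11 mxE mul0r unitr0.
move=> B uB a0; set a := ulsubmx B 0%R 0%R in a0.
have BE : B = block_mx a%:M (ursubmx B) (dlsubmx B) (drsubmx B).
  by rewrite -[LHS]submxK [ulsubmx B]mx11_scalar.
(* [A'] is the Schur complement of the pivot. *)
pose A' := (drsubmx B - a^-1 *: (dlsubmx B *m ursubmx B))%R.
have BE2 : B = (block_mx 1%:M 0 (a^-1 *: dlsubmx B) 1%:M : 'M[R]_(1 + n)) *m
    (block_mx a%:M (ursubmx B) 0 A' : 'M[R]_(1 + n)).
  rewrite mulmx_block !mul1mx !mul0mx !addr0 {1}BE; congr block_mx.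
    by rewrite -scalemxAl mul_mx_scalar scalerA mulVf// scale1r.
  by rewrite -scalemxAl /A' addrC subrK.
rewrite BE2; apply: linear_scaling_mul; first exact: linear_scaling_lower.
apply: linear_scaling_upper => //; apply: IH.
by move: uB; rewrite {1}BE2 unitmx_mul => /andP[_]; rewrite !unitmxE det_ublock unitrM => /andP[].
Qed.

End LebesgueLinear.

Import HBNNSimple.

(** * Integration against a measure given by a density *)

Section Density.
Local Open Scope ereal_scope.
Context d (T : measurableType d) (R : realType).
Variables (mu nu : {measure set T -> \bar R}) (k : T -> R).
Hypotheses (mk : measurable_fun setT k) (k0 : forall x, (0 <= k x)%R).
Hypothesis nuE : forall A, measurable A -> nu A = \int[mu]_(x in A) (k x)%:E.

Lemma ge0_integral_density (f : T -> \bar R) :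
  measurable_fun setT f -> (forall x, 0 <= f x) ->
  \int[nu]_x f x = \int[mu]_x (f x * (k x)%:E).
Proof.
move=> mf f0; pose h := nnsfun_approx measurableT mf.
have mk' : measurable_fun setT (fun x => (k x)%:E) by exact/measurable_EFinP.
have -> : \int[nu]_x f x = lim (\int[nu]_x (EFin \o h n) x @[n --> \oo]).
  have fE x : f x = lim ((EFin \o h n) x @[n --> \oo]).
    by apply/esym/cvg_lim => //; exact: cvg_nnsfun_approx.
  under eq_integral do rewrite fE.
  apply: monotone_convergence => //.
  - by move=> n; exact/measurable_EFinP.
  - by move=> n x _ /=; rewrite lee_fin.
  - by move=> x _ a b ab; rewrite lee_fin; exact/lefP/nd_nnsfun_approx.
have -> : \int[mu]_x (f x * (k x)%:E) =
    lim (\int[mu]_x ((EFin \o h n) x * (k x)%:E) @[n --> \oo]).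
  have fE x : f x * (k x)%:E = lim (((EFin \o h n) x * (k x)%:E) @[n --> \oo]).
    by apply/esym/cvg_lim => //; apply: cvgeZr => //; exact: cvg_nnsfun_approx.
  under eq_integral do rewrite fE.
  apply: monotone_convergence => //.
  - by move=> n; apply: emeasurable_funM => //; exact/measurable_EFinP.
  - by move=> n x _ /=; rewrite mule_ge0 ?lee_fin.
  - move=> x _ a b ab; rewrite lee_wpmul2r ?lee_fin//.
    exact/lefP/nd_nnsfun_approx.
suff E n : \int[mu]_x ((EFin \o h n) x * (k x)%:E) = \int[nu]_x (EFin \o h n) x.
  by congr (limn _); apply/funext => n; rewrite E.
transitivity (\int[nu]_x
   (\sum_(y \in range (h n)) (y * \1_(h n @^-1` [set y]) x)%:E)); last first.
  by apply: eq_integral => t tE; rewrite /= fimfunE -fsumEFin.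
have mind r : measurable_fun setT (fun x => (r * \1_(h n @^-1` [set r]) x)%:E).
  by apply/measurable_EFinP; exact: measurable_funM.
rewrite ge0_integral_fsum//; last by move=> m y _; exact: nnfun_muleindic_ge0.
transitivity (\int[mu]_x (\sum_(y \in range (h n))
    (y * \1_(h n @^-1` [set y]) x)%:E * (k x)%:E)).
  under [RHS]eq_integral => x xE.
    rewrite -ge0_mule_fsuml => [|y]; last exact: nnfun_muleindic_ge0.
    rewrite fsumEFin // -(fimfunE _ x); over.
  by [].
rewrite ge0_integral_fsum//; last 2 first.
- by move=> y; exact: emeasurable_funM.
- move=> m y _; rewrite mule_ge0 ?lee_fin//.
  by have := nnfun_muleindic_ge0 (h n) m y; rewrite -EFinM.
apply: eq_fsbigr => r rhn.
have r0 : 0 <= r%:E by move: rhn; rewrite inE => -[t _ <-]; rewrite lee_fin.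
under [RHS]eq_integral do rewrite EFinM.
rewrite integralZl_indic_nnsfun => //.
under eq_integral do rewrite EFinM -muleA.
rewrite ge0_integralZl//.
- under eq_integral do rewrite muleC.
  rewrite (eq_integral ((fun x => (k x)%:E) \_ (h n @^-1` [set r]))); last first.
    by move=> x xE; rewrite epatch_indic.
  by rewrite -integral_mkcond -nuE// integral_indic// setIT.
- by apply: emeasurable_funM => //; exact/measurable_EFinP.
- by move=> t Et; rewrite mule_ge0 ?lee_fin.
Qed.

End Density.

(** * The standard Gaussian measure as a product measure *)

Section GaussianMeasure.
Context {R : realType}.
Local Open Scope ereal_scope.
Local Notation leb := (@lebesgue_measure R).
Local Notation N01 := (@normal_prob R 0 1).

Definition mfun_cons_Rn n : {mfun (measurableTypeR R * Rn R n)%type >-> Rn R n.+1} :=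
  HB.pack (@cons_Rn R n) (isMeasurableFun.Build _ _ _ _ _ (@measurable_cons_Rn R n)).

(** Follows the recursion of [lebesgue_Rn], so that both the density formula and the product formula
    on boxes are inductions on [n]. *)
Fixpoint gauss_Rn n : probability (Rn R n) R :=
  match n with
  | 0 => dirac ([tuple] : Rn R 0)
  | n'.+1 => distribution (N01 \x gauss_Rn n') (mfun_cons_Rn n')
  end.

Lemma ge0_integral_normal_prob (f : R -> \bar R) :
  measurable_fun setT f -> (forall x, 0 <= f x) ->
  \int[N01]_x f x = \int[leb]_x (f x * (normal_pdf 0 1 x)%:E).
Proof.
move=> mf f0; apply: ge0_integral_density => //.
- exact: measurable_normal_pdf.
- exact: normal_pdf_ge0.
Qed.

Lemma ge0_integral_gauss_RnS n (f : Rn R n.+1 -> \bar R) :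
  measurable_fun setT f -> (forall x, 0 <= f x) ->
  \int[gauss_Rn n.+1]_x f x = \int[N01]_x \int[gauss_Rn n]_t f (cons_Rn (x, t)).
Proof.
move=> mf f0; rewrite /= ge0_integral_distribution//.
rewrite fubini_tonelli1//; last by move=> x; exact: f0.
by apply: measurableT_comp => //; exact: measurable_cons_Rn.
Qed.

Lemma measurable_gaussian_density n : measurable_fun setT (@gaussian_density R n).
Proof.
apply: measurable_funM => //; apply: measurableT_comp => //.
apply: measurableT_comp => //; apply: measurable_funM => //.
by apply: measurable_sum => i; apply: measurable_funX; exact: measurable_tnth.
Qed.

Lemma gaussian_density_gt0 n (x : Rn R n) : (0 < gaussian_density x)%R.
Proof. by rewrite mulr_gt0 ?expR_gt0// powR_gt0// mulr_gt0// pi_gt0. Qed.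

Lemma gaussian_density_cons n x (t : Rn R n) :
  gaussian_density (cons_Rn (x, t)) = (normal_pdf 0 1 x * gaussian_density t)%R.
Proof.
rewrite /gaussian_density big_ord_recl tnth0 (mulrDr (1 / 2)%R) opprD expRD.
under eq_bigr do rewrite tnthS.
rewrite normal_pdfE ?oner_neq0// /normal_peak /normal_fun subr0 expr1n !mul1r.
rewrite -powR12_sqrt; last by rewrite mulrn_wge0// pi_ge0.
rewrite -powRN (_ : - (n.+1%:R / 2) = - 2^-1 - n%:R / 2)%R; last first.
  by rewrite -(natr1 n); field.
rewrite powRD; last by rewrite mulf_neq0 ?implybT// gt_eqF// pi_gt0.
rewrite powRN (_ : pi *+ 2 = 2 * pi)%R ?mulr_natl// (_ : - x ^+ 2 / 2 = - (2^-1 * x ^+ 2))%R.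
  by rewrite powRN mulrACA.
by field.
Qed.

Lemma ge0_integral_gauss_Rn n (f : Rn R n -> \bar R) :
  measurable_fun setT f -> (forall x, 0 <= f x) ->
  \int[gauss_Rn n]_x f x = \int[lebesgue_Rn n]_x (f x * (gaussian_density x)%:E).
Proof.
elim: n => [|n IH] in f *.
  move=> mf f0; rewrite /= !integral_dirac//; last first.
    apply: emeasurable_funM => //; apply/measurable_EFinP.
    exact: measurable_gaussian_density.
  rewrite !diracE !in_setT !mul1e /gaussian_density big_ord0 mulr0 oppr0 expR0.
  by rewrite mul0r oppr0 powRr0 mulr1 mule1.
move=> mf f0; rewrite ge0_integral_gauss_RnS//.
have mf' : measurable_fun setT (fun z => f (cons_Rn z)).
  by apply: measurableT_comp => //; exact: measurable_cons_Rn.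
have mg k : measurable_fun setT (fun x => (@gaussian_density R k x)%:E).
  by apply/measurable_EFinP; exact: measurable_gaussian_density.
rewrite ge0_integral_normal_prob//; last 2 first.
- exact: (@measurable_fun_fubini_tonelli_F _ _ _ _ _ (gauss_Rn n) (fun z => f (cons_Rn z))).
- by move=> x; exact: integral_ge0.
rewrite ge0_integral_lebesgue_RnS; last 2 first.
- by apply: emeasurable_funM; [exact: mf|exact: mg].
- by move=> x; rewrite mule_ge0// lee_fin ltW// gaussian_density_gt0.
apply: eq_integral => x _; rewrite IH//; last first.
  by apply: (measurableT_comp mf'); exact: measurable_pair1.
rewrite -ge0_integralZr//; last 3 first.
- apply: emeasurable_funM; last exact: mg.
  by apply: (measurableT_comp mf'); exact: measurable_pair1.
- by move=> t _; rewrite mule_ge0// lee_fin ltW// gaussian_density_gt0.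
- by rewrite lee_fin normal_pdf_ge0.
apply: eq_integral => t _.
by rewrite gaussian_density_cons EFinM -muleA; congr (_ * _); rewrite muleC.
Qed.

Definition box n (A : 'I_n -> set (measurableTypeR R)) : set (Rn R n) :=
  [set x | forall i, A i (tnth x i)].

Lemma measurable_box n (A : 'I_n -> set (measurableTypeR R)) :
  (forall i, measurable (A i)) -> measurable (box A).
Proof.
move=> mA; rewrite (_ : box A = \bigcap_(i in [set: 'I_n]) ((@tnth n _ ^~ i) @^-1` A i)).
  apply: fin_bigcap_measurable => // i _.
  by rewrite -[X in measurable X]setTI; exact: measurable_tnth.
by apply/seteqP; split => x /=; [move=> H i _; exact: H|move=> H i; exact: H].
Qed.

Lemma gauss_Rn_box n (A : 'I_n -> set (measurableTypeR R)) :
  (forall i, measurable (A i)) -> gauss_Rn n (box A) = \prod_(i < n) N01 (A i).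
Proof.
elim: n => [|n IH] in A *.
  by move=> _; rewrite big_ord0 /= diracE mem_set// => -[].
move=> mA; rewrite big_ord_recl -IH//= /distribution /pushforward.
rewrite -product_measure1E//; last exact: measurable_box.
congr (product_measure1 _ _ _); apply/seteqP; split => -[x t] /=.
  move=> H; split; first by have := H ord0; rewrite /cons_Rn tnth0.
  by move=> i; have := H (lift ord0 i); rewrite /cons_Rn tnthS.
move=> [Ax At] i; case: (unliftP ord0 i) => [j|] ->.
  by rewrite /cons_Rn tnthS; exact: At.
by rewrite /cons_Rn tnth0.
Qed.

(** Boxes are stable under intersection, and they contain the cylinders over one coordinate, which
    generate the sigma-algebra. *)
Lemma measure_Rn_box_unique n (m1 m2 : {measure set (Rn R n) -> \bar R}) :
  (forall A, (forall i, measurable (A i)) -> m1 (box A) = m2 (box A)) ->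
  m1 setT < +oo ->
  forall B, measurable B -> m1 B = m2 B.
Proof.
move=> m12 m1oo B mB.
pose G : set (set (Rn R n)) := [set box A | A in [set A | forall i, measurable (A i)]].
have GT : G setT by exists (fun=> setT) => //; apply/seteqP; split.
apply: (g_sigma_algebra_measure_unique G _ (fun=> setT)) => //.
- by move=> _ [A mA <-]; exact: measurable_box.
- by apply/seteqP; split => // x _; exists 0%N.
- move=> _ _ [A mA <-] [A' mA' <-]; exists (fun i => A i `&` A' i).
    by move=> i; exact: measurableI.
  apply/seteqP; split => [x H|x [H H'] i]; last by split.
  by split=> i; have [] := H i.
- by move=> _ [A mA <-]; exact: m12.
apply: smallest_sub mB; first exact: smallest_sigma_algebra.
rewrite -bigcup_seq => X [i _ [Y mY <-]]; apply: sub_sigma_algebra.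
exists (fun j => if j == i then Y else setT).
  by move=> j; case: ifP.
apply/seteqP; split => x /=.
  by move=> /(_ i); rewrite eqxx.
by move=> [_ Yx] j; case: eqP => [->|].
Qed.

Lemma gaussian_density_sqnorm n (x : Rn R n) : gaussian_density x =
  ((2 * pi) `^ (- (n%:R / 2)) *
   expR (- (1 / 2 * (row_of_Rn x *m (row_of_Rn x)^T) 0%R 0%R)))%R.
Proof.
congr (_ * expR (- (_ * _)))%R; rewrite mxE; apply: eq_bigr => i _.
by rewrite !mxE expr2.
Qed.

Lemma orthogonal_mx_norm_det n (Q : 'M[R]_n) : Q *m Q^T = 1%:M -> `|\det Q|%R = 1%R.
Proof.
move=> QQ; apply/eqP; rewrite -(@eqrXn2 _ 2)// -normrX expr1n expr2.
by rewrite -{2}det_tr -det_mulmx QQ det1 normr1.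
Qed.

(** The density depends on the norm only, and an orthogonal matrix has determinant of absolute value
    one. *)
Lemma ge0_integral_gauss_Rn_orthogonal n (Q : 'M[R]_n) (f : Rn R n -> \bar R) :
  Q *m Q^T = 1%:M -> measurable_fun setT f -> (forall x, 0 <= f x) ->
  \int[gauss_Rn n]_x f (Rn_of_row (row_of_Rn x *m Q)) = \int[gauss_Rn n]_x f x.
Proof.
move=> QQ mf f0; rewrite !ge0_integral_gauss_Rn//; last first.
  by apply: measurableT_comp => //; exact: measurable_mulmx_Rn.
have uQ : Q \in unitmx by have [] := mulmx1_unit QQ.
rewrite -[RHS](unitmx_linear_scaling uQ); last 2 first.
- apply: emeasurable_funM => //; apply/measurable_EFinP.
  exact: measurable_gaussian_density.
- by move=> x; rewrite mule_ge0// lee_fin ltW// gaussian_density_gt0.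
rewrite orthogonal_mx_norm_det// mul1e; apply: eq_integral => x _.
congr (_ * _%:E); rewrite !gaussian_density_sqnorm Rn_of_rowK trmx_mul.
by rewrite mulmxA -(mulmxA _ Q) QQ mulmx1.
Qed.

Lemma standard_gaussian_distribution n d (T : measurableType d) (P : probability T R)
    (X : {RV P >-> Rn R n}) : standard_gaussian P X ->
  forall A, measurable A -> distribution P X A = gauss_Rn n A.
Proof.
move=> hX A mA; rewrite hX//.
transitivity (\int[gauss_Rn n]_x (\1_A x)%:E); last by rewrite integral_indic// setIT.
rewrite ge0_integral_gauss_Rn//; last exact/measurable_EFinP.
rewrite integral_mkcond; apply: eq_integral => x _.
by rewrite epatch_indic muleC.
Qed.

End GaussianMeasure.

(** * Gaussian matrices *)

Section GaussianFamily.
Context {R : realType}.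
Local Open Scope ereal_scope.
Local Notation N01 := (@normal_prob R 0 1).

Section family.
Context (I : finType) d (T : measurableType d) (P : probability T R).
Implicit Types xi : I -> T -> R.

(** Independence and standard normality in a single product formula over the whole index set;
    subfamilies are recovered by taking [setT] at the other indices. *)
Definition gaussian_family xi :=
  (forall i, measurable_fun setT (xi i)) /\
  forall A : I -> set (measurableTypeR R), (forall i, measurable (A i)) ->
    P [set w | forall i, A i (xi i w)] = \prod_i N01 (A i).

Definition family_tuple xi (w : T) : Rn R #|I| := [tuple xi (enum_val i) w | i < #|I|].

Lemma measurable_family_tuple xi : (forall i, measurable_fun setT (xi i)) ->
  measurable_fun setT (family_tuple xi).
Proof.
move=> mxi; apply/measurable_fun_tnthP => i.
rewrite (_ : _ \o _ = xi (enum_val i)); first exact: mxi.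
by apply/funext => w/=; rewrite tnth_mktuple.
Qed.

Lemma gaussian_family_tuple xi B : gaussian_family xi -> measurable B ->
  P (family_tuple xi @^-1` B) = gauss_Rn #|I| B.
Proof.
move=> [mxi hxi] mB.
pose f : {mfun T >-> Rn R #|I|} :=
  HB.pack (family_tuple xi) (isMeasurableFun.Build _ _ _ _ _ (measurable_family_tuple mxi)).
apply: (measure_Rn_box_unique (m1 := distribution P f)) mB; last first.
  by rewrite /= /distribution /pushforward preimage_setT probability_setT ltry.
move=> A mA; etransitivity; last by symmetry; exact: gauss_Rn_box.
rewrite /= /distribution /pushforward.
rewrite (_ : _ @^-1` _ = [set w | forall i, A (enum_rank i) (xi i w)]); last first.
  apply/seteqP; split => w /= H i.
    by have := H (enum_rank i); rewrite tnth_mktuple enum_rankK.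
  by rewrite tnth_mktuple; have := H (enum_val i); rewrite enum_valK.
rewrite (hxi (fun i => A (enum_rank i)))// (reindex (@enum_val I I)); last by apply: onW_bij; exact: enum_val_bij.
by apply: eq_bigr => i _; rewrite enum_valK.
Qed.

Lemma integral_gaussian_family xi (F : Rn R #|I| -> \bar R) : gaussian_family xi ->
  measurable_fun setT F -> (forall x, 0 <= F x) ->
  \int[P]_w F (family_tuple xi w) = \int[gauss_Rn #|I|]_x F x.
Proof.
move=> gxi mF F0.
pose f : {mfun T >-> Rn R #|I|} :=
  HB.pack (family_tuple xi) (isMeasurableFun.Build _ _ _ _ _ (measurable_family_tuple gxi.1)).
rewrite -[LHS](@ge0_integral_distribution _ _ _ _ _ P f)//.
by apply: eq_measure_integral => A mA _; exact: gaussian_family_tuple.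
Qed.

(** Indices outside the image of [s] receive the full set, of probability one. This serves
    transposes, submatrices and the stacking of a row on a matrix. *)
Lemma gaussian_family_inj (J : finType) (s : J -> I) xi : injective s ->
  gaussian_family xi ->
  (forall j, measurable_fun setT (xi (s j))) /\
  forall A : J -> set (measurableTypeR R), (forall i, measurable (A i)) ->
    P [set w | forall j, A j (xi (s j) w)] = \prod_j N01 (A j).
Proof.
move=> sI [mxi hxi]; split=> [j|A mA]; first exact: mxi.
pose A' i := if [pick j | s j == i] is Some j then A j else setT.
have A's j : A' (s j) = A j.
  by rewrite /A'; case: pickP => [j' /eqP/sI ->//|/(_ j)]; rewrite eqxx.
rewrite (_ : [set w | _] = [set w | forall i, A' i (xi i w)]); last first.
  apply/seteqP; split => w /= H i; last by have := H (s i); rewrite A's.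
  by rewrite /A'; case: pickP => [j /eqP <-|].
rewrite hxi; last by move=> i; rewrite /A'; case: pickP.
rewrite (bigID (mem (codom s))) /= -big_uniq; last first.
  by rewrite map_inj_uniq ?enum_uniq.
rewrite codomE big_map big_enum/=.
rewrite [X in _ * X]big1 ?mule1; last first.
  move=> i /codomP iNs; rewrite /A'; case: pickP => [j /eqP ij|_].
    by exfalso; apply: iNs; exists j.
  exact: probability_setT.
by apply: eq_bigr => j _; rewrite A's.
Qed.

Lemma gaussian_family_orthogonal xi (Q : I -> I -> R) :
  (forall i j, \sum_k Q i k * Q j k = (i == j)%:R)%R ->
  gaussian_family xi -> gaussian_family (fun j w => \sum_i xi i w * Q i j)%R.
Proof.
move=> QQ gxi; split=> [j|A mA].
  by apply: measurable_sum => i; apply: measurable_funM => //; exact: gxi.1.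
pose Q' : 'M[R]_#|I| := \matrix_(a, b) Q (enum_val a) (enum_val b).
have QQ' : Q' *m Q'^T = 1%:M.
  apply/matrixP => a b; rewrite !mxE -(inj_eq (@enum_val_inj _ _)) -QQ.
  rewrite (reindex (@enum_val I I)); last by apply: onW_bij; exact: enum_val_bij.
  by apply: eq_bigr => c _; rewrite !mxE.
pose B := box (fun i : 'I_#|I| => A (enum_val i)).
have mB : measurable B by apply: measurable_box.
have mQ : measurable ((fun x : Rn R #|I| => Rn_of_row (row_of_Rn x *m Q')) @^-1` B).
  by rewrite -[X in measurable X]setTI; exact: measurable_mulmx_Rn.
rewrite (_ : [set w | _] = family_tuple xi @^-1`
    ((fun x : Rn R #|I| => Rn_of_row (row_of_Rn x *m Q')) @^-1` B)); last first.
  have E w i : tnth (Rn_of_row (row_of_Rn (family_tuple xi w) *m Q')) (enum_rank i) =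
      (\sum_j xi j w * Q j i)%R.
    rewrite tnth_mktuple mxE [RHS](reindex (@enum_val I I)).
      by apply: eq_bigr => j _; rewrite !mxE tnth_mktuple enum_rankK.
    by apply: onW_bij; exact: enum_val_bij.
  apply/seteqP; split => w /= H i.
    by rewrite -[i]enum_valK E enum_valK; exact: H.
  by rewrite -E; have := H (enum_rank i); rewrite enum_rankK.
rewrite gaussian_family_tuple//.
transitivity (\int[gauss_Rn #|I|]_x (\1_B x)%:E).
  rewrite -(ge0_integral_gauss_Rn_orthogonal QQ')//; last first.
    by apply/measurable_EFinP.
  by rewrite -[in LHS](setIT (_ @^-1` B)) -integral_indic.
rewrite integral_indic// setIT; etransitivity; first exact: gauss_Rn_box.
rewrite [RHS](reindex (@enum_val I I))//; apply: onW_bij; exact: enum_val_bij.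
Qed.

End family.

Lemma gaussian_family_tnth n :
  gaussian_family (gauss_Rn n) (fun (i : 'I_n) (x : Rn R n) => tnth x i).
Proof. by split=> [i|A mA]; [exact: measurable_tnth|rewrite -gauss_Rn_box]. Qed.

Lemma gaussian_family_prod (I1 I2 : finType) d1 d2 (T1 : measurableType d1)
    (T2 : measurableType d2) (P1 : probability T1 R) (P2 : probability T2 R)
    (xi1 : I1 -> T1 -> R) (xi2 : I2 -> T2 -> R) :
  gaussian_family P1 xi1 -> gaussian_family P2 xi2 ->
  gaussian_family (P1 \x P2) (fun (s : (I1 + I2)%type) z =>
    match s with inl i => xi1 i z.1 | inr j => xi2 j z.2 end).
Proof.
move=> [m1 h1] [m2 h2]; split=> [[i|j]|A mA].
- by apply: measurableT_comp => //; exact: m1.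
- by apply: measurableT_comp => //; exact: m2.
have mA1 : measurable [set w | forall i, A (inl i) (xi1 i w)].
  rewrite (_ : mkset _ = \bigcap_(i in [set: I1]) (xi1 i @^-1` A (inl i))).
    apply: fin_bigcap_measurable => // i _.
    by rewrite -[X in measurable X]setTI; exact: (m1 i measurableT _ (mA _)).
  by apply/seteqP; split => x /=; [move=> H i _; exact: H|move=> H i; exact: H].
have mA2 : measurable [set w | forall i, A (inr i) (xi2 i w)].
  rewrite (_ : mkset _ = \bigcap_(i in [set: I2]) (xi2 i @^-1` A (inr i))).
    apply: fin_bigcap_measurable => // i _.
    by rewrite -[X in measurable X]setTI; exact: (m2 i measurableT _ (mA _)).
  by apply/seteqP; split => x /=; [move=> H i _; exact: H|move=> H i; exact: H].
rewrite big_sumType -h1// -h2//.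
etransitivity; last exact: product_measure1E.
congr (product_measure1 _ _ _); apply/seteqP; split => -[x y] /=.
  by move=> H; split=> i; [exact: (H (inl i))|exact: (H (inr i))].
by move=> [H1 H2] [i|i]; [exact: H1|exact: H2].
Qed.

Definition gaussian_matrix p n d (T : measurableType d) (P : probability T R)
    (G : T -> 'M[R]_(p, n)) :=
  gaussian_family P (fun (ij : 'I_p * 'I_n) w => G w ij.1 ij.2).

Definition Rn_matrix p n (x : Rn R #|{: 'I_p * 'I_n}|) : 'M[R]_(p, n) :=
  \matrix_(i, j) tnth x (enum_rank (i, j)).

Lemma mx_measurable_Rn_matrix p n : mx_measurable (@Rn_matrix p n).
Proof. by move=> i j; under eq_fun do rewrite mxE; exact: measurable_tnth. Qed.

Lemma gaussian_matrix_Rn_matrix p n : gaussian_matrix (gauss_Rn _) (@Rn_matrix p n).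
Proof.
have := @gaussian_family_inj _ _ _ _ _ (@enum_rank ('I_p * 'I_n)%type) _
  (@enum_rank_inj _) (gaussian_family_tnth _).
rewrite /gaussian_matrix (_ : (fun _ _ => _) = fun ij => (@tnth _ _)^~ (enum_rank ij))//.
by apply/funext => -[i j]; apply/funext => x; rewrite mxE.
Qed.

Section matrix_family.
Context d (T : measurableType d) (P : probability T R).

Lemma gaussian_matrix_measurable p n (G : T -> 'M[R]_(p, n)) :
  gaussian_matrix P G -> mx_measurable G.
Proof. by move=> [mG _] i j; exact: (mG (i, j)). Qed.

(** Only the law of [G] matters. A Gaussian matrix can thus be exchanged for one on a product space
    where the first row is a separate factor. *)
Lemma integral_gaussian_matrix p n (G : T -> 'M[R]_(p, n)) (F : 'M[R]_(p, n) -> \bar R) :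
  gaussian_matrix P G ->
  measurable_fun setT (fun x => F (Rn_matrix x)) -> (forall x, 0 <= F x) ->
  \int[P]_w F (G w) = \int[gauss_Rn _]_x F (Rn_matrix x).
Proof.
move=> gG mF F0.
rewrite -(integral_gaussian_family (F := fun x => F (Rn_matrix x)) gG)//.
apply: eq_integral => w _; congr F; apply/matrixP => i j.
by rewrite mxE tnth_mktuple enum_rankK.
Qed.

Lemma gaussian_matrix_reindex p n p' n' (s : 'I_p' * 'I_n' -> 'I_p * 'I_n)
    (G : T -> 'M[R]_(p, n)) (G' : T -> 'M[R]_(p', n')) : injective s ->
  (forall w i j, G' w i j = G w (s (i, j)).1 (s (i, j)).2) ->
  gaussian_matrix P G -> gaussian_matrix P G'.
Proof.
move=> sI G'E gG; have := gaussian_family_inj sI gG.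
rewrite /gaussian_matrix (_ : (fun _ w => G' w _ _) =
  fun ij w => G w (s ij).1 (s ij).2)//.
by apply/funext => -[i j]; apply/funext => w; rewrite G'E.
Qed.

Lemma gaussian_matrix_tr p n (G : T -> 'M[R]_(p, n)) :
  gaussian_matrix P G -> gaussian_matrix P (fun w => (G w)^T).
Proof.
apply: (@gaussian_matrix_reindex _ _ _ _ (fun ij => (ij.2, ij.1))).
  by move=> [? ?] [? ?] /= [-> ->].
by move=> w i j; rewrite mxE.
Qed.

Lemma gaussian_matrix_rsub p m n (G : T -> 'M[R]_(p, m + n)) :
  gaussian_matrix P G -> gaussian_matrix P (fun w => rsubmx (G w)).
Proof.
apply: (@gaussian_matrix_reindex _ _ _ _ (fun ij => (ij.1, rshift m ij.2))).
  by move=> [? ?] [? ?] /= [-> /addnI/val_inj ->].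
by move=> w i j; rewrite mxE.
Qed.

Lemma gaussian_matrix_mulr p n (G : T -> 'M[R]_(p, n)) (Q : 'M[R]_n) :
  Q *m Q^T = 1%:M -> gaussian_matrix P G -> gaussian_matrix P (fun w => G w *m Q).
Proof.
move=> QQ gG.
(* The Kronecker product of the identity with [Q]: right multiplication by [Q] seen as one
   orthogonal map on all entries. *)
pose Q' (a b : 'I_p * 'I_n) : R := ((a.1 == b.1)%:R * Q a.2 b.2)%R.
have QQ' a b : (\sum_k Q' a k * Q' b k = (a == b)%:R)%R.
  rewrite -(pair_bigA _ (fun i j => Q' a (i, j) * Q' b (i, j)))%R /=.
  rewrite (bigD1 a.1)//= [X in (_ + X)%R]big1 ?addr0; last first.
    move=> i /negbTE ia; rewrite big1// => j _.
    by rewrite /Q'/= eq_sym ia !mul0r.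
  transitivity ((a.1 == b.1)%:R * (Q *m Q^T) a.2 b.2)%R.
    rewrite mxE mulr_sumr; apply: eq_bigr => j _.
    by rewrite /Q'/= eqxx mul1r !mxE mulrCA eq_sym.
  by rewrite QQ mxE -natrM mulnb.
have := gaussian_family_orthogonal QQ' gG.
rewrite /gaussian_matrix; congr gaussian_family.
apply/funext => -[i j]; apply/funext => w /=; rewrite mxE.
rewrite -(pair_bigA _ (fun i' k => G w i' k * Q' (i', k) (i, j)))%R /=.
rewrite (bigD1 i)//= [X in (_ + X)%R]big1 ?addr0; last first.
  by move=> i' /negbTE ia; rewrite big1// => k _; rewrite /Q'/= ia mul0r mulr0.
by apply: eq_bigr => k _; rewrite /Q'/= eqxx mul1r.
Qed.

End matrix_family.

Lemma gaussian_matrix_mull p n d (T : measurableType d) (P : probability T R)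
    (G : T -> 'M[R]_(p, n)) (Q : 'M[R]_p) :
  Q *m Q^T = 1%:M -> gaussian_matrix P G -> gaussian_matrix P (fun w => Q^T *m G w).
Proof.
move=> QQ gG.
have := gaussian_matrix_tr (gaussian_matrix_mulr QQ (gaussian_matrix_tr gG)).
congr gaussian_matrix; apply/funext => w; by rewrite trmx_mul trmxK.
Qed.

Definition consrow_Rn p n (z : Rn R n * Rn R #|{: 'I_p * 'I_n}|) : 'M[R]_(1 + p, n) :=
  col_mx (row_of_Rn z.1) (Rn_matrix z.2).

Lemma gaussian_matrix_consrow p n : gaussian_matrix
  (gauss_Rn n \x gauss_Rn #|{: 'I_p * 'I_n}|) (@consrow_Rn p n).
Proof.
pose s (ij : 'I_(1 + p) * 'I_n) : 'I_n + 'I_#|{: 'I_p * 'I_n}| :=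
  match fintype.split ij.1 with inl _ => inl ij.2 | inr i => inr (enum_rank (i, ij.2)) end.
have sI : injective s.
  move=> [i j] [i' j']; rewrite /s/= -{2}(splitK i) -{2}(splitK i').
  case: (fintype.split i) => a; case: (fintype.split i') => b //=.
    by move=> [->]; rewrite (ord1 a) (ord1 b).
  by move=> [/enum_rank_inj[-> ->]].
have := gaussian_family_inj sI
  (gaussian_family_prod (gaussian_family_tnth n) (gaussian_family_tnth _)).
rewrite /gaussian_matrix (_ : (fun ij w => consrow_Rn w ij.1 ij.2) = fun ij z =>
  match s ij with inl i => tnth z.1 i | inr j => tnth z.2 j end)//.
apply/funext => -[i j]; apply/funext => z; rewrite /s/= mxE.
by case: fintype.split => a; rewrite !mxE.
Qed.

End GaussianFamily.

(** * Householder reflections and Gram determinants *)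

Section Householder.
Context {R : realType}.

Lemma mx11_tr_sum n (v : 'rV[R]_n) : (v *m v^T) 0 0 = \sum_i v 0 i ^+ 2.
Proof. by rewrite mxE; apply: eq_bigr => i _; rewrite mxE expr2. Qed.

Lemma sqnorm_ge0 n (v : 'rV[R]_n) : 0 <= (v *m v^T) 0 0.
Proof. by rewrite mx11_tr_sum sumr_ge0// => i _; exact: sqr_ge0. Qed.

Lemma sqnorm_eq0 n (v : 'rV[R]_n) : ((v *m v^T) 0 0 == 0) = (v == 0).
Proof.
apply/eqP/eqP => [|->]; last by rewrite mul0mx mxE.
rewrite mx11_tr_sum => /eqP; rewrite psumr_eq0; last by move=> i _; exact: sqr_ge0.
move=> /allP H; apply/rowP => i; rewrite mxE; apply/eqP.
by have := H i (mem_index_enum _); rewrite /= sqrf_eq0.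
Qed.

(** Since [v] and [a *: e] have the same norm, the reflection along their difference [w] exchanges
    them; if [w = 0] the identity does. *)
Lemma householder n (v : 'rV[R]_(1 + n)) : exists Q : 'M[R]_(1 + n),
  [/\ Q *m Q^T = 1%:M, Q^T *m Q = 1%:M &
      v *m Q = row_mx (Num.sqrt ((v *m v^T) 0 0))%:M 0].
Proof.
set a := Num.sqrt _; pose e : 'rV[R]_(1 + n) := row_mx 1%:M 0.
have -> : row_mx a%:M 0 = a *: e.
  by rewrite scale_row_mx scaler0 scalemx1.
pose w := v - a *: e.
have [w0|w0] := eqVneq w 0.
  exists 1%:M; rewrite trmx1 mulmx1; split => //.
  by rewrite mulmx1; apply/eqP; rewrite -subr_eq0 -/w w0.
have vv : v *m v^T = (a ^+ 2)%:M.
  by rewrite [LHS]mx11_scalar sqr_sqrtr// sqnorm_ge0.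
have ee : e *m e^T = 1%:M.
  by rewrite tr_row_mx mul_row_col trmx1 mulmx1 mul0mx addr0.
pose t := (w *m w^T) 0 0.
have t0 : t != 0 by rewrite sqnorm_eq0.
have wwT : w *m w^T = t%:M by rewrite [LHS]mx11_scalar.
have ve : e *m v^T = v *m e^T.
  by rewrite [LHS]mx11_scalar [RHS]mx11_scalar; congr _%:M;
    rewrite -[in LHS](trmxK e) -trmx_mul mxE.
have wT : w^T = v^T - a *: e^T by rewrite /w linearB linearZ.
(* Equality of the norms of [v] and [a *: e] makes the product of [v] with [w] half of the squared
   norm of [w]. *)
have vw : v *m w^T = (t / 2)%:M.
  have E : w *m w^T = 2 *: (v *m w^T).
    rewrite wT /w mulmxBr !mulmxBl mulmxBr -!scalemxAr -!scalemxAl ve ee vv.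
    rewrite scaler_nat mulr2n scalerA -expr2 scalemx1.
    by rewrite opprB.
  have tE : t = 2 * (v *m w^T) 0 0 by rewrite /t E mxE.
  by rewrite [LHS]mx11_scalar; congr _%:M; rewrite tE; field.
have wE : v - w = a *: e by rewrite /w opprB addrC subrK.
clearbody w.
pose Q : 'M[R]_(1 + n) := 1%:M - (2 / t) *: (w^T *m w).
have QT : Q^T = Q by rewrite /Q linearB linearZ/= trmx1 trmx_mul trmxK.
have QQ : Q *m Q = 1%:M.
  have SS : (w^T *m w) *m (w^T *m w) = t *: (w^T *m w).
    by rewrite -mulmxA (mulmxA w) wwT mul_scalar_mx -scalemxAr.
  rewrite {1}/Q mulmxBl mul1mx -scalemxAl /Q mulmxBr mulmx1 -scalemxAr SS.
  rewrite scalerBr !scalerA (_ : 2 / t * (2 / t) * t = 2 / t + 2 / t); last by field.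
  by rewrite scalerDl opprB addrK subrK.
exists Q; rewrite QT; split=> //.
rewrite /Q mulmxBr mulmx1 -scalemxAr mulmxA vw mul_scalar_mx scalerA.
rewrite (_ : 2 / t * (t / 2) = 1); last by field.
by rewrite scale1r wE.
Qed.

(** One step of the reduction: once the first row is [a] times the first basis vector, the column
    [c] below it disappears from the Gram determinant, as a block triangular factorization of
    [M *m M^T] shows. *)
Lemma det_gram_block p n (a : R) (c : 'cV[R]_p) (G : 'M[R]_(p, n)) :
  let M : 'M[R]_(1 + p, 1 + n) := block_mx a%:M 0 c G in
  \det (M *m M^T) = a ^+ 2 * \det (G *m G^T).
Proof.
move=> M; have -> : M *m M^T = (block_mx a%:M 0 c 1%:M : 'M[R]_(1 + p)) *m
    (block_mx a%:M c^T 0 (G *m G^T) : 'M[R]_(1 + p)).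
  rewrite /M tr_block_mx !mulmx_block !trmx0 !mulmx0 !mul0mx !addr0 tr_scalar_mx.
  by rewrite mul1mx.
by rewrite det_mulmx det_lblock det_ublock det_scalar1 det1 mulr1 mulrA expr2.
Qed.

Lemma det_gram_mulr p n (G : 'M[R]_(p, n)) (Q : 'M[R]_n) : Q *m Q^T = 1%:M ->
  \det ((G *m Q) *m (G *m Q)^T) = \det (G *m G^T).
Proof. by move=> QQ; rewrite trmx_mul mulmxA -(mulmxA G) QQ mulmx1. Qed.

End Householder.

(** * The law of the logarithm of the squared norm *)

Section WeightedMeasure.
Local Open Scope ereal_scope.
Context d (T : measurableType d) (R : realType).
Variables (mu : {measure set T -> \bar R}) (k : T -> R).
Hypotheses (mk : measurable_fun setT k) (k0 : forall x, (0 <= k x)%R).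

(** Packaged as a measure so that it can be compared on intervals with an image measure. *)
Definition weighted_measure (A : set T) : \bar R := \int[mu]_(x in A) (k x)%:E.

Let weighted0 : weighted_measure set0 = 0.
Proof. by rewrite /weighted_measure integral_set0. Qed.

Let weighted_ge0 A : 0 <= weighted_measure A.
Proof. by apply: integral_ge0 => x _; rewrite lee_fin. Qed.

Let weighted_sigma_additive : semi_sigma_additive weighted_measure.
Proof.
move=> F mF tF mUF; rewrite /weighted_measure ge0_integral_bigcup//.
- apply: is_cvg_ereal_nneg_natsum_cond => n _ _.
  by apply: integral_ge0 => x _; rewrite lee_fin.
- by apply: measurable_funTS; exact/measurable_EFinP.
- by move=> x _; rewrite lee_fin.
Qed.

HB.instance Definition _ := isMeasure.Build _ _ _ weighted_measure
  weighted0 weighted_ge0 weighted_sigma_additive.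

Definition weighted : {measure set T -> \bar R} := weighted_measure.

End WeightedMeasure.

Section LebesgueSets.
Context {R : realType}.
Local Open Scope ereal_scope.
Local Notation leb := (@lebesgue_measure R).

Lemma lebesgue_RnS_E n (S : set (Rn R n.+1)) : lebesgue_Rn n.+1 S =
  \int[leb]_x lebesgue_Rn n (xsection (@cons_Rn R n @^-1` S) x).
Proof. by []. Qed.

(** At most one section is nonempty. [S] is an arbitrary set, because the recursion defines the
    measure of any set by integrating over its sections; the preimage of a degenerate simplex can be
    inserted directly. *)
Lemma lebesgue_Rn_slice n (S : set (Rn R n.+1)) (c : R) :
  (forall x, S x -> tnth x ord0 = c) -> lebesgue_Rn n.+1 S = 0.
Proof.
move=> Sc; rewrite lebesgue_RnS_E; set g := fun x => _.
rewrite (_ : g = g \_ [set c]); first by rewrite -integral_mkcond integral_set1.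
apply/funext => x; rewrite patchE; case: ifPn => //.
rewrite notin_setE /= => xc; rewrite /g (_ : xsection _ _ = set0) ?measure0//.
apply/seteqP; split => t //; rewrite /xsection/= inE /= => /Sc.
by rewrite /cons_Rn tnth0.
Qed.

Lemma lebesgue_Rn_box n (A : 'I_n -> set (measurableTypeR R)) :
  (forall i, measurable (A i)) -> lebesgue_Rn n (box A) = \prod_(i < n) leb (A i).
Proof.
elim: n => [|n IH] in A *.
  by move=> _; rewrite big_ord0 /= diracE mem_set// => -[].
move=> mA; rewrite big_ord_recl -IH//.
transitivity ((leb \x lebesgue_Rn n) (A ord0 `*` box (fun i => A (lift ord0 i)))).
  congr (product_measure1 _ _ _); apply/seteqP; split => -[x t] /=.
    move=> H; split; first by have := H ord0; rewrite /cons_Rn tnth0.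
    by move=> i; have := H (lift ord0 i); rewrite /cons_Rn tnthS.
  move=> [Ax At] i; case: (unliftP ord0 i) => [j|] ->.
    by rewrite /cons_Rn tnthS; exact: At.
  by rewrite /cons_Rn tnth0.
by apply: product_measure1E => //; exact: measurable_box.
Qed.

End LebesgueSets.

Section Radial.
Context {R : realType}.
Local Open Scope ereal_scope.
Local Notation leb := (@lebesgue_measure R).

Definition sqn n (x : Rn R n) : R := (\sum_(i < n) tnth x i ^+ 2)%R.

Lemma sqn_mx n (x : Rn R n) : sqn x = (row_of_Rn x *m (row_of_Rn x)^T) 0%R 0%R.
Proof. by rewrite mx11_tr_sum; apply: eq_bigr => i _; rewrite mxE. Qed.

Lemma sqn_ge0 n (x : Rn R n) : (0 <= sqn x)%R.
Proof. by rewrite sumr_ge0// => i _; exact: sqr_ge0. Qed.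

Lemma measurable_sqn n : measurable_fun setT (@sqn n).
Proof.
by apply: measurable_sum => i; apply: measurable_funX; exact: measurable_tnth.
Qed.

(** The value at the origin is a default of [ln]; the arguments below cut out the null set [Z] where
    it occurs. *)
Definition lnsq n (x : Rn R n) : measurableTypeR R := ln (sqn x).

Lemma measurable_lnsq n : measurable_fun setT (@lnsq n).
Proof.
apply: (measurableT_comp (@measurable_ln R)); exact: measurable_sqn.
Qed.

Let Z n : set (Rn R n) := [set x | sqn x = 0%R].

Arguments Z : clear implicits.

Let mZ n : measurable (Z n).
Proof.
rewrite (_ : Z n = @sqn n @^-1` [set 0%R])//.
by apply: measurable_preimage; [exact: measurable_sqn|exact: measurable_set1].
Qed.

Let lebZ n : lebesgue_Rn n.+1 (Z n.+1) = 0.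
Proof.
apply: (@lebesgue_Rn_slice _ _ _ 0%R) => x /eqP.
rewrite psumr_eq0; last by move=> i _; exact: sqr_ge0.
by move=> /allP/(_ ord0 (mem_index_enum _)) /=; rewrite sqrf_eq0 => /eqP.
Qed.

Let B n (t : R) : set (Rn R n) := [set x | (sqn x <= t)%R].

Arguments B : clear implicits.

Let mB n t : measurable (B n t).
Proof.
rewrite (_ : B n t = @sqn n @^-1` `]-oo, t]); last first.
  by apply/seteqP; split => x; rewrite /B/= in_itv.
by apply: measurable_preimage; [exact: measurable_sqn|exact: measurable_itv].
Qed.

Let leb_B n (t : R) : (0 < t)%R ->
  lebesgue_Rn n (B n t) = (Num.sqrt t ^+ n)%:E * lebesgue_Rn n (B n 1).
Proof.
move=> t0; have s0 : (0 < Num.sqrt t)%R by rewrite sqrtr_gt0.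
have uA : (Num.sqrt t)%:M \in @unitmx R n.
  by rewrite unitmxE det_scalar unitfE expf_neq0// gt_eqF.
transitivity (\int[lebesgue_Rn n]_x (\1_(B n t) x)%:E).
  by rewrite integral_indic ?setIT//; exact: mB.
rewrite -(unitmx_linear_scaling uA)//; last first.
  by apply/measurable_EFinP; apply: measurable_indic; exact: mB.
rewrite det_scalar ger0_norm ?exprn_ge0 ?ltW//; congr (_ * _).
transitivity (\int[lebesgue_Rn n]_x (\1_(B n 1) x)%:E); last first.
  by rewrite integral_indic ?setIT//; exact: mB.
apply: eq_integral => x _; rewrite !indicE; congr (_%:R%:E); congr (nat_of_bool _).
apply/idP/idP; rewrite !inE /B/= !sqn_mx Rn_of_rowK trmx_mul tr_scalar_mx.
  rewrite mul_mx_scalar mul_scalar_mx -scalemxAl -scalemxAr scalerA -expr2.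
  rewrite sqr_sqrtr ?(ltW t0)// [X in (X <= t)%R -> _]mxE => H.
  by rewrite -(ler_pM2l t0) mulr1.
rewrite mul_mx_scalar mul_scalar_mx -scalemxAl -scalemxAr scalerA -expr2.
rewrite sqr_sqrtr ?(ltW t0)// [X in _ -> (X <= t)%R]mxE => H.
by rewrite -[leRHS]mulr1 (ler_pM2l t0).
Qed.

Let leb_B1_fin n : lebesgue_Rn n (B n 1) \is a fin_num.
Proof.
rewrite ge0_fin_numE//; apply: (@le_lt_trans _ _ (lebesgue_Rn n (box (fun=> `[(-1)%R, 1%R]%classic)))).
  apply: le_measure; rewrite ?inE.
  - exact: mB.
  - by apply: measurable_box => i; exact: measurable_itv.
  - move=> x; rewrite /B/= => xB i /=; rewrite in_itv/= -ler_norml.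
    rewrite -(@expr_le1 _ 2)// -normrX ger0_norm ?sqr_ge0//; apply: le_trans xB.
    rewrite /sqn (bigD1 i)//= lerDl sumr_ge0// => j _; exact: sqr_ge0.
rewrite lebesgue_Rn_box//.
under eq_bigr do rewrite lebesgue_measure_itv/= lte_fin (lt_trans (@ltrN10 R) ltr01) -EFinB.
by rewrite prodEFin ltry.
Qed.

(** Volume of the unit ball. Its value is never computed: it is absorbed in a normalizing constant
    that is fixed by total mass one. *)
Let omega n := fine (lebesgue_Rn n (B n 1)).

Let sqrt_exp (a : R) n : (Num.sqrt (expR a) ^+ n = expR (n%:R / 2 * a))%R.
Proof.
rewrite (_ : a = a / 2 + a / 2)%R; last by field.
rewrite expRD -expr2 sqrtr_sqr ger0_norm ?expR_ge0// -expRM_natl; congr expR.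
by field.
Qed.

Let leb_Bexp n (a : R) :
  lebesgue_Rn n (B n (expR a)) = (omega n * expR (n%:R / 2 * a))%:E.
Proof.
by rewrite leb_B ?expR_gt0// -(fineK (leb_B1_fin _)) sqrt_exp -EFinM mulrC.
Qed.

Let leb_lnsq n (a b : R) : (a <= b)%R -> lebesgue_Rn n.+1 (@lnsq n.+1 @^-1` `]a, b]) =
  (omega n.+1 * expR (n.+1%:R / 2 * b) - omega n.+1 * expR (n.+1%:R / 2 * a))%:E.
Proof.
move=> ab; have mS : measurable (@lnsq n.+1 @^-1` `]a, b]).
  by apply: measurable_preimage; [exact: measurable_lnsq|exact: measurable_itv].
have mSZ : measurable ((@lnsq n.+1 @^-1` `]a, b]) `\` Z n.+1).
  by apply: measurableD => //; exact: mZ.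
pose S := @lnsq n.+1 @^-1` `]a, b].
have mZS : measurable (Z n.+1 `&` S) by apply: measurableI; [exact: mZ|exact: mS].
rewrite -/S -(@setDUK _ (Z n.+1 `&` S) S); last by move=> x [].
rewrite setUC measureU0//; last 2 first.
- by apply: measurableD; [exact: mS|exact: mZS].
- apply/eqP; rewrite eq_le measure_ge0 andbT -[leRHS](lebZ n).
  by apply: le_measure; rewrite ?inE//; exact: mZ.
rewrite (_ : _ `\` _ = B n.+1 (expR b) `\` B n.+1 (expR a)); last first.
  apply/seteqP; split => x /=; rewrite /S /B /Z /lnsq/= in_itv/=.
    move=> [/andP[ax xb] H].
    have x0 : (0 < sqn x)%R.
      rewrite lt_neqAle sqn_ge0 andbT eq_sym; apply/negP => /eqP x0.
      by apply: H; split => //; apply/andP.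
    split; first by rewrite -[sqn x]lnK ?posrE// ler_expR.
    by apply/negP; rewrite -ltNge -[ltRHS]lnK ?posrE// ltr_expR.
  move=> [xb /negP]; rewrite -ltNge => ax.
  have x0 : (0 < sqn x)%R by rewrite (le_lt_trans (expR_ge0 a)).
  split; last by move=> [/eqP]; rewrite gt_eqF.
  by rewrite -ltr_expR -ler_expR lnK ?posrE// ax xb.
have Boo : lebesgue_Rn n.+1 (B n.+1 (expR b)) < +oo.
  by rewrite leb_B ?expR_gt0// -(fineK (leb_B1_fin _)) -EFinM ltry.
rewrite measureD; [|exact: mB|exact: mB|exact: Boo].
rewrite setIidr; last first.
  by move=> x; rewrite /B/= => /le_trans; apply; rewrite ler_expR.
by rewrite EFinB; congr (_ - _); exact: leb_Bexp.
Qed.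

Let omega_ge0 n : (0 <= omega n)%R.
Proof. exact: fine_ge0. Qed.

(** The derivative in [u] of the volume of the ball of squared radius [expR u]. *)
Let kappa n (u : R) : R := (omega n * (n%:R / 2) * expR (n%:R / 2 * u))%R.

Let kappa_ge0 n u : (0 <= kappa n u)%R.
Proof. by rewrite !mulr_ge0 ?expR_ge0// omega_ge0. Qed.

Let kappa_cont n : continuous (kappa n).
Proof.
move=> x; apply: cvgM; first exact: cvg_cst.
apply: (cvg_comp _ expR); last exact: continuous_expR.
by apply: cvgM; [exact: cvg_cst|exact: cvg_id].
Qed.

Let mkappa n : measurable_fun setT (kappa n).
Proof. exact: continuous_measurable_fun. Qed.

(** Both sides are measures in [A]. They agree on left-open intervals by the fundamental theorem of
    calculus, and the intervals from [-i] to [i] exhaust the line with finite mass. *)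
Let leb_lnsq_density n A : measurable A ->
  lebesgue_Rn n.+1 (@lnsq n.+1 @^-1` A) = \int[leb]_(u in A) (kappa n.+1 u)%:E.
Proof.
move=> mA.
pose L : {mfun Rn R n.+1 >-> measurableTypeR R} :=
  HB.pack (@lnsq n.+1) (isMeasurableFun.Build _ _ _ _ _ (@measurable_lnsq n.+1)).
have E a b : (a <= b)%R -> lebesgue_Rn n.+1 (@lnsq n.+1 @^-1` `]a, b]) =
    \int[leb]_(u in `]a, b]) (kappa n.+1 u)%:E.
  rewrite le_eqVlt => /predU1P[->|ab].
    by rewrite set_itvoc0 preimage_set0 measure0 integral_set0.
  rewrite leb_lnsq ?ltW// integral_itv_obnd_cbnd; last first.
    by apply: measurable_funTS; exact/measurable_EFinP.
  pose F u := (omega n.+1 * expR (n.+1%:R / 2 * u))%R : R.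
  have dF (u : R) : is_derive u 1%R F (kappa n.+1 u).
    rewrite /F; apply: is_derive_eq; rewrite /kappa/= !(scaler0, addr0, add0r, scaler1).
    by rewrite /GRing.scale/=; ring.
  rewrite (@continuous_FTC2 _ _ F)// ?EFinB//.
  - by apply: continuous_subspaceT; exact: kappa_cont.
  - split => [x _||].
    + by have [] := dF x.
    + apply: cvg_at_right_filter; apply: differentiable_continuous.
      by apply/derivable1_diffP; have [] := dF a.
    + apply: cvg_at_left_filter; apply: differentiable_continuous.
      by apply/derivable1_diffP; have [] := dF b.
  - by move=> x _; rewrite derive1E derive_val.
pose m1 : {measure set (measurableTypeR R) -> \bar R} :=
  pushforward (lebesgue_Rn n.+1) L.
pose m2 := weighted leb (mkappa n.+1) (kappa_ge0 n.+1).
rewrite -[LHS]/(m1 (measurable_funP L) A) -[RHS]/(m2 A).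
pose g (i : nat) : set (measurableTypeR R) := `](- i%:R)%R, (i%:R : R)]%classic.
apply: (@measure_unique _ R (measurableTypeR R) (@ocitv R) g) => //.
- exact: ocitvI.
- by move=> i; exists (- i%:R, i%:R)%R.
- exact: bigcup_itvT.
- move=> _ [[a b] _ <-].
  have [ab|ba] := leP a b; first exact: E.
  rewrite set_itv_ge ?measure0//.
  by rewrite bnd_simp -leNgt ltW.
- by move=> i; rewrite [X in X < _]leb_lnsq ?ltry// ge0_cp.
Qed.

(** Away from the origin the Gaussian density is a function of [lnsq], and the image of Lebesgue
    measure under [lnsq] has density [kappa]. *)
Lemma ge0_integral_lnsq n : exists2 C : R, (0 <= C)%R &
  forall f : R -> \bar R, measurable_fun setT f -> (forall x, 0 <= f x) ->
  \int[gauss_Rn n.+1]_x f (lnsq x) =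
  \int[leb]_u (f u * (C * expR (n.+1%:R / 2 * u - expR u / 2))%:E).
Proof.
pose c : R := ((2 * pi) `^ (- (n.+1%:R / 2)))%R.
exists (c * (omega n.+1 * (n.+1%:R / 2)))%R.
  by rewrite mulr_ge0 ?powR_ge0// mulr_ge0// omega_ge0.
move=> f mf f0; have mL := @measurable_lnsq n.+1.
pose k u : R := (c * expR (- (expR u / 2)))%R.
have k0 u : (0 <= k u)%R by rewrite mulr_ge0 ?powR_ge0 ?expR_ge0.
have mk : measurable_fun setT (fun u => (k u)%:E).
  apply/measurable_EFinP; apply: measurable_funM => //; apply: measurableT_comp => //.
  by apply: measurableT_comp => //; exact: measurable_funM.
have mfL : measurable_fun setT (fun x : Rn R n.+1 => f (lnsq x)) by exact: measurableT_comp.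
rewrite ge0_integral_gauss_Rn//.
transitivity (\int[lebesgue_Rn n.+1]_x (f (lnsq x) * (k (lnsq x))%:E)).
  apply: ge0_ae_eq_integral => //.
  - apply: emeasurable_funM => //; apply/measurable_EFinP.
    exact: measurable_gaussian_density.
  - exact: (measurableT_comp (emeasurable_funM mf mk) mL).
  - by move=> x _; rewrite mule_ge0// lee_fin ltW// gaussian_density_gt0.
  - by move=> x _; rewrite mule_ge0// lee_fin.
  exists (Z n.+1); split; [exact: mZ|exact: lebZ|].
  move=> x /= /not_implyP[_ H]; rewrite /Z/=; apply: contrapT => x0; apply: H.
  congr (_ * _%:E); rewrite /gaussian_density /k /lnsq lnK; last first.
    by rewrite posrE lt_neqAle sqn_ge0 andbT eq_sym; apply/eqP.
  by rewrite /c/= mul1r mulrC [in RHS]mulrC [(sqn x / 2)%R]mulrC.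
rewrite -[LHS](@ge0_integral_pushforward _ _ _ _ _ _ mL (lebesgue_Rn n.+1) setT
  (fun u => f u * (k u)%:E))//; last 2 first.
- exact: emeasurable_funM.
- by move=> u _; rewrite mule_ge0// lee_fin.
transitivity (\int[leb]_u (f u * (k u)%:E * (kappa n.+1 u)%:E)).
  apply: (@ge0_integral_density _ (measurableTypeR R) R leb _ (kappa n.+1)
    (mkappa n.+1) (kappa_ge0 n.+1)).
  - by move=> A mA; exact: leb_lnsq_density.
  - exact: emeasurable_funM.
  - by move=> u; rewrite mule_ge0// lee_fin.
apply: eq_integral => u _; rewrite -muleA -EFinM; congr (_ * _%:E).
by rewrite /k /kappa expRD; ring.
Qed.

(** [expR (ln t)] differs from [t >= 0] at most for [t = 0], and the origin is a null set. *)
Lemma ge0_integral_sqn n (h : R -> \bar R) :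
  measurable_fun setT h -> (forall x, 0 <= h x) ->
  \int[gauss_Rn n.+1]_x h (sqn x) = \int[gauss_Rn n.+1]_x h (expR (lnsq x)).
Proof.
move=> mh h0; have mL := @measurable_lnsq n.+1.
have mg : measurable_fun setT (fun x : Rn R n.+1 => (gaussian_density x)%:E).
  by apply/measurable_EFinP; exact: measurable_gaussian_density.
have m1 : measurable_fun setT (fun x : Rn R n.+1 => h (sqn x)).
  by apply: measurableT_comp => //; exact: measurable_sqn.
have m2 : measurable_fun setT (fun x : Rn R n.+1 => h (expR (lnsq x))).
  by apply: measurableT_comp => //; exact: measurableT_comp.
rewrite !ge0_integral_gauss_Rn//; apply: ge0_ae_eq_integral => //.
- exact: emeasurable_funM.
- exact: emeasurable_funM.
- by move=> x _; rewrite mule_ge0// lee_fin ltW// gaussian_density_gt0.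
- by move=> x _; rewrite mule_ge0// lee_fin ltW// gaussian_density_gt0.
exists (Z n.+1); split; [exact: mZ|exact: lebZ|].
move=> x /= /not_implyP[_ H]; rewrite /Z/=; apply: contrapT => x0; apply: H.
congr (h _ * _); rewrite /lnsq lnK//.
by rewrite posrE lt_neqAle sqn_ge0 andbT eq_sym; apply/eqP.
Qed.

End Radial.

(** * The law of the Gram determinant of a Gaussian matrix *)

Section DeterminantLaw.
Context {R : realType}.
Local Open Scope ereal_scope.

Definition mfun_lnsq n : {mfun Rn R n >-> measurableTypeR R} :=
  HB.pack (@lnsq R n) (isMeasurableFun.Build _ _ _ _ _ (@measurable_lnsq R n)).

Definition logchi2 n : probability (measurableTypeR R) R :=
  distribution (gauss_Rn n) (mfun_lnsq n).

Definition addR (z : (measurableTypeR R * measurableTypeR R)%type) : measurableTypeR R :=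
  (z.1 + z.2)%R.

Lemma measurable_addR : measurable_fun setT addR.
Proof. by apply: measurable_funD. Qed.

Definition mfun_addR :
    {mfun (measurableTypeR R * measurableTypeR R)%type >-> measurableTypeR R} :=
  HB.pack addR (isMeasurableFun.Build _ _ _ _ _ measurable_addR).

Definition convolution (P1 P2 : probability (measurableTypeR R) R) :
    probability (measurableTypeR R) R := distribution (P1 \x P2) mfun_addR.

Fixpoint logdet_law p n : probability (measurableTypeR R) R :=
  match p with
  | 0 => dirac (0%R : measurableTypeR R)
  | p'.+1 => convolution (logchi2 n) (logdet_law p' n.-1)
  end.

Lemma ge0_integral_convolution P1 P2 (f : R -> \bar R) :
  measurable_fun setT f -> (forall x, 0 <= f x) ->
  \int[convolution P1 P2]_x f x = \int[P1]_x \int[P2]_y f (x + y)%R.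
Proof.
move=> mf f0; rewrite ge0_integral_distribution//.
rewrite fubini_tonelli1//; last by move=> x; exact: f0.
by apply: measurableT_comp => //; exact: measurable_addR.
Qed.

(** For a frozen first row [g] the reflection is a constant orthogonal matrix, under which the other
    rows remain Gaussian and independent. The test function is general because at each step it
    absorbs the factor [sqn g]. *)
Theorem gaussian_matrix_logdet p n d (T : measurableType d) (P : probability T R)
    (G : T -> 'M[R]_(p, n)) (phi : R -> \bar R) : (p <= n)%N ->
  gaussian_matrix P G -> measurable_fun setT phi -> (forall x, 0 <= phi x) ->
  \int[P]_w phi (\det (G w *m (G w)^T)) = \int[logdet_law p n]_y phi (expR y).
Proof.
elim: p => [|p IH] in n d T P G phi *.
  move=> _ _ mphi phi0; rewrite /= integral_dirac//; last first.
    by apply: measurableT_comp => //; exact: measurable_expR.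
  rewrite diracE in_setT mul1e expR0.
  under eq_integral do rewrite det_mx00.
  by rewrite integral_cst//= probability_setT mule1.
case: n => [//|n] in G *; rewrite ltnS => pn gG mphi phi0.
pose F (A : 'M[R]_(p.+1, n.+1)) := phi (\det (A *m A^T)).
have F0 A : 0 <= F A by exact: phi0.
have mF d' (T' : measurableType d') (g : T' -> 'M[R]_(p.+1, n.+1)) :
    mx_measurable g -> measurable_fun setT (fun x => F (g x)).
  move=> mg; apply: measurableT_comp => //; apply: mx_measurable_det.
  by apply: mx_measurableM => //; exact: mx_measurable_tr.
rewrite [LHS](@integral_gaussian_matrix _ _ _ _ _ _ _ F)//; last first.
  by apply: mF; exact: mx_measurable_Rn_matrix.
have gC := @gaussian_matrix_consrow R p n.+1.
have mC := gaussian_matrix_measurable gC.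
rewrite -(integral_gaussian_matrix gC (F := F))//; last first.
  by apply: mF; exact: mx_measurable_Rn_matrix.
rewrite fubini_tonelli1//; last exact: mF.
have E (g : Rn R n.+1) :
    \int[gauss_Rn #|{: 'I_p * 'I_n.+1}|]_y F (consrow_Rn (g, y)) =
    \int[logdet_law p n]_y phi (sqn g * expR y)%R.
  have [Q [QQ QQ' gQ]] := householder (row_of_Rn g).
  (* The remaining rows after the reflection, without their first column, which does not affect the
     determinant. *)
  pose G' (y : Rn R #|{: 'I_p * 'I_n.+1}|) : 'M[R]_(p, n) :=
    rsubmx (Rn_matrix y *m Q : 'M[R]_(p, 1 + n)).
  have gG' : gaussian_matrix (gauss_Rn #|{: 'I_p * 'I_n.+1}|) G'.
    apply: gaussian_matrix_rsub; apply: gaussian_matrix_mulr => //.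
    exact: gaussian_matrix_Rn_matrix.
  rewrite -(IH n _ _ _ G' (fun t => phi (sqn g * t)%R) pn gG')//; last first.
    by apply: measurableT_comp => //; exact: measurable_funM.
  apply: eq_integral => y _; congr phi.
  have E2 : consrow_Rn (g, y) *m Q = (block_mx (Num.sqrt (sqn g))%:M 0
      (lsubmx (Rn_matrix y *m Q : 'M[R]_(p, 1 + n))) (G' y) : 'M[R]_(1 + p, 1 + n)).
    by rewrite [LHS]mul_col_mx gQ -sqn_mx /block_mx hsubmxK.
  by rewrite -(det_gram_mulr _ QQ) E2 det_gram_block sqr_sqrtr ?sqn_ge0.
rewrite /fubini_F; under eq_integral do rewrite E.
rewrite (@ge0_integral_sqn R n (fun t => \int[logdet_law p n]_y phi (t * expR y)%R)); last 2 first.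
- apply: (@measurable_fun_fubini_tonelli_F _ _ _ _ _ (logdet_law p n)
    (fun z : measurableTypeR R * measurableTypeR R => phi (z.1 * expR z.2)%R)) => //.
  apply: measurableT_comp => //; apply: measurable_funM => //.
  by apply: measurableT_comp => //; exact: measurable_expR.
- by move=> x; exact: integral_ge0.
have me : measurable_fun setT (fun x => phi (expR x)).
  by apply: measurableT_comp => //; exact: measurable_expR.
rewrite [RHS]ge0_integral_convolution// [RHS]ge0_integral_distribution//=.
- by apply: eq_integral => g _; apply: eq_integral => y _; rewrite /= expRD.
- apply: (@measurable_fun_fubini_tonelli_F _ _ _ _ _ (logdet_law p n)
    (fun z : measurableTypeR R * measurableTypeR R => phi (expR (z.1 + z.2)%R))) => //.
  by apply: (measurableT_comp me); exact: measurable_funD.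
- by move=> x; exact: integral_ge0.
Qed.

End DeterminantLaw.

(** * The volume of a Gaussian simplex *)

Section OrthonormalFrames.
Context {R : realType}.

(** [L] may be singular, so an orthonormal frame [U] whose span contains the rows exists even for
    dependent rows, as needed for degenerate simplices. *)
Lemma lq_decomposition p n (W : 'M[R]_(p, n)) : (p <= n)%N ->
  exists (L : 'M[R]_p) (U : 'M[R]_(p, n)), U *m U^T = 1%:M /\ W = L *m U.
Proof.
elim: p n => [|p IH] [|n] // in W *.
- by move=> _; exists 1%:M, 0; split; apply/matrixP => -[].
- by move=> _; exists 1%:M, 0; split; apply/matrixP => -[].
rewrite ltnS => pn.
have [Q [QQ QQ' vQ]] := householder (usubmx (W : 'M[R]_(1 + p, 1 + n))).
set s := Num.sqrt _ in vQ.
pose W1 := dsubmx (W : 'M[R]_(1 + p, 1 + n)) *m Q.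
have [L' [U' [UU' W'E]]] := IH n (rsubmx W1) pn.
pose V : 'M[R]_(1 + p, 1 + n) := block_mx 1%:M 0 0 U'.
have VV : V *m V^T = 1%:M.
  rewrite tr_block_mx mulmx_block !trmx0 !mulmx0 !mul0mx !addr0 add0r trmx1 mulmx1 UU'.
  by rewrite -scalar_mx_block.
exists (block_mx s%:M 0 (lsubmx W1) L' : 'M[R]_(1 + p)), (V *m Q^T); split.
  by rewrite trmx_mul trmxK mulmxA -(mulmxA V) QQ' mulmx1.
have WQ : (W : 'M[R]_(1 + p, 1 + n)) *m Q =
    block_mx s%:M 0 (lsubmx W1) L' *m V.
  rewrite -[in LHS](@vsubmxK _ 1 p _ W) mul_col_mx vQ -/W1 -[in LHS](@hsubmxK _ p 1 n W1) W'E.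
  by rewrite mulmx_block !mulmx1 !mulmx0 !mul0mx !addr0 add0r.
by rewrite mulmxA -WQ -mulmxA QQ mulmx1.
Qed.

Lemma det_gram_mull p n (L : 'M[R]_p) (U : 'M[R]_(p, n)) :
  \det ((L *m U) *m (L *m U)^T) = \det L ^+ 2 * \det (U *m U^T).
Proof. by rewrite trmx_mul mulmxA -(mulmxA L) !det_mulmx det_tr expr2 mulrAC. Qed.

(** Choose [v] nonzero with [L *m v^T = 0] and let [H] turn [v] to the first axis: the first column
    of [L *m H] is then zero. *)
Lemma singular_lq p (L : 'M[R]_p.+1) : \det L = 0 ->
  exists H : 'M[R]_p.+1, [/\ H *m H^T = 1%:M, H^T *m H = 1%:M &
    forall i, (L *m H) i ord0 = 0].
Proof.
move=> L0.
have [v v0 vL] : exists2 v : 'rV[R]_p.+1, v != 0 & v *m L^T = 0.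
  by apply/det0P; rewrite det_tr L0 eqxx.
have [H [HH HH' vH]] := householder (v : 'rV[R]_(1 + p)).
exists H; split => //.
set s := Num.sqrt _ in vH.
have s0 : s != 0 by rewrite gt_eqF// sqrtr_gt0 lt_neqAle sqnorm_ge0 andbT eq_sym sqnorm_eq0.
have LH0 : s *: lsubmx (L *m H : 'M[R]_(p.+1, 1 + p)) = 0.
  have : (L *m H) *m (v *m H)^T = 0.
    rewrite trmx_mul mulmxA -(mulmxA L) HH mulmx1.
    by rewrite -[L]trmxK -trmx_mul vL trmx0.
  rewrite vH tr_row_mx -[L *m H](@hsubmxK _ _ 1 p) mul_row_col trmx0 mulmx0 addr0.
  by rewrite tr_scalar_mx mul_mx_scalar hsubmxK.
move=> i; have := congr1 (fun M : 'M[R]_(p.+1, 1) => M i 0) LH0.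
rewrite [LHS]mxE [X in _ * X]mxE [RHS]mxE => /eqP.
rewrite mulf_eq0 (negbTE s0)/= => /eqP <-; congr (_ i _); exact: val_inj.
Qed.

End OrthonormalFrames.

(** * The volume of a simplex as a Gram determinant *)

Section SimplexVolume.
Context {R : realType}.
Local Open Scope ereal_scope.
Local Notation leb := (@lebesgue_measure R).

Definition corner_simplex p : set (Rn R p) :=
  [set w | (forall i, (0 <= tnth w i)%R) /\ (\sum_i tnth w i <= 1)%R].

Lemma measurable_corner_simplex p : measurable (@corner_simplex p).
Proof.
rewrite (_ : @corner_simplex p = box (fun=> `[0%R, +oo[%classic) `&`
    ((fun w : Rn R p => \sum_i tnth w i)%R @^-1` `]-oo, 1%R])).
  apply: measurableI; first by apply: measurable_box => i; exact: measurable_itv.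
  apply: measurable_preimage; last exact: measurable_itv.
  by apply: measurable_sum => i; exact: measurable_tnth.
apply/seteqP; split => x /=; rewrite in_itv/= => -[H1 H2]; split => // i.
  by rewrite /= in_itv/= H1.
by have := H1 i; rewrite /= in_itv/= andbT.
Qed.

(** The exact value, one over the factorial of [p], only adds a constant to the log-volume, which
    standardization removes. *)
Lemma corner_simplex_volume p :
  0 < lebesgue_Rn p (@corner_simplex p) < +oo.
Proof.
have mbox (a : R) : measurable (box (fun _ : 'I_p => `[0%R, a]%classic)).
  by apply: measurable_box => i; exact: measurable_itv.
apply/andP; split.
  (* Side length for which the coordinates of a point of the box sum to at most one; the successor
     covers [p = 0]. *)
  pose a : R := (p.+1%:R^-1)%R; have a0 : (0 < a)%R by rewrite invr_gt0.
  apply: (@lt_le_trans _ _ (lebesgue_Rn p (box (fun=> `[0%R, a]%classic)))).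
    rewrite lebesgue_Rn_box//.
    under eq_bigr do rewrite lebesgue_measure_itv/= lte_fin a0 -EFinB subr0.
    by rewrite prodEFin lte_fin prodr_gt0.
  apply: le_measure; rewrite ?inE//; first exact: measurable_corner_simplex.
  move=> x H; split => [i|]; first by have := H i; rewrite /= in_itv/= => /andP[].
  apply: (@le_trans _ _ (\sum_(i < p) a)%R).
    by apply: ler_sum => i _; have := H i; rewrite /= in_itv/= => /andP[].
  by rewrite sumr_const card_ord -mulr_natl ler_pdivrMr// mul1r ler_nat.
apply: (@le_lt_trans _ _ (lebesgue_Rn p (box (fun=> `[0%R, 1%R]%classic)))).
  apply: le_measure; rewrite ?inE//; first exact: measurable_corner_simplex.
  move=> x [x0 x1] i /=; rewrite in_itv/= x0/=; apply: le_trans x1.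
  by rewrite (bigD1 i)//= lerDl sumr_ge0.
rewrite lebesgue_Rn_box//.
under eq_bigr do rewrite lebesgue_measure_itv/= lte_fin ltr01 -EFinB.
by rewrite prodEFin ltry.
Qed.

Definition edges p n (X : 'I_p.+1 -> 'rV[R]_n) : 'M[R]_(p, n) :=
  \matrix_(i, j) (X (lift ord0 i) 0%R j - X ord0 0%R j)%R.

Lemma row_edges p n (X : 'I_p.+1 -> 'rV[R]_n) i :
  row i (edges X) = (X (lift ord0 i) - X ord0)%R.
Proof. by apply/rowP => j; rewrite !mxE. Qed.

Lemma simplexE p n (X : 'I_p.+1 -> 'rV[R]_n) y : simplex X y <->
  exists2 w, @corner_simplex p w & y = (X ord0 + row_of_Rn w *m edges X)%R.
Proof.
have sumE (w : 'I_p.+1 -> R) : (\sum_i w i = 1)%R ->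
    (\sum_i w i *: X i = X ord0 + (\row_i w (lift ord0 i)) *m edges X)%R.
  rewrite !big_ord_recl => /(canRL (addrK _)) ->.
  rewrite scalerBl scale1r -addrA; congr (_ + _)%R.
  rewrite mulmx_sum_row addrC scaler_suml -sumrB; apply: eq_bigr => i _.
  by rewrite row_edges mxE scalerBr.
split=> [[w [w0 w1 ->]]|[w [w0 w1] ->]].
  exists (Rn_of_row (\row_i w (lift ord0 i))); last by rewrite Rn_of_rowK sumE.
  split=> [i|]; first by rewrite tnth_mktuple mxE.
  under eq_bigr do rewrite tnth_mktuple mxE.
  by move: w1; rewrite big_ord_recl => <-; rewrite lerDr.
exists (fun i => if unlift ord0 i is Some j then tnth w j else 1 - \sum_j tnth w j)%R.
have s1 : (\sum_i (if unlift ord0 i is Some j then tnth w j else 1 - \sum_j tnth w j) = 1)%R.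
  rewrite big_ord_recl unlift_none.
  by under [X in (_ + X)%R]eq_bigr do rewrite liftK; rewrite subrK.
split=> [i||]; first by case: unliftP => [j _|_]; rewrite ?w0// subr_ge0.
  exact: s1.
rewrite sumE//; congr (_ + _ *m _)%R; apply/rowP => i.
by rewrite !mxE liftK.
Qed.

Lemma simplex_vertex p n (X : 'I_p.+1 -> 'rV[R]_n) i : simplex X (X i).
Proof.
exists (fun j => (j == i)%:R%R); split.
- by move=> j; rewrite ler0n.
- by rewrite (bigD1 i)//= eqxx big1 ?addr0// => j /negbTE ->.
- by rewrite (bigD1 i)//= eqxx scale1r big1 ?addr0// => j /negbTE ->; rewrite scale0r.
Qed.

(** Differences of points in the range of the chart lie in the row space of [U], where [U^T *m U]
    acts as the identity. *)
Lemma affine_chart_edges p n (X : 'I_p.+1 -> 'rV[R]_n) a (U : 'M[R]_(p, n)) :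
  U *m U^T = 1%:M -> simplex X `<=` range (affine_chart a U) ->
  edges X = (edges X *m U^T) *m U.
Proof.
move=> UU SU; apply/row_matrixP => i; rewrite !row_mul row_edges.
have [s _ <-] := SU _ (simplex_vertex X (lift ord0 i)).
have [t _ <-] := SU _ (simplex_vertex X ord0).
rewrite /affine_chart opprD addrACA subrr add0r -mulmxBl.
by rewrite -(mulmxA _ U) UU mulmx1.
Qed.

Lemma lebesgue_affine_image p (T : 'M[R]_p) (t0 : 'rV[R]_p) : T \in unitmx ->
  lebesgue_Rn p [set t | exists2 w, @corner_simplex p w &
    row_of_Rn t = (t0 + row_of_Rn w *m T)%R] =
  `|\det T|%:E * lebesgue_Rn p (@corner_simplex p).
Proof.
move=> uT; set A := [set t | _].
have AE : A = (fun t : Rn R p => Rn_of_row ((- t0 + row_of_Rn t) *m invmx T)%R)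
    @^-1` @corner_simplex p.
  apply/seteqP; split => t /=.
    by move=> [w Dw ->]; rewrite addKr mulmxK// row_of_RnK.
  by move=> H; exists (Rn_of_row ((- t0 + row_of_Rn t) *m invmx T)%R); rewrite // Rn_of_rowK mulmxKV// addNKr.
have mA : measurable A.
  rewrite AE; apply: measurable_preimage; last exact: measurable_corner_simplex.
  apply: measurable_Rn_of_row; apply: mx_measurableM; last exact: mx_measurable_cst.
  by apply: mx_measurableD; [exact: mx_measurable_cst|exact: mx_measurable_row_of_Rn].
have mf : measurable_fun setT (fun t => (\1_A t : R)%:E).
  by apply/measurable_EFinP; exact: measurable_indic.
transitivity (\int[lebesgue_Rn p]_t (\1_A t)%:E); first by rewrite integral_indic// setIT.
rewrite -(ge0_integral_translation t0 mf)//.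
rewrite -(unitmx_linear_scaling uT (f := fun t => (\1_A (Rn_of_row (t0 + row_of_Rn t)%R))%:E))//; last first.
  apply: (measurableT_comp mf); apply: measurable_Rn_of_row.
  by apply: mx_measurableD; [exact: mx_measurable_cst|exact: mx_measurable_row_of_Rn].
congr (_ * _).
transitivity (\int[lebesgue_Rn p]_t (\1_(@corner_simplex p) t)%:E); last first.
  by rewrite integral_indic ?setIT//; exact: measurable_corner_simplex.
apply: eq_integral => t _; rewrite !indicE; congr (_%:R%:E); congr (nat_of_bool _).
rewrite Rn_of_rowK AE; apply/idP/idP; rewrite !inE/= Rn_of_rowK addKr mulmxK// row_of_RnK.
- by [].
- by [].
Qed.

(** If the Gram determinant is nonzero, all admissible charts give the same value, so the infimum is
    over a singleton. If it vanishes, some chart sends the preimage of the simplex into a coordinate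
    hyperplane, and the infimum is 0. *)
Lemma simplex_volumeE p n (x : 'I_p.+1 -> Rn R n) : (p <= n)%N ->
  let E := edges (fun i => row_of_Rn (x i)) in
  simplex_volume x =
    (fine (lebesgue_Rn p (@corner_simplex p)) * Num.sqrt (\det (E *m E^T)))%R.
Proof.
move=> pn E; rewrite /simplex_volume /volume; set X := fun i => row_of_Rn (x i).
have [L [U [UU EE]]] := lq_decomposition E pn.
have chart (L' : 'M[R]_p) (U' : 'M[R]_(p, n)) : E = L' *m U' ->
    simplex X `<=` range (affine_chart (X ord0) U').
  move=> E' y /simplexE[w _ ->]; exists (Rn_of_row (row_of_Rn w *m L')) => //.
  by rewrite /affine_chart Rn_of_rowK -mulmxA -E'.
have [dE|dE] := eqVneq (\det (E *m E^T)) 0%R.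
  rewrite dE sqrtr0 mulr0.
  suff -> : ereal_inf [set v | exists (a : 'rV[R]_n) (V : 'M[R]_(p, n)),
      [/\ V *m V^T = 1%:M, simplex X `<=` range (affine_chart a V) &
          v = lebesgue_Rn p (affine_chart a V @^-1` simplex X)]] = 0 by [].
  apply/eqP; rewrite eq_le; apply/andP; split; last first.
    by apply: le_ereal_inf_tmp => _ [a [V [_ _ ->]]].
  apply: ereal_inf_lbound.
  (* For [p = 0] the empty determinant is 1, so a simplex that is a point is not degenerate. *)
  case: p => [|p'] in x pn E X L U UU EE chart dE *.
    by move: dE; rewrite det_mx00 => /eqP; rewrite oner_eq0.
  have dL : \det L = 0%R.
    by move: dE; rewrite EE det_gram_mull UU det1 mulr1 => /eqP; rewrite sqrf_eq0 => /eqP.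
  have [H [HH HH' H0]] := singular_lq dL.
  have EH : E = (L *m H) *m (H^T *m U) by rewrite mulmxA -(mulmxA L) HH mulmx1.
  have UH : (H^T *m U) *m (H^T *m U)^T = 1%:M.
    by rewrite trmx_mul trmxK mulmxA -(mulmxA _ U) UU mulmx1.
  exists (X ord0), (H^T *m U); split => //; first exact: chart EH.
  apply/esym; apply: (@lebesgue_Rn_slice _ _ _ 0%R) => t /simplexE[w _].
  rewrite -/E EH mulmxA => /addrI /(congr1 (fun M => M *m (H^T *m U)^T)).
  rewrite -!(mulmxA _ (H^T *m U)) UH !mulmx1 => tE.
  have -> : tnth t ord0 = row_of_Rn t 0%R ord0 by rewrite mxE.
  by rewrite tE mxE big1// => i _; rewrite H0 mulr0.
rewrite (_ : [set v | _] = [set (Num.sqrt (\det (E *m E^T)))%:E *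
    lebesgue_Rn p (@corner_simplex p)]).
  have /andP[_ Doo] := corner_simplex_volume p.
  by rewrite ereal_inf1 fineM// ?ge0_fin_numE// mulrC.
have val a (V : 'M[R]_(p, n)) : V *m V^T = 1%:M ->
    simplex X `<=` range (affine_chart a V) ->
    lebesgue_Rn p (affine_chart a V @^-1` simplex X) =
    (Num.sqrt (\det (E *m E^T)))%:E * lebesgue_Rn p (@corner_simplex p).
  move=> VV SV; have EV := affine_chart_edges VV SV; rewrite -/E in EV.
  pose T := E *m V^T.
  have dT : \det (E *m E^T) = (\det T ^+ 2)%R.
    by rewrite EV det_gram_mull VV det1 mulr1.
  have uT : T \in unitmx.
    by rewrite unitmxE unitfE; move: dE; rewrite dT expf_eq0.
  rewrite dT sqrtr_sqr -(lebesgue_affine_image (((X ord0 - a) *m V^T))%R uT).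
  congr (lebesgue_Rn p _).
  have [t0 _ X0] := SV _ (simplex_vertex X ord0).
  have X0' : (X ord0 - a)%R *m V^T *m V = (X ord0 - a)%R.
    by rewrite -X0 /affine_chart addrC addKr -(mulmxA (row_of_Rn t0)) VV mulmx1.
  apply/seteqP; split => t /=.
    move=> /simplexE[w Dw]; rewrite -/E => tE; exists w => //.
    rewrite /T mulmxA -mulmxDl -addrAC -tE /affine_chart addrC addKr.
    by rewrite -mulmxA VV mulmx1.
  move=> [w Dw tE]; apply/simplexE; exists w => //.
  by rewrite -/E /affine_chart tE mulmxDl X0' addrA subrKC -mulmxA -EV.
apply/seteqP; split => [_ [a [V [VV SV ->]]]|_ ->] /=; first exact: val.
by exists (X ord0), U; split => //; [exact: (chart L)|rewrite val//; exact: (chart L)].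
Qed.

End SimplexVolume.

(** * From Gaussian vertices to a Gaussian matrix *)

Section GaussianSimplex.
Context {R : realType}.
Local Open Scope ereal_scope.

(** The edges share a vertex and are dependent. But the edge map annihilates the all-ones vector;
    once an orthogonal [Q] turns this vector to the first axis, the edges become a fixed invertible
    matrix times the last [p] rows of the rotated vertex matrix, which is again Gaussian. *)
Lemma edges_gaussian_reduction p n : exists (L : 'M[R]_p) (Q : 'M[R]_(1 + p)),
  [/\ L \in unitmx, Q *m Q^T = 1%:M &
   forall x : 'I_p.+1 -> Rn R n, edges (fun i => row_of_Rn (x i)) =
     L *m dsubmx (Q^T *m (\matrix_(i, j) tnth (x i) j : 'M[R]_(1 + p, n)))].
Proof.
have [Q [QQ QQ' oQ]] := householder (const_mx 1%R : 'rV[R]_(1 + p)).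
set s := Num.sqrt _ in oQ.
have s0 : s != 0%R.
  rewrite gt_eqF// sqrtr_gt0 lt_neqAle sqnorm_ge0 andbT eq_sym sqnorm_eq0.
  by apply/eqP => /rowP/(_ 0%R)/eqP; rewrite !mxE oner_eq0.
pose B : 'M[R]_(p, 1 + p) := row_mx (const_mx (-1)%R) 1%:M.
have B1 : B *m (const_mx 1%R : 'rV[R]_(1 + p))^T = 0%R.
  apply/matrixP => i j; rewrite !mxE big_split_ord/= big_ord1 row_mxEl !mxE mulr1.
  rewrite (bigD1 i)//= row_mxEr !mxE eqxx mulr1 big1 ?addr0 ?addNr//.
  by move=> k /negbTE ki; rewrite row_mxEr !mxE eq_sym ki mul0r.
have BQ0 : lsubmx (B *m Q) = 0%R.
  have : (B *m Q) *m ((const_mx 1%R : 'rV[R]_(1 + p)) *m Q)^T = 0%R.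
    by rewrite trmx_mul mulmxA -(mulmxA B) QQ mulmx1.
  rewrite oQ tr_row_mx -[B *m Q](@hsubmxK _ _ 1 p) mul_row_col trmx0 mulmx0 addr0.
  rewrite tr_scalar_mx mul_mx_scalar hsubmxK => /eqP.
  by rewrite scaler_eq0 (negbTE s0) => /eqP.
pose L := rsubmx (B *m Q).
have BE (m : nat) (Y : 'M[R]_(1 + p, m)) : B *m Y = L *m dsubmx (Q^T *m Y).
  have -> : B *m Y = (B *m Q) *m (Q^T *m Y) by rewrite mulmxA -(mulmxA B) QQ mulmx1.
  rewrite -[B *m Q in LHS](@hsubmxK _ _ 1 p) BQ0 -[Q^T *m Y in LHS](@vsubmxK _ 1 p).
  by rewrite mul_row_col mul0mx add0r.
exists L, Q; split => // [|x].
  (* On the matrix with zero first row and identity below, [B] gives the identity, so [L] has a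
     right inverse. *)
  have := BE _ (col_mx 0%R 1%:M); rewrite {1}/B mul_row_col mulmx0 add0r mulmx1.
  by move=> /esym/mulmx1_unit[].
rewrite -BE; apply/matrixP => i j; rewrite !mxE big_split_ord/= big_ord1 row_mxEl !mxE.
rewrite (bigD1 i)//= row_mxEr !mxE eqxx mul1r big1 ?addr0.
  rewrite mulN1r addrC; congr (tnth (x _) _ - tnth (x _) _)%R; exact: val_inj.
by move=> k /negbTE ki; rewrite row_mxEr !mxE eq_sym ki mul0r.
Qed.

Section simplex.
Context p n d (T : measurableType d) (P : probability T R)
  (X : 'I_p.+1 -> {RV P >-> Rn R n}).
Hypotheses (pn : (p <= n)%N) (Xindep : mutually_independent P X)
  (Xgauss : forall i, standard_gaussian P (X i)).

Let GX (w : T) : 'M[R]_(1 + p, n) := \matrix_(i, j) tnth (X i w) j.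

Lemma gaussian_matrix_vertices : gaussian_matrix P GX.
Proof.
split=> [ij|A mA].
  rewrite (_ : (fun w => _) = (@tnth n _ ^~ ij.2) \o X ij.1).
    by apply: measurableT_comp => //; exact: measurable_tnth.
  by apply/funext => w; rewrite mxE.
have mB (i : 'I_p.+1) : measurable (box (fun j : 'I_n => A (i, j))).
  exact: measurable_box.
have := Xindep [set: 'I_p.+1]%SET mB.
rewrite (_ : \bigcap_(i in _) _ = [set w | forall ij, A ij (GX w ij.1 ij.2)]); last first.
  apply/seteqP; split => w /= H.
    by move=> [i j] /=; rewrite mxE; apply: (H i); rewrite /= inE.
  by move=> i _ j /=; have := H (i, j); rewrite /= mxE.
move=> ->.
transitivity (\prod_(i < p.+1) \prod_(j < n) normal_prob 0 1 (A (i, j))); last first.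
  by rewrite pair_bigA; apply: eq_bigr => -[].
apply: eq_big => [i|i _]; first by rewrite inE.
have := standard_gaussian_distribution (Xgauss i) (mB i).
by rewrite /distribution /pushforward => ->; exact: gauss_Rn_box.
Qed.

(** Measurability belongs to the conclusion: the volume is defined as an infimum, and the Gram
    formula is what makes it measurable in the vertices. The factor 1/2 is the square root of that
    formula. *)
Lemma ln_simplex_volume_law : exists K : R,
  measurable_fun setT (fun w => ln (simplex_volume (fun i => X i w))) /\
  forall phi : R -> \bar R, measurable_fun setT phi -> (forall x, 0 <= phi x) ->
    \int[P]_w phi (ln (simplex_volume (fun i => X i w))) =
    \int[logdet_law p n]_y phi (K + y / 2)%R.
Proof.
have [L [Q [uL QQ LE]]] := edges_gaussian_reduction p n.
pose G w := dsubmx (Q^T *m GX w).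
have gG : gaussian_matrix P G.
  apply: (@gaussian_matrix_reindex _ _ _ _ _ _ _ _ (fun ij => (rshift 1 ij.1, ij.2))
    (fun w => Q^T *m GX w)).
  - by move=> [? ?] [? ?] /= [/addnI/val_inj -> ->].
  - by move=> w i j; rewrite mxE.
  - exact: gaussian_matrix_mull QQ gaussian_matrix_vertices.
pose c := fine (lebesgue_Rn p (@corner_simplex R p)).
have c0 : (0 < c)%R by rewrite fine_gt0// corner_simplex_volume.
pose k := (c * `|\det L|)%R.
have k0 : (0 < k)%R.
  by rewrite mulr_gt0// normr_gt0; move: uL; rewrite unitmxE unitfE.
have VE w : simplex_volume (fun i => X i w) = (k * Num.sqrt (\det (G w *m (G w)^T)))%R.
  rewrite simplex_volumeE//= LE det_gram_mull sqrtrM ?sqr_ge0// sqrtr_sqr mulrA.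
  by [].
have msqrt : measurable_fun setT (@Num.sqrt R).
  by apply: continuous_measurable_fun; exact: sqrt_continuous.
have mh : measurable_fun setT (fun t : R => ln (k * Num.sqrt t)).
  by apply: (measurableT_comp (@measurable_ln R)); exact: measurable_funM.
exists (ln k); split.
  under eq_fun do rewrite VE.
  apply: (measurableT_comp mh); apply: mx_measurable_det.
  have mG := gaussian_matrix_measurable gG.
  by apply: mx_measurableM => //; exact: mx_measurable_tr.
move=> phi mphi phi0; under eq_integral do rewrite VE.
rewrite (gaussian_matrix_logdet (phi := fun t => phi (ln (k * Num.sqrt t))) pn gG)//; last first.
  exact: measurableT_comp.
apply: eq_integral => y _; congr phi.
rewrite (_ : expR y = expR (y / 2) ^+ 2)%R; last first.
  by rewrite -expRM_natl; congr expR; field.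
by rewrite sqrtr_sqr ger0_norm ?expR_ge0// lnM ?posrE ?expR_gt0// expRK.
Qed.

End simplex.
End GaussianSimplex.

(** * Cumulants *)

Section BinomialConvolution.
Context {R : comNzRingType}.
Implicit Types a b c : nat -> R.

(** The coefficients of a product of exponential generating functions. *)
Definition bconv a b (m : nat) : R := \sum_(i < m.+1) a i * b (m - i)%N *+ 'C(m, i).

Lemma eq_bconv a a' b b' m : (forall i, (i <= m)%N -> a i = a' i) ->
  (forall i, (i <= m)%N -> b i = b' i) -> bconv a b m = bconv a' b' m.
Proof.
move=> aE bE; apply: eq_bigr => i _; rewrite aE -1?ltnS// bE// leq_subr//.
Qed.

Lemma bconv0 a b : bconv a b 0 = a 0 * b 0.
Proof. by rewrite /bconv big_ord1 bin0 mulr1n subn0. Qed.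

Lemma bconvDl a a' b m : bconv (fun i => a i + a' i) b m = bconv a b m + bconv a' b m.
Proof. by rewrite /bconv -big_split; apply: eq_bigr => i _; rewrite mulrDl mulrnDl. Qed.

Lemma bconvDr a b b' m : bconv a (fun i => b i + b' i) m = bconv a b m + bconv a b' m.
Proof. by rewrite /bconv -big_split; apply: eq_bigr => i _; rewrite mulrDr mulrnDl. Qed.

(* The shift is a derivation for the binomial convolution (Pascal's rule). *)
Lemma bconvS a b m :
  bconv a b m.+1 = bconv (fun i => a i.+1) b m + bconv a (fun i => b i.+1) m.
Proof.
have E : a 0%N * b m.+1 + \sum_(i < m.+1) a i.+1 * b (m - i)%N *+ 'C(m, i.+1) =
    bconv a (fun i => b i.+1) m.
  transitivity (\sum_(i < m.+2) a i * b (m.+1 - i)%N *+ 'C(m, i)).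
    by rewrite [RHS]big_ord_recl subn0 bin0 mulr1n.
  rewrite big_ord_recr/= bin_small// mulr0n addr0; apply: eq_bigr => i _.
  by rewrite subSn// -ltnS.
rewrite -E {1}/bconv big_ord_recl bin0 subn0 mulr1n.
under eq_bigr do rewrite /= /bump add1n subSS binS mulrnDr.
by rewrite big_split/= addrA [RHS]addrC.
Qed.

Lemma bconvC a b m : bconv a b m = bconv b a m.
Proof.
elim: m a b => [|m IH] a b; first by rewrite !bconv0 mulrC.
by rewrite !bconvS addrC; congr (_ + _); exact: IH.
Qed.

Lemma bconvA a b c m : bconv a (bconv b c) m = bconv (bconv a b) c m.
Proof.
elim: m a b c => [|m IH] a b c; first by rewrite !bconv0 mulrA.
rewrite !bconvS IH.
rewrite (@eq_bconv a a (fun i => bconv b c i.+1) (fun i => bconv (fun i => b i.+1) c i + bconv b (fun i => c i.+1) i))//; last first.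
  by move=> i _; rewrite bconvS.
rewrite (@eq_bconv (fun i => bconv a b i.+1) (fun i => bconv (fun i => a i.+1) b i + bconv a (fun i => b i.+1) i) c c)//; last first.
  by move=> i _; rewrite bconvS.
by rewrite bconvDr bconvDl !IH addrA.
Qed.

(* [c i] is the cumulant of order [i + 1] of the moment sequence [mu]: in terms of
   exponential generating functions, M' = K' M. *)
Definition is_cumulant (mu c : nat -> R) := forall m, mu m.+1 = bconv c mu m.

Lemma is_cumulant_bconv mu nu c d : is_cumulant mu c -> is_cumulant nu d ->
  is_cumulant (bconv mu nu) (fun i => c i + d i).
Proof.
move=> hc hd m; rewrite bconvS bconvDl; congr (_ + _).
  by rewrite bconvA; apply: eq_bconv => // i _; rewrite hc.
rewrite (@eq_bconv mu mu _ (bconv d nu))// bconvC -bconvA.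
by apply: eq_bconv => // i _; rewrite bconvC.
Qed.

Lemma is_cumulant_scale mu c (s : R) : is_cumulant mu c ->
  is_cumulant (fun m => s ^+ m * mu m) (fun i => s ^+ i.+1 * c i).
Proof.
move=> hc m; rewrite hc /bconv mulr_sumr; apply: eq_bigr => i _.
rewrite mulrnAr; congr (_ *+ _).
rewrite mulrACA -exprD addSn subnKC//.
by rewrite -ltnS.
Qed.

Lemma is_cumulant_unique mu c d : mu 0%N = 1 ->
  is_cumulant mu c -> is_cumulant mu d -> c =1 d.
Proof.
move=> mu0 hc hd; elim/ltn_ind => m IH.
have := hc m; rewrite hd /bconv !big_ord_recr/= subnn mu0 !mulr1 binn !mulr1n.
rewrite (eq_bigr (fun i : 'I_m => c i * mu (m - i)%N *+ 'C(m, i))).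
  by move=> /addrI.
by move=> i _; rewrite IH.
Qed.

(** The cumulants solve a triangular system, each equation using all earlier ones; hence the
    recursion carries the list of values found so far. *)
Fixpoint cumulant_seq (mu : nat -> R) n : seq R :=
  if n is n'.+1 then
    let s := cumulant_seq mu n' in
    rcons s (mu n'.+1 - \sum_(i < n') s`_i * mu (n' - i)%N *+ 'C(n', i))
  else [::].

Definition cumulant mu m := (cumulant_seq mu m.+1)`_m.

Lemma size_cumulant_seq mu n : size (cumulant_seq mu n) = n.
Proof. by elim: n => //= n IH; rewrite size_rcons IH. Qed.

Lemma nth_cumulant_seq mu n m : (m < n)%N -> (cumulant_seq mu n)`_m = cumulant mu m.
Proof.
elim: n => // n IH; rewrite ltnS leq_eqVlt => /predU1P[-> //|mn].
by rewrite /= nth_rcons size_cumulant_seq mn IH.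
Qed.

Lemma cumulantE mu m : cumulant mu m =
  mu m.+1 - \sum_(i < m) cumulant mu i * mu (m - i)%N *+ 'C(m, i).
Proof.
rewrite {1}/cumulant /= nth_rcons size_cumulant_seq ltnn eqxx; congr (_ - _).
by apply: eq_bigr => i _; rewrite nth_cumulant_seq.
Qed.

Lemma cumulantP mu : mu 0%N = 1 -> is_cumulant mu (cumulant mu).
Proof.
move=> mu0 m; rewrite /bconv big_ord_recr/= subnn mu0 mulr1 binn mulr1n.
by rewrite (cumulantE mu m) addrC subrK.
Qed.

Lemma is_cumulant_exp (b : R) :
  is_cumulant (fun m => b ^+ m) (fun i => if i == 0%N then b else 0).
Proof.
move=> m; rewrite /bconv big_ord_recl/= subn0 bin0 mulr1n big1 ?addr0 ?exprS//.
by move=> i _; rewrite mul0r mul0rn.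
Qed.

End BinomialConvolution.

(** * From bounds on cumulants to bounds on moments *)

Section CumulantBounds.
Context {R : realFieldType}.

(** The formal moment sequence with generating function 1 + t z. For t = 1/a this is the quotient of
    the moment generating functions at parameters a + 1 and a; its logarithmic derivative t / (1 + t
    z) yields the cumulants below. *)
Definition affine_mgf (t : R) (m : nat) : R := if m is m'.+1 then (m' == 0%N)%:R * t else 1.

Lemma is_cumulant_affine_mgf (t : R) :
  is_cumulant (affine_mgf t) (fun i => (- 1) ^+ i * i`!%:R * t ^+ i.+1).
Proof.
move=> [|m].
  by rewrite bconv0 /= fact0 !mul1r mulr1 expr1.
rewrite /bconv !big_ord_recr/= big1 ?add0r; last first.
  move=> i _; rewrite /affine_mgf; case E : (m.+1 - i)%N => [|[|l]].
  - by move/eqP: E; rewrite subn_eq0 leqNgt ltnS ltnW.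
  - have := ltn_ord i; rewrite -subn_gt0; move: E; rewrite subSn; last exact: ltnW.
    by move=> [->].
  - by rewrite /= mul0r mulr0 mul0rn.
rewrite subnn /affine_mgf/= subSn// subnn/= mul0r mul1r mulr1 binn mulr1n.
rewrite binSn factS natrM -(mulr_natr (_ * t)) !exprS.
by ring.
Qed.

Lemma bconv_affine_mgf mu (t : R) m :
  bconv mu (affine_mgf t) m = mu m + m%:R * t * mu m.-1.
Proof.
case: m => [|m]; first by rewrite bconv0 /= mulr1 !mul0r addr0.
rewrite /bconv !big_ord_recr/= big1 ?add0r; last first.
  move=> i _; rewrite /affine_mgf; case E : (m.+1 - i)%N => [|[|l]].
  - by move/eqP: E; rewrite subn_eq0 leqNgt ltnS ltnW.
  - have := ltn_ord i; rewrite -subn_gt0; move: E; rewrite subSn; last exact: ltnW.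
    by move=> [->].
  - by rewrite /= mul0r mulr0 mul0rn.
rewrite subnn /affine_mgf/= subSn// subnn/= mul1r mulr1 binn mulr1n binSn.
by rewrite -(mulr_natr (_ * t)) addrC; ring.
Qed.

Definition normal_cumulant (i : nat) : R := (i == 1%N)%:R.

Lemma bconv_normal_cumulant mu m : bconv normal_cumulant mu m = m%:R * mu m.-1.
Proof.
case: m => [|m]; first by rewrite bconv0 /normal_cumulant !mul0r.
rewrite /bconv !big_ord_recl/= /bump/= big1 => [|i _].
  by rewrite /normal_cumulant/= mul0r mul0rn add0r addr0 mul1r bin1 subn1 mulr_natl.
by rewrite /normal_cumulant/= mul0r mul0rn.
Qed.

Lemma normal_moment_rec nu : is_cumulant nu normal_cumulant ->
  forall m, nu m.+1 = m%:R * nu m.-1.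
Proof. by move=> hnu m; rewrite hnu bconv_normal_cumulant. Qed.

Lemma normal_moment_odd nu : is_cumulant nu normal_cumulant ->
  forall m, odd m -> nu m = 0.
Proof.
move=> /normal_moment_rec hnu; elim/ltn_ind => -[//|[|m]] IH om.
  by rewrite hnu mul0r.
by rewrite hnu IH ?mulr0//; move: om; rewrite /= negbK.
Qed.

(* The gain exponents: a standardized moment sequence whose cumulants of order
   [i >= 3] are O(eps), resp. O(eps^2) for even [i], has the same behaviour. *)
Definition gain (j : nat) : nat := (~~ odd j).+1.

(** [C] is chosen before [eps], [mu] and [c], hence will be uniform in the dimension. The induction
    compares the two recurrences for the moments term by term. *)
Lemma moment_gap_bound (nu : nat -> R) (K : R) (k : nat) : 0 <= K -> nu 0%N = 1 ->
  is_cumulant nu normal_cumulant ->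
  exists2 C, 0 <= C & forall (eps : R) (mu c : nat -> R),
    0 <= eps <= 1 -> mu 0%N = 1 -> is_cumulant mu c -> c 0%N = 0 -> c 1%N = 1 ->
    (forall i, (2 <= i < k)%N -> `|c i| <= K * eps ^+ gain i.+1) ->
    forall j, (j <= k)%N -> `|mu j - nu j| <= C * eps ^+ gain j.
Proof.
move=> K0 nu0 hnu; elim: k => [|k [C C0 IH]].
  exists 0 => // eps mu c _ mu0 _ _ _ _ j; rewrite leqn0 => /eqP ->.
  by rewrite mu0 nu0 subrr normr0 mul0r.
pose B := \sum_(j < k.+1) `|nu j|.
have B0 : 0 <= B by rewrite sumr_ge0.
pose C1 := \sum_(i < k.+1) (C + K * (B + C)) *+ 'C(k, i).
have D0 : 0 <= C + K * (B + C) by rewrite addr_ge0// mulr_ge0// addr_ge0.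
have C10 : 0 <= C1 by rewrite sumr_ge0// => i _; rewrite mulrn_wge0.
exists (C + C1); first by rewrite addr_ge0.
move=> eps mu c /andP[e0 e1] mu0 hc c0 c1 cK j.
have e01 : 0 <= eps <= 1 by rewrite e0.
have cK' i : (2 <= i < k)%N -> `|c i| <= K * eps ^+ gain i.+1.
  by move=> /andP[i2 ik]; apply: cK; rewrite i2 ltnS ltnW.
have gap := IH eps mu c e01 mu0 hc c0 c1 cK'.
have pe l : 0 <= eps ^+ l by rewrite exprn_ge0.
rewrite leq_eqVlt ltnS => /predU1P[->|jk]; last first.
  by rewrite mulrDl (le_trans (gap _ jk))// lerDl mulr_ge0.
rewrite mulrDl ler_wpDl ?mulr_ge0// hc hnu /bconv -sumrB.
apply: le_trans (ler_norm_sum _ _ _) _; rewrite mulr_suml; apply: ler_sum => i _.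
have ik : (i <= k)%N by rewrite -ltnS.
suff : `|c i * mu (k - i)%N - normal_cumulant i * nu (k - i)%N| <=
    (C + K * (B + C)) * eps ^+ gain k.+1.
  have [r r0 E] : exists2 r : R, 0 <= r & forall x : R, x *+ 'C(k, i) = x * r.
    by exists ('C(k, i))%:R => // x; rewrite mulr_natr.
  by move=> le_i; rewrite !E -mulrBl normrM (ger0_norm r0) [leRHS]mulrAC ler_wpM2r.
have [i0|i1|i2] := ltngtP i 1%N.
- move: i0; rewrite ltnS leqn0 => /eqP ->.
  by rewrite c0 /normal_cumulant !mul0r subrr normr0 mulr_ge0.
- have ik' : (i < k.+1)%N by [].
  rewrite /normal_cumulant (gtn_eqF i1) mul0r subr0 normrM.
  have ci : `|c i| <= K * eps ^+ gain i.+1 by apply: cK; rewrite i1.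
  have gj := gap _ (leq_subr i k).
  have muB : `|mu (k - i)%N| <= B + C.
    rewrite -[mu _](subrK (nu (k - i)%N)) (le_trans (ler_normD _ _))// addrC lerD//.
      have kik : (k - i < k.+1)%N by rewrite ltnS leq_subr.
      by rewrite /B (bigD1 (Ordinal kik))//= lerDl sumr_ge0.
    by apply: le_trans gj _; rewrite ler_piMr// exprn_ile1.
  apply: (@le_trans _ _ (K * (B + C) * eps ^+ gain k.+1)); last first.
    by rewrite ler_wpM2r// lerDr.
  (* Either the cumulant has even order [i + 1] and carries eps^2, or the moment has odd order
     [k + 1] and a single eps is enough. *)
  have [oi|oi] := boolP (odd i || ~~ odd k).
    apply: (@le_trans _ _ (K * eps ^+ gain k.+1 * (B + C))); last by rewrite mulrAC.
    apply: ler_pM => //; apply: le_trans ci _; rewrite ler_wpM2l//.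
    apply: ler_wiXn2l => //; rewrite /gain !ltnS /= !negbK.
    by move: oi; case: (odd i); case: (odd k).
  (* Here [k - i] is odd: the normal moment vanishes, so the moment itself is O(eps) and supplies
     the second factor. *)
  move: oi; rewrite negb_or negbK => /andP[oi ok].
  have okj : odd (k - i) by rewrite oddB// ok (negbTE oi).
  move: ci gj; rewrite /gain /= okj ok oi/= (normal_moment_odd hnu okj) subr0 expr1.
  move=> ci gj; apply: (@le_trans _ _ (K * eps * (C * eps))).
    exact: ler_pM.
  rewrite mulrACA -expr2 ler_wpM2r ?sqr_ge0// ler_wpM2l// lerDr.
  exact: B0.
- rewrite i2 c1 /normal_cumulant eqxx !mul1r.
  have k1 : (0 < k)%N by rewrite -i2.
  apply: le_trans (gap _ (leq_subr _ _)) _.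
  rewrite (_ : gain (k - 1) = gain k.+1); last first.
    by rewrite /gain oddB//= addbT negbK.
  by rewrite ler_wpM2r// lerDl mulr_ge0// addr_ge0.
Qed.

End CumulantBounds.

(** * Moments of the logarithm of a Gamma variable *)

Section DecayingFunctions.
Context {R : realType}.
Local Notation leb := (@lebesgue_measure R).

(** A class stable under sums and multiplication by powers, whose members are integrable and vanish
    at infinity, so that integration by parts reduces to membership. *)
Definition decaying (f : R -> R) := continuous f /\ exists C d : R,
  [/\ 0 <= C, 0 < d & forall u, `|f u| <= C * expR (- (d * `|u|))].

Lemma eq_decaying (f g : R -> R) : f =1 g -> decaying f -> decaying g.
Proof. by move=> /funext ->. Qed.

Lemma decayingD (f g : R -> R) : decaying f -> decaying g ->
  decaying (fun u => f u + g u).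
Proof.
move=> [cf [C [c [C0 c0 fC]]]] [cg [D [d [D0 d0 gD]]]]; split.
  by move=> x; apply: cvgD; [exact: cf|exact: cg].
exists (C + D), (Num.min c d); split; [exact: addr_ge0|by rewrite lt_min c0|].
move=> u; apply: le_trans (ler_normD _ _) _; rewrite mulrDl; apply: lerD.
  apply: le_trans (fC u) _; rewrite ler_wpM2l// ler_expR lerN2 ler_wpM2r//.
  by rewrite ge_min lexx.
apply: le_trans (gD u) _; rewrite ler_wpM2l// ler_expR lerN2 ler_wpM2r//.
by rewrite ge_min lexx orbT.
Qed.

Lemma decayingZ (k : R) (f : R -> R) : decaying f -> decaying (fun u => k * f u).
Proof.
move=> [cf [C [c [C0 c0 fC]]]]; split.
  by move=> x; apply: cvgM; [exact: cvg_cst|exact: cf].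
exists (`|k| * C), c; split => [|//|u]; first by rewrite mulr_ge0.
by rewrite normrM -mulrA ler_wpM2l.
Qed.

(** Half of the decay rate pays for the factor: [|u|] is at most 2/c times the exponential of
    [c |u| / 2]. *)
Lemma decayingXM (f : R -> R) : decaying f -> decaying (fun u => u * f u).
Proof.
move=> [cf [C [c [C0 c0 fC]]]]; split.
  by move=> x; apply: cvgM; [exact: cvg_id|exact: cf].
exists (C * (2 / c)), (c / 2); split => [||u].
- by rewrite mulr_ge0// divr_ge0// ltW.
- by rewrite divr_gt0.
rewrite normrM; apply: (@le_trans _ _ (2 / c * expR (c / 2 * `|u|) * (C * expR (- (c * `|u|))))).
  apply: ler_pM => //; rewrite -ler_pdivrMl ?divr_gt0// invf_div.
  by apply: le_trans (expR_ge1Dx _); rewrite lerDr.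
rewrite (_ : - (c * `|u|) = - (c / 2 * `|u|) - c / 2 * `|u|); last by field.
rewrite expRD !expRN le_eqVlt; apply/orP; left; apply/eqP.
by field; rewrite !gt_eqF ?expR_gt0.
Qed.

Lemma decayingXn (f : R -> R) m : decaying f -> decaying (fun u => u ^+ m * f u).
Proof.
move=> df; elim: m => [|m IH].
  by apply: eq_decaying df => u; rewrite expr0 mul1r.
by apply: eq_decaying (decayingXM IH) => u; rewrite exprS mulrA.
Qed.

Lemma decaying_sum (I : Type) (s : seq I) (f : I -> R -> R) (g : R -> R) : decaying g ->
  (forall i, decaying (f i)) -> decaying (fun u => \sum_(i <- s) f i u).
Proof.
move=> dg df; elim: s => [|i s IH].
  by apply: eq_decaying (decayingZ 0 dg) => u; rewrite big_nil mul0r.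
by apply: eq_decaying (decayingD (df i) IH) => u; rewrite big_cons.
Qed.

Lemma integrable_exponential_abs (d : R) : 0 < d ->
  leb.-integrable setT (fun u => (expR (- (d * `|u|)))%:E).
Proof.
move=> d0; have i1 := integrable_exponential_pdf d0.
have m1 : measurable_fun setT (exponential_pdf d) by exact: measurable_exponential_pdf.
have i2 : leb.-integrable setT (fun u => (exponential_pdf d (- u))%:E).
  have m2 : measurable_fun setT (fun u : R => exponential_pdf d (- u)).
    exact: measurableT_comp.
  apply/integrableP; split; first exact/measurable_EFinP.
  have E : (\int[leb]_u `|(exponential_pdf d (- u))%:E| =
      \int[leb]_u `|(EFin \o exponential_pdf d) u|)%E.
    rewrite -(@ge0_integral_affine _ (-1) 0 (fun u => `|(EFin \o exponential_pdf d) u|)%E)//.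
    - rewrite normrN1 mul1e; apply: eq_integral => u _ /=.
      by rewrite mulN1r addr0.
    - by apply: measurableT_comp => //; exact/measurable_EFinP.
  by rewrite E; case/integrableP: i1.
apply: (le_integrable measurableT _ _ (integrableZl measurableT d^-1 (integrableD measurableT i1 i2))) => //.
  apply/measurable_EFinP; apply: measurableT_comp => //; apply: measurableT_comp => //.
  by apply: measurable_funM => //; exact: measurableT_comp.
have p0 v : 0 <= exponential_pdf d v by rewrite exponential_pdf_ge0// ltW.
have d'0 : 0 <= d^-1 by rewrite invr_ge0 ltW.
move=> u _ /=; rewrite lee_fin ger0_norm ?expR_ge0// [leRHS]ger0_norm; last first.
  by rewrite mulr_ge0// addr_ge0.
rewrite mulrDr; have [u0|u0] := leP 0 u.
  by rewrite exponential_pdfE// mulKf ?gt_eqF// (ger0_norm u0) mulNr lerDl mulr_ge0.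
rewrite [X in _ <= _ + _ * X]exponential_pdfE; last by rewrite oppr_ge0 ltW.
by rewrite mulKf ?gt_eqF// (ltr0_norm u0) mulNr lerDr mulr_ge0.
Qed.

Lemma decaying_measurable (f : R -> R) : decaying f -> measurable_fun setT f.
Proof. by move=> [cf _]; exact: continuous_measurable_fun. Qed.

Lemma decaying_integrable (f : R -> R) : decaying f ->
  leb.-integrable setT (EFin \o f).
Proof.
move=> df; have mf := decaying_measurable df; case: df => [_ [C [c [C0 c0 fC]]]].
apply: (le_integrable measurableT _ _ (integrableZl measurableT C (integrable_exponential_abs c0))) => //.
  exact/measurable_EFinP.
by move=> u _ /=; rewrite lee_fin (le_trans (fC u))// ler_norm.
Qed.

Lemma decayingRD (f g : R -> R) : decaying f -> decaying g ->
  \int[leb]_u (f u + g u) = \int[leb]_u f u + \int[leb]_u g u.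
Proof. by move=> df dg; rewrite RintegralD//; exact: decaying_integrable. Qed.

Lemma decayingRZ (k : R) (f : R -> R) : decaying f ->
  \int[leb]_u (k * f u) = k * \int[leb]_u f u.
Proof. by move=> df; rewrite RintegralZl//; exact: decaying_integrable. Qed.

Lemma decayingRle (f g : R -> R) : decaying f -> decaying g -> (forall u, f u <= g u) ->
  \int[leb]_u f u <= \int[leb]_u g u.
Proof. by move=> df dg fg; apply: le_Rintegral => //; exact: decaying_integrable. Qed.

Lemma decayingR_sum n (f : nat -> R -> R) : (forall i, decaying (f i)) ->
  \int[leb]_u (\sum_(i < n) f i u) = \sum_(i < n) \int[leb]_u f i u.
Proof.
move=> df; elim: n => [|n IH].
  transitivity (\int[leb]_u (0 * f 0%N u)).
    by apply: eq_Rintegral => u _; rewrite big_ord0 mul0r.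
  by rewrite decayingRZ// mul0r big_ord0.
rewrite big_ord_recr/= -IH.
transitivity (\int[leb]_u (\sum_(i < n) f i u + f n u)).
  by apply: eq_Rintegral => u _; rewrite big_ord_recr.
rewrite decayingRD//.
have := @decaying_sum _ (index_enum 'I_n) (fun i u => f (i : 'I_n) u) _ (df 0%N).
by apply.
Qed.

(** Integration by parts: on growing symmetric intervals the integral of [f] is a difference of
    boundary values of [F], which tend to 0. *)
Lemma integral_derive_decaying (F f : R -> R) : (forall x : R, is_derive x (1 : R) F (f x)) ->
  decaying F -> decaying f -> \int[leb]_u f u = 0.
Proof.
move=> dF FD fD; have mf := decaying_measurable fD.
have intf := decaying_integrable fD.
pose A n : set R := `[(- n.+1%:R)%R, (n.+1%:R : R)]%classic.
pose f_ n := ((EFin \o f) \_ (A n)).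
have mA n : measurable (A n : set (measurableTypeR R)) by exact: measurable_itv.
have mf_ n : measurable_fun setT (f_ n).
  apply/(measurable_restrictT _ (mA n)); apply: measurable_funTS; exact/measurable_EFinP.
have cvg1 : (\int[leb]_u f_ n u @[n --> \oo] --> \int[leb]_u (f u)%:E)%E.
  apply: (@dominated_cvg _ _ _ leb setT measurableT f_ (EFin \o f) (fun u => `|(EFin \o f) u|%E)) => //.
  - move=> u _; apply: cvg_near_cst; near=> n.
    rewrite /f_ patchE ifT// inE /A/= in_itv/= -ler_norml.
    by rewrite (@le_trans _ _ n%:R)// ?ler_nat//; near: n; exact: nbhs_infty_ger.
  - exact: integrable_abse.
  - by move=> n u _; rewrite /f_ patchE; case: ifP => // _; rewrite abse0.
have fE n : (\int[leb]_u f_ n u)%E = (F n.+1%:R - F (- n.+1%:R))%:E.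
  rewrite -integral_mkcond (@continuous_FTC2 _ _ F) ?EFinB//.
  - by rewrite gtrN.
  - by apply: continuous_subspaceT; exact: fD.1.
  - split => [x _||].
    + by have [] := dF x.
    + by apply: cvg_at_right_filter; exact: FD.1.
    + by apply: cvg_at_left_filter; exact: FD.1.
  - by move=> x _; rewrite derive1E derive_val.
have cvg0 : (\int[leb]_u f_ n u @[n --> \oo] --> (0 : \bar R))%E.
  under eq_fun do rewrite fE.
  apply: cvg_EFin; first by near=> n.
  have [_ [C [c [C0 c0 FC]]]] := FD.
  (* From exp(-c x) <= 1/(c x), applied at both ends. *)
  pose K := 2 * C / c.
  have hK : K * harmonic n @[n --> \oo] --> (0 : R).
    by rewrite -[X in _ --> X](mulr0 K); apply: cvgM; [exact: cvg_cst|exact: cvg_harmonic].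
  apply: (@squeeze_cvgr _ _ _ _ (fun n => - (K * harmonic n)) (fun n => K * harmonic n)) => //.
    near=> n; rewrite -ler_norml /=.
    have e_le : expR (- (c * n.+1%:R)) <= c^-1 * harmonic n.
      rewrite expRN /harmonic -invfM lef_pV2 ?posrE ?expR_gt0 ?mulr_gt0//.
      by apply: le_trans (expR_ge1Dx _); rewrite lerDr.
    apply: (le_trans (ler_normB _ _)).
    apply: (@le_trans _ _ (C * (c^-1 * harmonic n) + C * (c^-1 * harmonic n))); last first.
      rewrite -[leRHS]/(K * harmonic n); move: (harmonic n) => h; rewrite /K.
      by rewrite le_eqVlt; apply/orP; left; apply/eqP; field; rewrite gt_eqF.
    apply: lerD; rewrite (le_trans (FC _))// ler_wpM2l//.
      by rewrite ger0_norm.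
    by rewrite normrN ger0_norm.
  by rewrite -oppr0; exact: cvgN.
have E : (\int[leb]_u (f u)%:E)%E = 0%E by apply: (cvg_unique _ cvg1 cvg0).
by rewrite /Rintegral E.
Unshelve. all: by end_near. Qed.

End DecayingFunctions.

Section LogGamma.
Context {R : realType}.
Local Notation leb := (@lebesgue_measure R).

(** Unnormalized density of the logarithm of twice a Gamma variable with parameter [a]; its mass is
    2^a Gamma(a). *)
Definition rho (a u : R) : R := expR (a * u - expR u / 2).

Lemma rhoM (a b u : R) : expR (b * u) * rho a u = rho (a + b) u.
Proof. by rewrite /rho -expRD; congr expR; ring. Qed.

Lemma rho_gt0 (a u : R) : 0 < rho a u. Proof. exact: expR_gt0. Qed.

Lemma continuous_rho (a : R) : continuous (rho a).
Proof.
move=> x; apply: (cvg_comp _ expR); last exact: continuous_expR.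
apply: cvgB; first by apply: cvgM; [exact: cvg_cst|exact: cvg_id].
by apply: cvgM; [exact: continuous_expR|exact: cvg_cst].
Qed.

Lemma decaying_rho (a : R) : 0 < a -> decaying (rho a).
Proof.
move=> a0; split; first exact: continuous_rho.
(* The point where the tangent of [expR u / 2] has slope [2 * a]; being below the graph, this
   tangent turns growth at rate [a] into decay at rate [a]. *)
pose c : R := ln (4 * a).
have ec : expR c = 4 * a by rewrite lnK// posrE mulr_gt0.
exists (1 + expR (2 * a * (c - 1))), a; split => [||u]; first by rewrite addr_ge0 ?expR_ge0.
  by [].
rewrite ger0_norm ?expR_ge0// mulrDl mul1r.
have [u0|u0] := leP u 0.
  apply: (@le_trans _ _ (expR (- (a * `|u|)))); last by rewrite lerDl mulr_ge0 ?expR_ge0.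
  by rewrite ler_expR ler0_norm// mulrN opprK lerBlDr lerDl divr_ge0 ?expR_ge0.
apply: (@le_trans _ _ (expR (2 * a * (c - 1)) * expR (- (a * `|u|)))); last first.
  by rewrite lerDr expR_ge0.
rewrite -expRD ler_expR gtr0_norm//.
have H : 1 + (u - c) <= expR (u - c) by exact: expR_ge1Dx.
have -> : expR u = 4 * a * expR (u - c) by rewrite -ec -expRD; congr expR; ring.
nra.
Qed.

Definition rho_moment (a : R) (m : nat) : R := \int[leb]_u (u ^+ m * rho a u).

Lemma is_derive_Xn_rho (a : R) m (x : R) : is_derive x (1 : R) (fun u => u ^+ m * rho a u)
  (m%:R * (x ^+ m.-1 * rho a x) + (a * (x ^+ m * rho a x) + - 2^-1 * (x ^+ m * rho (a + 1) x))).
Proof.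
have -> : (fun u => u ^+ m * rho a u) = (id ^+ m) * (rho a).
  by apply/funext => u; rewrite !fctE.
rewrite /rho; apply: is_derive_eq.
rewrite /GRing.scale/= !(scaler0, addr0, add0r, scaler1, mulr1).
have -> : expR ((a + 1) * x - expR x / 2) = expR x * expR (a * x - expR x / 2).
  by rewrite -expRD; congr expR; ring.
have -> : (id ^+ m) x = x ^+ m by rewrite fctE.
by field.
Qed.

(** The integral of the derivative of [u ^+ m * rho a u] is zero; the inner derivative produces
    [expR u * rho a u = rho (a + 1) u]. *)
Lemma rho_moment_rec (a : R) m : 0 < a ->
  rho_moment (a + 1) m = 2 * a * rho_moment a m + 2 * m%:R * rho_moment a m.-1.
Proof.
move=> a0; have a10 : 0 < a + 1 by rewrite addr_gt0.
have d0 := decaying_rho a0; have d1 := decaying_rho a10.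
have H := integral_derive_decaying (is_derive_Xn_rho a m) (decayingXn m d0).
have D1 := decayingZ (m%:R) (decayingXn m.-1 d0).
have D2 := decayingZ a (decayingXn m d0).
have D3 := decayingZ (- 2^-1) (decayingXn m d1).
have := H (decayingD D1 (decayingD D2 D3)).
rewrite !decayingRD//; last exact: decayingD.
rewrite (decayingRZ _ (decayingXn m.-1 d0)) (decayingRZ _ (decayingXn m d0)).
rewrite (decayingRZ _ (decayingXn m d1)) -/(rho_moment a m) -/(rho_moment a m.-1).
rewrite -/(rho_moment (a + 1) m) => E; clear -E; lra.
Qed.

Lemma rho_moment0_gt0 (a : R) : 0 < a -> 0 < rho_moment a 0.
Proof.
move=> a0; have d0 := decayingXn 0 (decaying_rho a0).
have intf := decaying_integrable d0.
rewrite -lte_fin fineK; last exact: integrable_fin_num.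
pose c : R := expR (- (expR 1 / 2)).
have mI : measurable (`[0, 1]%classic : set (measurableTypeR R)) by exact: measurable_itv.
have mf : measurable_fun setT (fun u : R => (u ^+ 0 * rho a u)%:E).
  by apply/measurable_EFinP; exact: decaying_measurable d0.
apply: (@lt_le_trans _ _ (\int[leb]_(u in `[0%R, 1%R]) c%:E)%E).
  rewrite integral_cst//= lebesgue_measure_itv/= lte_fin ltr01 oppr0 adde0 mule1.
  by rewrite lte_fin expR_gt0.
apply: (@le_trans _ _ (\int[leb]_(u in `[0%R, 1%R]) (u ^+ 0 * rho a u)%:E)%E).
  apply: ge0_le_integral => //.
  - by move=> u _; rewrite lee_fin expR_ge0.
  - exact: measurable_funTS.
  - move=> u /=; rewrite in_itv/= => /andP[u0 u1]; rewrite lee_fin expr0 mul1r ler_expR.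
    have : expR u <= expR 1 by rewrite ler_expR.
    nra.
apply: ge0_subset_integral => //.
by move=> u _; rewrite lee_fin expr0 mul1r expR_ge0.
Qed.

Definition lgmoment (a : R) (m : nat) : R := rho_moment a m / rho_moment a 0.

Lemma lgmoment0 (a : R) : 0 < a -> lgmoment a 0 = 1.
Proof. by move=> a0; rewrite /lgmoment divff// gt_eqF// rho_moment0_gt0. Qed.

(* Gamma (a + 1) = a Gamma a, on the level of the moments of the logarithm. *)
Lemma lgmoment_rec (a : R) m : 0 < a ->
  lgmoment (a + 1) m = bconv (lgmoment a) (affine_mgf a^-1) m.
Proof.
move=> a0; rewrite bconv_affine_mgf /lgmoment !rho_moment_rec// mulr0 mul0r addr0.
have := rho_moment0_gt0 a0; move: (rho_moment a 0) => z z0.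
by field; rewrite !gt_eqF.
Qed.

(** Moments about [ln (2 * a)], not about the mean: twice a Gamma variable has mean [2 * a], so the
    exponential of the centered variable has mean exactly 1. *)
Definition lgcentral (a : R) : nat -> R := bconv (lgmoment a) (fun i => (- ln (2 * a)) ^+ i).

Lemma lgcentralE (a : R) j : 0 < a -> rho_moment a 0 * lgcentral a j =
  \int[leb]_u ((u - ln (2 * a)) ^+ j * rho a u).
Proof.
move=> a0; have d0 := decaying_rho a0; set b := ln _.
pose f i u := ((- b) ^+ (j - i) *+ 'C(j, i)) * (u ^+ i * rho a u).
transitivity (\int[leb]_u (\sum_(i < j.+1) f i u)); last first.
  apply: eq_Rintegral => u _; rewrite [u - b]addrC exprDn mulr_suml.
  by apply: eq_bigr => i _; rewrite /f mulrA mulrnAl.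
rewrite decayingR_sum => [|i]; last exact/decayingZ/decayingXn.
rewrite /lgcentral /bconv mulr_sumr; apply: eq_bigr => i _.
rewrite decayingRZ -/(rho_moment a i); last exact: decayingXn.
rewrite /lgmoment -mulrnAr mulrA mulrC (mulrC (rho_moment a 0)) divfK//.
by rewrite gt_eqF// rho_moment0_gt0.
Qed.

(* Multiplying the density [rho a] by [expR (x - b)] or [expR (b - x)] shifts [a] by one,
   so this bounds the central moments by the masses of [rho (a + 1)] and [rho (a - 1)]. *)
Lemma cosh_lower_bound (x : R) j : (0 < j)%N ->
  x ^+ (2 * j) <= (2 ^+ j * j`!%:R) ^+ 2 * (expR x + expR (- x) - 2).
Proof.
case: j => // j _; wlog x0 : x / 0 <= x.
  move=> H; have [x0|x0] := leP 0 x; first exact: H.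
  have := H (- x); rewrite oppr_ge0 ltW// => /(_ isT).
  by rewrite opprK [expR (- x) + _]addrC !exprM sqrrN.
(* Both sides are squares; the square root of the inequality follows from exp(y) >= 1 + y^j / j! at
   y = x/2. *)
have -> : expR x + expR (- x) - 2 = (expR (x / 2) - expR (- (x / 2))) ^+ 2.
  rewrite sqrrB -!expRM_natl -expRD subrr expR0.
  rewrite (_ : 2%:R * (x / 2) = x); last by field.
  rewrite (_ : 2%:R * - (x / 2) = - x); last by field.
  by ring.
rewrite mulnC exprM -exprMn; apply: lerXn2r; rewrite ?nnegrE ?exprn_ge0//.
  rewrite mulr_ge0 ?mulr_ge0 ?exprn_ge0// subr_ge0 ler_expR.
  by rewrite lerNl (@le_trans _ _ 0)// ?oppr_le0 divr_ge0.
have H := @expR_ge1Dxn _ (x / 2) j (divr_ge0 x0 (ler0n _ 2)).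
have H1 : expR (- (x / 2)) <= 1 by rewrite -expR0 ler_expR oppr_le0 divr_ge0.
have f0 : 0 < (j.+1)`!%:R :> R by rewrite ltr0n fact_gt0.
apply: (@le_trans _ _ (2 ^+ j.+1 * (j.+1)`!%:R * ((x / 2) ^+ j.+1 / (j.+1)`!%:R))).
  rewrite expr_div_n le_eqVlt; apply/orP; left; apply/eqP.
  have p0 : 0 < 2 ^+ j.+1 :> R by rewrite exprn_gt0.
  by move: f0 p0; move: ((j.+1)`!%:R) (2 ^+ j.+1) (x ^+ j.+1) => f q y f0 q0;
    field; rewrite !gt_eqF.
rewrite ler_wpM2l ?mulr_ge0 ?exprn_ge0//.
lra.
Qed.

(** With u the variable and b = log(2a), the means of exp(u - b) and exp(b - u) are 1 and a/(a - 1),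
    so their sum minus 2 is exactly 1/(a - 1). *)
Lemma lgcentral_bound (a : R) j : 1 < a -> (0 < j)%N ->
  lgcentral a j ^+ 2 <= (2 ^+ j * j`!%:R) ^+ 2 / (a - 1).
Proof.
move=> a1 j0; have a0 : 0 < a by rewrite (lt_trans _ a1).
have a10 : 0 < a - 1 by rewrite subr_gt0.
have d0 := decaying_rho a0; have z0 := rho_moment0_gt0 a0.
set D := (2 ^+ j * j`!%:R) ^+ 2; set b := ln (2 * a).
have eb : expR b = 2 * a by rewrite lnK// posrE mulr_gt0.
have dc i : decaying (fun u => (u - b) ^+ i * rho a u).
  elim: i => [|i IH]; first by apply: eq_decaying d0 => u; rewrite expr0 mul1r.
  apply: eq_decaying (decayingD (decayingXM IH) (decayingZ (- b) IH)) => u.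
  by rewrite exprS; ring.
(* Nonnegativity of the variance of the [j]-th power. *)
have step1 : lgcentral a j ^+ 2 <= lgcentral a (2 * j).
  set c := lgcentral a j.
  have D1 := decayingZ (- (2 * c)) (dc j).
  have D2 := decayingZ (c ^+ 2) (decayingXn 0 d0).
  have : 0 <= \int[leb]_u (((u - b) ^+ j - c) ^+ 2 * rho a u).
    by apply: Rintegral_ge0 => u _; rewrite mulr_ge0 ?sqr_ge0 ?expR_ge0.
  under eq_Rintegral => u _.
    rewrite (_ : _ * _ = (u - b) ^+ (2 * j) * rho a u +
      (- (2 * c) * ((u - b) ^+ j * rho a u) + c ^+ 2 * (u ^+ 0 * rho a u))).
      over.
    by rewrite mulnC exprM; ring.
  rewrite decayingRD//; last exact: decayingD.
  rewrite (decayingRD D1 D2) (decayingRZ _ (dc j)) (decayingRZ _ (decayingXn 0 d0)).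
  rewrite -!lgcentralE// -/(rho_moment a 0) -/c => H.
  have : 0 <= rho_moment a 0 * (lgcentral a (2 * j) - c ^+ 2) by nra.
  by rewrite pmulr_rge0// subr_ge0.
apply: le_trans step1 _.
rewrite -(ler_pM2l z0) lgcentralE// -/b.
have dp : decaying (rho (a + 1)) by apply: decaying_rho; rewrite addr_gt0.
have dm : decaying (rho (a - 1)) by exact: decaying_rho.
have E1 := decayingZ (D / (2 * a)) (decayingXn 0 dp).
have E2 := decayingZ (D * (2 * a)) (decayingXn 0 dm).
have E3 := decayingZ (- (2 * D)) (decayingXn 0 d0).
apply: (@le_trans _ _ (\int[leb]_u (D / (2 * a) * (u ^+ 0 * rho (a + 1) u) +
    (D * (2 * a) * (u ^+ 0 * rho (a - 1) u) + - (2 * D) * (u ^+ 0 * rho a u))))).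
  apply: decayingRle => //; first by apply: decayingD => //; exact: decayingD.
  move=> u; rewrite !expr0 !mul1r -(rhoM a 1) -(rhoM a (-1)).
  rewrite mul1r mulN1r.
  have := cosh_lower_bound (u - b) j0; rewrite -/D opprB !expRB eb.
  move=> H; apply: le_trans (ler_wpM2r (ltW (rho_gt0 a u)) H) _.
  rewrite expRN le_eqVlt; apply/orP; left; apply/eqP.
  by field; rewrite !gt_eqF ?expR_gt0.
rewrite decayingRD//; last exact: decayingD.
rewrite (decayingRD E2 E3) (decayingRZ _ (decayingXn 0 dp)) (decayingRZ _ (decayingXn 0 dm)).
rewrite (decayingRZ _ (decayingXn 0 d0)).
rewrite -!/(rho_moment _ 0) rho_moment_rec// mulr0 mul0r addr0.
have : rho_moment a 0 = 2 * (a - 1) * rho_moment (a - 1) 0.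
  by rewrite -{1}(subrK 1 a) rho_moment_rec// mulr0 mul0r addr0.
move: (rho_moment (a - 1) 0) => y zE; rewrite zE.
by rewrite le_eqVlt; apply/orP; left; apply/eqP; field; rewrite !gt_eqF.
Qed.

End LogGamma.

(** * Integrals and moments of functions of either sign *)

Section HasIntegral.
Context {R : realType}.
Local Open Scope ereal_scope.
Local Notation leb := (@lebesgue_measure R).

(** Integrability and value travel together, so that each rule below transports both. *)
Definition has_integral d (T : measurableType d) (P : {measure set T -> \bar R})
    (f : T -> R) (r : R) :=
  P.-integrable setT (EFin \o f) /\ \int[P]_w (f w)%:E = r%:E.

Section Linearity.
Context d (T : measurableType d) (P : {measure set T -> \bar R}).

Lemma eq_has_integral (f g : T -> R) r : f =1 g -> has_integral P f r -> has_integral P g r.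
Proof. by move=> /funext ->. Qed.

Lemma has_integralD (f g : T -> R) a b : has_integral P f a -> has_integral P g b ->
  has_integral P (fun w => f w + g w)%R (a + b).
Proof.
move=> [fi fa] [gi gb]; split; first exact: (integrableD measurableT fi gi).
under eq_integral do rewrite EFinD.
by rewrite integralD// fa gb EFinD.
Qed.

Lemma has_integralZ (k : R) (f : T -> R) a : has_integral P f a ->
  has_integral P (fun w => k * f w)%R (k * a).
Proof.
move=> [fi fa]; split; first exact: (integrableZl measurableT k fi).
under eq_integral do rewrite EFinM.
by rewrite integralZl// fa EFinM.
Qed.

Lemma has_integral_sum n (f : nat -> T -> R) (a : nat -> R) :
  (forall i, has_integral P (f i) (a i)) ->
  has_integral P (fun w => \sum_(i < n) f i w)%R (\sum_(i < n) a i).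
Proof.
move=> fa; elim: n => [|n IH].
  apply: eq_has_integral (_ : has_integral P (fun w => 0 * f 0%N w)%R _).
    by move=> w; rewrite mul0r big_ord0.
  by rewrite big_ord0 -[X in has_integral _ _ X](mul0r (a 0%N)); exact: has_integralZ.
rewrite big_ord_recr; apply: eq_has_integral (has_integralD IH (fa n)).
by move=> w; rewrite big_ord_recr.
Qed.

End Linearity.

(** Agreement on nonnegative test functions passes to signed ones through positive and negative
    parts. *)
Lemma has_integral_law d1 d2 (T1 : measurableType d1) (T2 : measurableType d2)
    (P : {measure set T1 -> \bar R}) (Q : {measure set T2 -> \bar R})
    (Y : T1 -> R) (W : T2 -> R) : measurable_fun setT Y ->
  (forall phi : R -> \bar R, measurable_fun setT phi -> (forall x, 0 <= phi x) ->
    \int[P]_w phi (Y w) = \int[Q]_w phi (W w)) ->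
  forall (phi : R -> R) r, measurable_fun setT phi ->
    has_integral Q (phi \o W) r -> has_integral P (phi \o Y) r.
Proof.
move=> mY PQ phi r mphi [/integrableP[_ iQ] eQ].
have mphi' : measurable_fun setT (EFin \o phi) by exact/measurable_EFinP.
split.
  apply/integrableP; split; first exact: (measurableT_comp mphi' mY).
  by rewrite (PQ (fun x => `|(phi x)%:E|))//; exact: measurableT_comp.
rewrite integralE -eQ [RHS]integralE; congr (_ - _).
  transitivity (\int[P]_w (EFin \o phi)^\+ (Y w)); first by apply: eq_integral => w _; rewrite !funeposE.
  rewrite (PQ ((EFin \o phi)^\+))//; last exact: measurable_funepos.
  by apply: eq_integral => w _; rewrite !funeposE.
transitivity (\int[P]_w (EFin \o phi)^\- (Y w)); first by apply: eq_integral => w _; rewrite !funenegE.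
rewrite (PQ ((EFin \o phi)^\-))//; last exact: measurable_funeneg.
by apply: eq_integral => w _; rewrite !funenegE.
Qed.

Lemma has_integral_density (P : {measure set (measurableTypeR R) -> \bar R}) (g : R -> R) :
  (forall u, 0 <= g u)%R ->
  (forall phi : R -> \bar R, measurable_fun setT phi -> (forall x, 0 <= phi x) ->
    \int[P]_w phi w = \int[leb]_u (phi u * (g u)%:E)) ->
  forall phi : R -> R, measurable_fun setT phi -> decaying (fun u => phi u * g u)%R ->
    has_integral P phi (\int[leb]_u (phi u * g u))%R.
Proof.
move=> g0 Pg phi mphi dphi; have iphi := decaying_integrable dphi.
have mphi' : measurable_fun setT (EFin \o phi) by exact/measurable_EFinP.
have aphi : measurable_fun setT (fun x => `|(phi x)%:E|) by exact: measurableT_comp.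
split.
  apply/integrableP; split => //; rewrite (Pg (fun x => `|(phi x)%:E|))//.
  case/integrableP: iphi => _; apply: le_lt_trans; rewrite le_eqVlt; apply/orP; left; apply/eqP.
  by apply: eq_integral => u _ /=; rewrite -EFinM normrM (ger0_norm (g0 u)).
rewrite /Rintegral fineK; last exact: integrable_fin_num.
rewrite integralE [RHS]integralE; congr (_ - _).
  rewrite (Pg ((EFin \o phi)^\+))//; last exact: measurable_funepos.
  apply: eq_integral => u _; rewrite !funeposE/= EFinM.
  by rewrite muleC -[in RHS]muleC maxe_pMr// ?mule0// lee_fin.
rewrite (Pg ((EFin \o phi)^\-))//; last exact: measurable_funeneg.
apply: eq_integral => u _; rewrite !funenegE/= -mulNr EFinM.
by rewrite muleC -[in RHS]muleC maxe_pMr// ?mule0// lee_fin.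
Qed.

Lemma has_integral_prod d1 d2 (T1 : measurableType d1) (T2 : measurableType d2)
    (P1 : probability T1 R) (P2 : probability T2 R) (f : T1 -> R) (g : T2 -> R) a b :
  has_integral P1 f a -> has_integral P2 g b ->
  has_integral (P1 \x P2) (fun z => f z.1 * g z.2)%R (a * b).
Proof.
move=> [fi fa] [gi gb].
have mf := measurable_int _ fi; have mg := measurable_int _ gi.
have mnf : measurable_fun setT (fun x => `|f x|%:E).
  by apply/measurable_EFinP; apply: measurableT_comp => //; exact/measurable_EFinP.
have mng : measurable_fun setT (fun x => `|g x|%:E).
  by apply/measurable_EFinP; apply: measurableT_comp => //; exact/measurable_EFinP.
have mF : measurable_fun setT (fun z : T1 * T2 => (f z.1)%:E * (g z.2)%:E).
  apply: emeasurable_funM.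
    exact: (measurableT_comp mf measurable_fst).
  exact: (measurableT_comp mg measurable_snd).
have mF' : measurable_fun setT (EFin \o (fun z : T1 * T2 => f z.1 * g z.2)%R).
  by apply: eq_measurable_fun mF => z _ /=; rewrite EFinM.
have i12 : (P1 \x P2).-integrable setT (EFin \o (fun z : T1 * T2 => f z.1 * g z.2)%R).
  apply/integrable12ltyP => //.
  have [/integrableP[_ ilf] /integrableP[_ ilg]] := (fi, gi).
  have E x : \int[P2]_y `|(f x * g y)%:E| = `|f x|%:E * \int[P2]_y `|g y|%:E.
    rewrite -ge0_integralZl//.
    by apply: eq_integral => y _ /=; rewrite normrM EFinM.
  rewrite /=; under eq_integral => x _ do rewrite E.
  rewrite ge0_integralZr//.
  - apply: lte_mul_pinfty => //.
    + exact: integral_ge0.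
    + by rewrite ge0_fin_numE// integral_ge0.
  - exact: integral_ge0.
split => //; rewrite -integral12_prod_meas1//.
under eq_integral => x _.
  rewrite /fubini_F; under eq_integral => y _ do rewrite /= EFinM.
  rewrite integralZl// gb; over.
by rewrite integralZr// fa EFinM.
Qed.

Definition has_moments d (T : measurableType d) (P : {measure set T -> \bar R})
    (Y : T -> R) (mu : nat -> R) := forall j, has_integral P (fun w => Y w ^+ j)%R (mu j).

Lemma has_moments_prodD d1 d2 (T1 : measurableType d1) (T2 : measurableType d2)
    (P1 : probability T1 R) (P2 : probability T2 R) (Y : T1 -> R) (W : T2 -> R) mu nu :
  has_moments P1 Y mu -> has_moments P2 W nu ->
  has_moments (P1 \x P2) (fun z => Y z.1 + W z.2)%R (bconv mu nu).
Proof.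
move=> hY hW j; apply: (@eq_has_integral _ _ _ (fun z => \sum_(i < j.+1)
    'C(j, i)%:R * (Y z.1 ^+ i * W z.2 ^+ (j - i)))%R).
  move=> z; rewrite addrC exprDn; apply: eq_bigr => i _.
  by rewrite mulr_natl mulrC.
rewrite /bconv; under [X in has_integral _ _ X]eq_bigr do rewrite -mulr_natl.
apply: (@has_integral_sum _ _ _ j.+1 (fun i z => ('C(j, i)%:R * (Y z.1 ^+ i * W z.2 ^+ (j - i)))%R)
  (fun i => ('C(j, i)%:R * (mu i * nu (j - i)%N))%R)) => i.
by apply: has_integralZ; exact: has_integral_prod (hY i) (hW _).
Qed.

Section AffineMoments.
Context d (T : measurableType d) (P : {measure set T -> \bar R}).

Lemma has_momentsD_cst (Y : T -> R) mu (b : R) : has_moments P Y mu ->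
  has_moments P (fun w => Y w + b)%R (bconv mu (fun i => b ^+ i)%R).
Proof.
move=> hY j; apply: (@eq_has_integral _ _ _ (fun w => \sum_(i < j.+1)
    (b ^+ (j - i) *+ 'C(j, i)) * Y w ^+ i)%R).
  move=> w; rewrite addrC exprDn; apply: eq_bigr => i _.
  by rewrite mulrnAl.
rewrite /bconv; under [X in has_integral _ _ X]eq_bigr do rewrite mulrC -mulrnAl.
apply: (@has_integral_sum _ _ _ j.+1 (fun i w => ((b ^+ (j - i) *+ 'C(j, i)) * Y w ^+ i)%R)
  (fun i => ((b ^+ (j - i) *+ 'C(j, i)) * mu i)%R)) => i.
exact: has_integralZ.
Qed.

Lemma has_momentsZ (Y : T -> R) mu (s : R) : has_moments P Y mu ->
  has_moments P (fun w => s * Y w)%R (fun j => s ^+ j * mu j)%R.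
Proof.
move=> hY j; apply: (@eq_has_integral _ _ _ (fun w => s ^+ j * Y w ^+ j)%R).
  by move=> w; rewrite exprMn.
exact: has_integralZ.
Qed.

End AffineMoments.

Lemma has_moments_law d1 d2 (T1 : measurableType d1) (T2 : measurableType d2)
    (P : {measure set T1 -> \bar R}) (Q : {measure set T2 -> \bar R})
    (Y : T1 -> R) (W : T2 -> R) mu : measurable_fun setT Y ->
  (forall phi : R -> \bar R, measurable_fun setT phi -> (forall x, 0 <= phi x) ->
    \int[P]_w phi (Y w) = \int[Q]_w phi (W w)) ->
  has_moments Q W mu -> has_moments P Y mu.
Proof.
move=> mY PQ hW j.
exact: (has_integral_law mY PQ (measurable_funX j (@measurable_id _ (measurableTypeR R) setT)) (hW j)).
Qed.

Lemma has_moments_dirac0 :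
  has_moments (dirac (0%R : measurableTypeR R)) id (fun i => 0 ^+ i)%R.
Proof.
move=> j.
have mj : measurable_fun setT (EFin \o (fun w : measurableTypeR R => w ^+ j)%R).
  by apply/measurable_EFinP; exact: measurable_funX.
have E (f : measurableTypeR R -> \bar R) : measurable_fun setT f ->
    \int[dirac (0%R : measurableTypeR R)]_x f x = f 0%R.
  by move=> mf; rewrite integral_dirac// diracE in_setT mul1e.
split; last by rewrite E.
apply/integrableP; split => //; rewrite E ?ltry//.
exact: measurableT_comp.
Qed.

Lemma has_moments_convolution (P1 P2 : probability (measurableTypeR R) R) mu nu :
  has_moments P1 id mu -> has_moments P2 id nu ->
  has_moments (convolution P1 P2) id (bconv mu nu).
Proof.
move=> h1 h2; apply: has_moments_law (has_moments_prodD h1 h2) => //.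
by move=> phi mphi phi0; rewrite ge0_integral_distribution.
Qed.

End HasIntegral.

(** * Moments and cumulants of the standard normal law *)

Section NormalMoments.
Context {R : realType}.
Local Notation leb := (@lebesgue_measure R).
Local Notation phi := (normal_pdf (0 : R) 1).

Lemma standard_normal_pdfE (u : R) : phi u = normal_peak 1 * expR (- (u ^+ 2 / 2)).
Proof.
rewrite normal_pdfE ?oner_eq0// /normal_fun subr0 expr1n; congr (_ * expR _).
by rewrite mulNr.
Qed.

Lemma decaying_standard_normal_pdf : decaying phi.
Proof.
split; first by apply: continuous_normal_pdf; rewrite oner_eq0.
(* From |u| - u^2/2 <= 1/2. *)
exists (normal_peak 1 * expR 2^-1), 1; split => [||u] //.
  by rewrite mulr_ge0 ?expR_ge0 ?normal_peak_ge0.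
rewrite (ger0_norm (normal_pdf_ge0 _ _ _)) standard_normal_pdfE.
rewrite -[leRHS]mulrA -expRD.
rewrite ler_wpM2l ?normal_peak_ge0// ler_expR -real_normK ?num_real//.
have := sqr_ge0 (`|u| - 1); set v := `|u|; move=> H; nra.
Qed.

Definition normal_moment (m : nat) : R := \int[leb]_u (u ^+ m * phi u).

Lemma has_moments_standard_normal :
  has_moments (normal_prob (0 : R) 1 : probability (measurableTypeR R) R) id normal_moment.
Proof.
move=> j; apply: (@has_integral_density _ _ phi).
- exact: normal_pdf_ge0.
- by move=> f mf f0; rewrite ge0_integral_normal_prob.
- exact: measurable_funX.
- exact/decayingXn/decaying_standard_normal_pdf.
Qed.

Lemma normal_moment0 : normal_moment 0 = 1.
Proof.
rewrite /normal_moment /Rintegral; under eq_integral do rewrite expr0 mul1r.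
by rewrite integral_normal_pdf.
Qed.

Lemma is_derive_Xn_normal_pdf m (x : R) : is_derive x (1 : R) (fun u => u ^+ m * phi u)
  (m%:R * (x ^+ m.-1 * phi x) + -1 * (x ^+ m.+1 * phi x)).
Proof.
have -> : (fun u => u ^+ m * phi u) =
    (id ^+ m) * (fun u => normal_peak 1 * expR (- (u ^+ 2 / 2))).
  by apply/funext => u; rewrite !fctE standard_normal_pdfE.
rewrite standard_normal_pdfE; apply: is_derive_eq.
rewrite /GRing.scale/= !(scaler0, addr0, add0r, scaler1, mulr1).
have -> : (id ^+ m) x = x ^+ m by rewrite fctE.
rewrite [x ^+ m.+1]exprS; move: (x ^+ m) (x ^+ m.-1) (expR _) (normal_peak 1) => a b e c.
by field.
Qed.

Lemma is_cumulant_normal_moment : is_cumulant normal_moment normal_cumulant.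
Proof.
move=> m; rewrite bconv_normal_cumulant.
have d0 := decaying_standard_normal_pdf.
have D1 := decayingZ m%:R (decayingXn m.-1 d0).
have D2 := decayingZ (-1) (decayingXn m.+1 d0).
have := integral_derive_decaying (is_derive_Xn_normal_pdf m) (decayingXn m d0) (decayingD D1 D2).
rewrite decayingRD// (decayingRZ _ (decayingXn m.-1 d0)) (decayingRZ _ (decayingXn m.+1 d0)).
rewrite -/(normal_moment m.-1) -/(normal_moment m.+1) mulN1r => /eqP.
by rewrite subr_eq0 => /eqP.
Qed.

End NormalMoments.

(** * Moments of the log-determinant *)

Section LogDeterminantMoments.
Context {R : realType}.
Local Notation leb := (@lebesgue_measure R).

Lemma has_moments_logchi2 n :
  has_moments (logchi2 n.+1 : probability (measurableTypeR R) R) id (lgmoment (n.+1%:R / 2)).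
Proof.
set a : R := n.+1%:R / 2; have a0 : 0 < a by rewrite divr_gt0.
have [C C0 CE] := @ge0_integral_lnsq R n.
have E (f : R -> \bar R) : measurable_fun setT f -> (forall x, (0 <= f x)%E) ->
    (\int[logchi2 n.+1]_u f u = \int[leb]_u (f u * (C * rho a u)%:E))%E.
  by move=> mf f0; rewrite /logchi2 ge0_integral_distribution// CE.
have dr j : decaying (fun u => u ^+ j * (C * rho a u)).
  apply: eq_decaying (decayingZ C (decayingXn j (decaying_rho a0))) => u.
  by rewrite mulrCA.
have Crho u : 0 <= C * rho a u by rewrite mulr_ge0// ltW// rho_gt0.
have h j : has_integral (logchi2 n.+1) (fun u => u ^+ j) (C * rho_moment a j).
  have -> : C * rho_moment a j = \int[leb]_u (u ^+ j * (C * rho a u)).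
    rewrite /rho_moment -decayingRZ; last exact/decayingXn/decaying_rho.
    by apply: eq_Rintegral => u _; rewrite mulrCA.
  apply: has_integral_density => //; exact: measurable_funX.
(* The unknown constant of the density is identified by total mass one. *)
have C1 : C * rho_moment a 0 = 1.
  have [_] := h 0%N; under eq_integral do rewrite expr0.
  by rewrite integral_cst//= probability_setT mule1 => -[].
move=> j; rewrite /lgmoment -[X in X / _]mul1r -C1 [X in X / _]mulrAC mulfK.
  exact: h.
by rewrite gt_eqF// rho_moment0_gt0.
Qed.

Lemma has_moments_logdet_law p n : (p <= n)%N -> exists mu,
  [/\ has_moments (logdet_law p n : probability (measurableTypeR R) R) id mu, mu 0%N = 1 &
      is_cumulant mu (fun i => \sum_(j < p) cumulant (lgmoment ((n - j)%:R / 2)) i)].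
Proof.
elim: p n => [|p IH] n.
  move=> _; exists (fun i => 0 ^+ i); split => //; first exact: has_moments_dirac0.
  have -> : (fun i => \sum_(j < 0) cumulant (lgmoment ((n - j)%:R / 2)) i) =
      (fun i => if i == 0%N then 0 else 0 : R).
    by apply/funext => i; rewrite big_ord0; case: ifP.
  exact: is_cumulant_exp.
case: n => // n; rewrite ltnS => pn.
have [mu [hmu mu0 cmu]] := IH n pn.
have l0 : lgmoment (n.+1%:R / 2 : R) 0 = 1 by apply: lgmoment0; rewrite divr_gt0.
exists (bconv (lgmoment (n.+1%:R / 2)) mu); split.
- by apply: has_moments_convolution hmu; exact: has_moments_logchi2.
- by rewrite bconv0 l0 mu0 mulr1.
- have -> : (fun i => \sum_(j < p.+1) cumulant (lgmoment ((n.+1 - j)%:R / 2)) i) =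
    (fun i => cumulant (lgmoment (n.+1%:R / 2)) i +
      \sum_(j < p) cumulant (lgmoment ((n - j)%:R / 2)) i : R).
    by apply/funext => i; rewrite big_ord_recl subn0.
  exact: is_cumulant_bconv (cumulantP l0) cmu.
Qed.

End LogDeterminantMoments.

(** * Bounds on the cumulants of log-Gamma variables *)

Section LogGammaCumulants.
Context {R : realType}.

Definition lgcumulant (a : R) (m : nat) : R := cumulant (lgmoment a) m.

Lemma lgcumulant_rec (a : R) m : 0 < a ->
  lgcumulant (a + 1) m = lgcumulant a m + (-1) ^+ m * m`!%:R * a^-1 ^+ m.+1.
Proof.
move=> a0; have l0 := lgmoment0 a0.
have l1 : lgmoment (a + 1) 0 = 1 by rewrite lgmoment0// addr_gt0.
have E : lgmoment (a + 1) = bconv (lgmoment a) (affine_mgf a^-1).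
  by apply/funext => i; exact: lgmoment_rec.
have H := is_cumulant_bconv (cumulantP l0) (is_cumulant_affine_mgf a^-1).
rewrite -E in H.
exact: (is_cumulant_unique l1 (cumulantP l1) H m).
Qed.

Lemma lgcentral0 (a : R) : 0 < a -> lgcentral a 0 = 1.
Proof. by move=> a0; rewrite /lgcentral bconv0 lgmoment0// mul1r expr0. Qed.

(** Recentering changes only the cumulant of order one. *)
Lemma lgcumulant_central (a : R) m : 0 < a ->
  cumulant (lgcentral a) m.+1 = lgcumulant a m.+1.
Proof.
move=> a0; have l0 := lgmoment0 a0; have c0 := lgcentral0 a0.
have H := is_cumulant_bconv (cumulantP l0) (is_cumulant_exp (- ln (2 * a))).
by rewrite (is_cumulant_unique c0 (cumulantP c0) H m.+1) /= addr0.
Qed.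

Lemma cvg_invrD (a : R) : (a + N%:R)^-1 @[N --> \oo] --> (0 : R).
Proof.
apply/gtr0_cvgV0.
  near=> N; rewrite -ltrBlDl sub0r (@le_lt_trans _ _ `|a|)//.
    by rewrite -normrN ler_norm.
  by near: N; exact: nbhs_infty_gtr.
apply/cvgryPge => A; near=> N; rewrite -lerBlDl.
by near: N; exact: nbhs_infty_ger.
Unshelve. all: by end_near. Qed.

Lemma cvg_lgcentral (a : R) j : (0 < j)%N ->
  lgcentral (a + N%:R) j @[N --> \oo] --> (0 : R).
Proof.
move=> j0; set D : R := (2 ^+ j * j`!%:R) ^+ 2.
have h : D * (a - 1 + N%:R)^-1 @[N --> \oo] --> (0 : R).
  by rewrite -[X in _ --> X](mulr0 D); apply: cvgM; [exact: cvg_cst|exact: cvg_invrD].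
apply/cvgr0Pnorm_le => e e0; near=> N.
rewrite -(@ler_pXn2r _ 2) ?nnegrE ?(ltW e0)// real_normK ?num_real//.
apply: (@le_trans _ _ (D * (a - 1 + N%:R)^-1)).
  rewrite (_ : a - 1 + N%:R = a + N%:R - 1); last by rewrite addrAC.
  apply: lgcentral_bound => //; rewrite -ltrBlDl.
  by near: N; exact: nbhs_infty_gtr.
apply: (le_trans (ler_norm _)).
by near: N; move/cvgr0Pnorm_le : h; apply; rewrite exprn_gt0.
Unshelve. all: by end_near. Qed.

(* Vanishing at infinity turns the recurrence [lgcumulant_rec] into a telescoping series
   for [lgcumulant a m], m > 0, so that no asymptotics of Gamma is needed. *)
Lemma cvg_cumulant_lgcentral (a : R) m :
  cumulant (lgcentral (a + N%:R)) m @[N --> \oo] --> (0 : R).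
Proof.
elim/ltn_ind: m => m IH.
have -> : (fun N => cumulant (lgcentral (a + N%:R)) m) = (fun N => lgcentral (a + N%:R) m.+1 -
    \sum_(i < m) cumulant (lgcentral (a + N%:R)) i * lgcentral (a + N%:R) (m - i)%N *+ 'C(m, i)).
  by apply/funext => N; exact: cumulantE.
rewrite -[X in _ --> X]subr0; apply: cvgB; first exact: cvg_lgcentral.
have H : \sum_(i < m) cumulant (lgcentral (a + N%:R)) i * lgcentral (a + N%:R) (m - i)%N *+ 'C(m, i)
    @[N --> \oo] --> \sum_(i < m) (0 : R).
  apply: cvg_big => [|i _]; first exact: add_continuous.
  rewrite -[X in _ --> X](mul0rn _ 'C(m, i)) -[X in _ --> X *+ _](mul0r (0 : R)).
  apply: cvgMn; apply: cvgM; first exact: IH.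
  by apply: cvg_lgcentral; rewrite subn_gt0.
by rewrite (_ : \sum_(i < m) (0 : R) = 0) in H; last exact: big1.
Qed.

Lemma cvg_lgcumulant (a : R) m : 0 < a ->
  lgcumulant (a + N%:R) m.+1 @[N --> \oo] --> (0 : R).
Proof.
move=> a0; under eq_fun do rewrite -lgcumulant_central ?ltr_wpDr//.
exact: cvg_cumulant_lgcentral.
Qed.

(** Applied to a difference of two quantities along [a + N], it turns a one-step comparison into an
    inequality at [a]. *)
Lemma nonincreasing_cvg0_ge0 (u : nat -> R) : (forall n, u n.+1 <= u n) ->
  u n @[n --> \oo] --> (0 : R) -> 0 <= u 0%N.
Proof.
move=> /nonincreasing_seqP du cu.
have := nonincreasing_cvgn_ge du (cvgP _ cu) 0%N.
by rewrite (cvg_lim _ cu).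
Qed.

(** The step from x to x + 1 lowers the cumulant by 1/x^2 and the bound by 1/(x (x + 1)), which is
    less. *)
Lemma lgcumulant1_ge (a : R) : 0 < a -> a^-1 <= lgcumulant a 1.
Proof.
move=> a0.
have := @nonincreasing_cvg0_ge0 (fun N => lgcumulant (a + N%:R) 1 - (a + N%:R)^-1).
rewrite addr0 subr_ge0; apply.
  move=> N; have x0 : 0 < a + N%:R by rewrite ltr_wpDr.
  rewrite -natr1 addrA lgcumulant_rec//; move: (a + N%:R) x0 => x x0.
  rewrite -subr_ge0.
  have -> : lgcumulant x 1 - x^-1 -
      (lgcumulant x 1 + (-1) ^+ 1 * 1`!%:R * x^-1 ^+ 2 - (x + 1)^-1) =
      (x ^+ 2 * (x + 1))^-1.
    rewrite factS fact0 muln1 mulr1n; field.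
    by rewrite !gt_eqF// addr_gt0.
  by rewrite invr_ge0 mulr_ge0 ?sqr_ge0// ltW// addr_gt0.
rewrite -[X in _ --> X]subr0; apply: cvgB; first exact: cvg_lgcumulant.
exact: cvg_invrD.
Qed.

(** For [m = 0] and constant K the claim reads K >= 1 + 1/x; at x = 1/2, the parameter of one degree
    of freedom, this forces the constant 3. *)
Lemma telescoping_bound (x : R) m : 2^-1 <= x ->
  x^-1 ^+ m.+2 + 3 * (x + 1)^-1 ^+ m.+1 <= 3 * x^-1 ^+ m.+1.
Proof.
move=> x2; have x0 : 0 < x by rewrite (lt_le_trans _ x2).
have x10 : 0 < x + 1 by rewrite addr_gt0.
have y0 : 0 <= x^-1 by rewrite invr_ge0 ltW.
have z0 : 0 <= (x + 1)^-1 by rewrite invr_ge0 ltW.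
have H : (x + 1)^-1 ^+ m.+1 <= x^-1 ^+ m * (x + 1)^-1.
  rewrite exprSr ler_wpM2r// lerXn2r ?nnegrE//.
  by rewrite lef_pV2 ?posrE// lerDl.
have H2 : 0 <= x^-1 ^+ m by rewrite exprn_ge0.
have H3 : x^-1 ^+ 2 + 3 * (x + 1)^-1 <= 3 * x^-1.
  rewrite -subr_ge0.
  have -> : 3 * x^-1 - (x^-1 ^+ 2 + 3 * (x + 1)^-1) = (2 * x - 1) / (x ^+ 2 * (x + 1)).
    by field; rewrite !gt_eqF.
  rewrite divr_ge0 ?mulr_ge0 ?sqr_ge0 ?(ltW x10)//; lra.
have -> : 3 * x^-1 ^+ m.+1 = x^-1 ^+ m * (3 * x^-1) by rewrite exprSr; ring.
apply: le_trans (ler_wpM2l H2 H3).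
have -> : x^-1 ^+ m.+2 = x^-1 ^+ m * x^-1 ^+ 2 by rewrite -addn2 exprD.
by rewrite mulrDr lerD2l mulrCA ler_wpM2l.
Qed.

Lemma lgcumulant_bound (a : R) m : 2^-1 <= a ->
  `|lgcumulant a m.+1| <= 3 * m.+1`!%:R * a^-1 ^+ m.+1.
Proof.
move=> a2; have a0 : 0 < a by rewrite (lt_le_trans _ a2).
have xV0 N : 0 <= (a + N%:R)^-1 by rewrite invr_ge0 addr_ge0// ltW.
set M : R := m.+1`!%:R; have M0 : 0 < M by rewrite ltr0n fact_gt0.
(* The sign makes every increment negative, so that [g] decreases to 0. *)
pose g N := (-1) ^+ m * lgcumulant (a + N%:R) m.+1.
have gS N : g N.+1 = g N - M * (a + N%:R)^-1 ^+ m.+2.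
  rewrite /g -natr1 addrA lgcumulant_rec ?ltr_wpDr// mulrDr -/M; congr (_ + _).
  by rewrite exprS mulN1r !mulNr mulrN -mulrA signrMK.
have cg : g N @[N --> \oo] --> (0 : R).
  rewrite -[X in _ --> X](mulr0 ((-1) ^+ m)).
  by apply: cvgM; [exact: cvg_cst|exact: cvg_lgcumulant].
have xge N : 2^-1 <= a + N%:R by rewrite (le_trans a2)// lerDl.
have gE : g 0%N = (-1) ^+ m * lgcumulant a m.+1 by rewrite /g addr0.
have -> : `|lgcumulant a m.+1| = `|g 0%N|.
  by rewrite gE normrM normrX normrN1 expr1n mul1r.
rewrite ger0_norm; last first.
  apply: (nonincreasing_cvg0_ge0 _ cg) => N; rewrite gS gerBl.
  apply: mulr_ge0; first exact: ltW.
  apply: exprn_ge0; exact: xV0.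
have := @nonincreasing_cvg0_ge0 (fun N => 3 * M * (a + N%:R)^-1 ^+ m.+1 - g N).
rewrite addr0 subr_ge0; apply.
  move=> N; rewrite gS -(natr1 N) addrA; move: (a + N%:R) (xge N) => x x2.
  rewrite opprB addrA lerD2r addrC.
  have -> : M * x^-1 ^+ m.+2 + 3 * M * (x + 1)^-1 ^+ m.+1 =
    M * (x^-1 ^+ m.+2 + 3 * (x + 1)^-1 ^+ m.+1) by ring.
  rewrite [leRHS](_ : _ = M * (3 * x^-1 ^+ m.+1)); last by ring.
  rewrite ler_pM2l; last exact: M0.
  exact: telescoping_bound.
rewrite -[X in _ --> X](subrr (0 : R)); apply: cvgB cg.
rewrite -[X in _ --> X](mulr0 (3 * M)); apply: cvgM; first exact: cvg_cst.
have -> : (0 : R) = 0 ^+ m.+1 by rewrite expr0n.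
apply: (@cvg_comp _ _ _ (fun N => (a + N%:R)^-1) (fun x : R => x ^+ m.+1) _ _ _ (cvg_invrD a)).
exact: exprn_continuous.
Qed.

End LogGammaCumulants.

(** * Moments of the standardized log-volume *)

Section StandardizedMoments.
Context {R : realType}.

(** Mean and variance are read off the first two cumulants; centering cancels [c 0] and scaling
    multiplies order [i + 1] by a power of that degree. *)
Lemma has_moments_standardize d (T : measurableType d) (P : probability T R) (Y : T -> R) mu c :
  has_moments P Y mu -> mu 0%N = 1 -> is_cumulant mu c -> 0 < c 1%N ->
  exists zeta e, [/\ has_moments P (standardize P Y) zeta, zeta 0%N = 1, is_cumulant zeta e,
    e 0%N = 0 /\ e 1%N = 1 &
    forall i, (2 <= i)%N -> e i = c i / Num.sqrt (c 1%N) ^+ i.+1].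
Proof.
move=> hY mu0 hc c10; pose b := - mu 1%N.
have c0 : c 0%N = mu 1%N by rewrite hc bconv0 mu0 mulr1.
have hYb := has_momentsD_cst b hY.
have hcb := is_cumulant_bconv hc (is_cumulant_exp b).
set nu := bconv mu _ in hYb hcb; set cb := (fun i => _) in hcb.
have nu0 : nu 0%N = 1 by rewrite /nu bconv0 mu0 expr0 mulr1.
have cb0 : cb 0%N = 0 by rewrite /cb/= c0 subrr.
have nu2 : nu 2 = c 1%N.
  rewrite hcb /bconv !big_ord_recr big_ord0/= cb0 mul0r mul0rn !add0r.
  by rewrite nu0 mulr1 mulr1n /cb/= addr0.
have EY : ('E_P[Y] = (mu 1%N)%:E)%E.
  by rewrite unlock; have [_ <-] := hY 1%N; apply: eq_integral => w _; rewrite expr1.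
have VY : ('V_P[Y] = (c 1%N)%:E)%E.
  rewrite /variance unlock EY /= unlock -nu2; have [_ <-] := hYb 2%N.
  by apply: eq_integral => w _; rewrite expr2.
pose q := Num.sqrt (c 1%N); have q0 : 0 < q by rewrite sqrtr_gt0.
have SE : standardize P Y = (fun w => q^-1 * (Y w + b)).
  by apply/funext => w; rewrite /standardize EY VY /= mulrC.
exists (fun j => q^-1 ^+ j * nu j), (fun i => q^-1 ^+ i.+1 * cb i); split.
- by rewrite SE; exact: has_momentsZ.
- by rewrite expr0 mul1r.
- exact: is_cumulant_scale.
- split; first by rewrite cb0 mulr0.
  rewrite /cb/= addr0 -(sqr_sqrtr (ltW c10)) -/q exprVn mulVf//.
  by rewrite expf_neq0// gt_eqF.
- by case=> [|[|i]] // _; rewrite /cb/= addr0 exprVn mulrC.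
Qed.

Definition logdet_cumulant n p i : R := \sum_(j < p) lgcumulant ((n - j)%:R / 2) i.

Lemma standardized_ln_simplex_volume p n d (T : measurableType d) (P : probability T R)
    (X : 'I_p.+1 -> {RV P >-> Rn R n}) (V := fun w => ln (simplex_volume (fun i => X i w))) :
  (p <= n)%N -> mutually_independent P X -> (forall i, standard_gaussian P (X i)) ->
  0 < logdet_cumulant n p 1 ->
  exists zeta e, [/\ has_moments P (standardize P V) zeta, zeta 0%N = 1, is_cumulant zeta e,
    e 0%N = 0 /\ e 1%N = 1 &
    forall i, (2 <= i)%N ->
      e i = logdet_cumulant n p i / Num.sqrt (logdet_cumulant n p 1) ^+ i.+1].
Proof.
move=> pn Xind Xgauss S10.
have [K [mV VE]] := ln_simplex_volume_law pn Xind Xgauss.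
have [mu [hmu mu0 cmu]] := @has_moments_logdet_law R p n pn.
have h1 := has_momentsD_cst K (has_momentsZ 2^-1 hmu).
have c1 := is_cumulant_bconv (is_cumulant_scale 2^-1 cmu) (is_cumulant_exp K).
set nu := bconv _ _ in h1 c1; set c := (fun i => _) in c1.
have hV : has_moments P V nu.
  apply: has_moments_law h1 => // phi mphi phi0; rewrite VE//.
  by apply: eq_integral => y _; rewrite addrC mulrC.
have nu0 : nu 0%N = 1 by rewrite /nu bconv0 mu0 !expr0 !mulr1.
have cE i : c i.+1 = 2^-1 ^+ i.+2 * logdet_cumulant n p i.+1 by rewrite /c addr0.
have c10 : 0 < c 1%N by rewrite cE mulr_gt0// exprn_gt0// invr_gt0.
have [zeta [e [hz z0 ce e01 eE]]] := has_moments_standardize hV nu0 c1 c10.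
exists zeta, e; split => // -[//|i] i1; rewrite eE// !cE.
(* The factor 1/2 of the log-volume cancels by homogeneity; the constant [K] entered the cumulant of
   order one only. *)
rewrite sqrtrM ?exprn_ge0 ?invr_ge0// sqrtr_sqr ger0_norm ?invr_ge0// exprMn.
have q0 : 0 < Num.sqrt (logdet_cumulant n p 1) ^+ i.+2 by rewrite exprn_gt0// sqrtr_gt0.
have h0 : 0 < (2^-1 : R) ^+ i.+2 by rewrite exprn_gt0// invr_gt0.
move: (_ ^+ i.+2) (Num.sqrt _ ^+ i.+2) h0 q0 => h q h0 q0.
by field; rewrite !gt_eqF.
Qed.

Lemma logdet_cumulant1_ge n p : (p <= n)%N -> p%:R / n%:R <= logdet_cumulant n p 1.
Proof.
move=> pn; rewrite mulr_natl -[p in leLHS]card_ord -sumr_const; apply: ler_sum => j _.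
have nj : (0 < n - j)%N by rewrite subn_gt0 (leq_trans (ltn_ord j)).
have a0 : 0 < (n - j)%:R / 2 :> R by rewrite divr_gt0// ltr0n.
apply: le_trans (lgcumulant1_ge a0); rewrite lef_pV2 ?posrE//.
  rewrite ler_pdivrMr// (@le_trans _ _ n%:R)// ?ler_nat ?leq_subr//.
  by rewrite ler_peMr// ler1n.
by rewrite ltr0n (leq_trans nj)// leq_subr.
Qed.

Lemma logdet_cumulant_bound_far (kap : R) n p i : 0 < kap -> (0 < n)%N -> (p <= n)%N ->
  kap * n%:R <= (n - p)%:R / 2 -> (0 < i)%N ->
  `|logdet_cumulant n p i| <= p%:R * (3 * i`!%:R * kap^-1 ^+ i * n%:R^-1 ^+ i).
Proof.
move=> kap0 n0 pn kapn; case: i => // i _; apply: le_trans (ler_norm_sum _ _ _) _.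
rewrite mulr_natl -[p in leRHS]card_ord -sumr_const; apply: ler_sum => j _.
have nj : (0 < n - j)%N by rewrite subn_gt0 (leq_trans (ltn_ord j)).
have a0 : 2^-1 <= (n - j)%:R / 2 :> R by rewrite ler_peMl ?invr_ge0// ler1n.
apply: le_trans (lgcumulant_bound i a0) _.
rewrite -[leRHS]mulrA -exprMn -invfM.
apply: ler_wpM2l => //.
have k0 : 0 < kap * n%:R by rewrite mulr_gt0// ltr0n.
have x0 : 0 < (n - j)%:R / 2 :> R by rewrite divr_gt0// ltr0n.
rewrite lerXn2r ?nnegrE ?invr_ge0 ?(ltW k0) ?(ltW x0)//.
rewrite lef_pV2 ?posrE//; apply: le_trans kapn _.
by rewrite ler_wpM2r ?invr_ge0// ler_nat leq_sub2l// ltnW.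
Qed.

(** The term [n%:R^-1] closes the induction, since 1/(x+1)^2 <= 1/x - 1/(x+1). Indices beyond [n]
    contribute 0, by truncated subtraction and the inverse of 0. *)
Lemma sum_inv_sqr_le2 n p : \sum_(j < p) ((n - j)%:R^-1 : R) ^+ 2 <= 2 - n%:R^-1.
Proof.
elim: p n => [|p IH] n.
  rewrite big_ord0 subr_ge0; case: n => [|n]; first by rewrite invr0.
  by rewrite (@le_trans _ _ 1)// ?ler1n// invf_le1// ler1n.
case: n => [|n].
  by rewrite big1 ?invr0 ?subr0// => j _; rewrite sub0n invr0 expr0n.
rewrite big_ord_recl subn0 /=.
under eq_bigr do rewrite subSS.
case: n => [|n].
  rewrite big1 => [|j _]; last by rewrite sub0n invr0 expr0n.
  by rewrite invr1 expr1n addr0; lra.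
apply: (@le_trans _ _ (n.+2%:R^-1 ^+ 2 + (2 - n.+1%:R^-1))); first by rewrite lerD2l.
have x0 : 0 < n.+1%:R :> R by rewrite ltr0n.
rewrite -[n.+2%:R]natr1; move: (n.+1%:R : R) x0 => x x0.
have x10 : 0 < x + 1 by rewrite addr_gt0.
rewrite -subr_ge0.
have -> : 2 - (x + 1)^-1 - ((x + 1)^-1 ^+ 2 + (2 - x^-1)) = (x * (x + 1) ^+ 2)^-1.
  by field; rewrite !gt_eqF.
by rewrite invr_ge0 mulr_ge0 ?sqr_ge0// ltW.
Qed.

(** For [i >= 2] the powers are dominated by inverse squares; [2 ^+ i] comes from the halved
    parameters and the last factor from the sum. *)
Lemma logdet_cumulant_bound n p i : (p <= n)%N -> (2 <= i)%N ->
  `|logdet_cumulant n p i| <= 3 * i`!%:R * 2 ^+ i * 2.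
Proof.
move=> pn; case: i => [|[|i]] // _; apply: le_trans (ler_norm_sum _ _ _) _.
have H : \sum_(j < p) ((n - j)%:R^-1 : R) ^+ 2 <= 2.
  by rewrite (le_trans (sum_inv_sqr_le2 _ _))// gerBl invr_ge0.
have M0 : 0 <= 3 * i.+2`!%:R * 2 ^+ i.+2 :> R by apply: mulr_ge0; [exact: mulr_ge0|exact: exprn_ge0].
apply: le_trans (ler_wpM2l M0 H).
rewrite mulr_sumr; apply: ler_sum => j _.
have nj : (0 < n - j)%N by rewrite subn_gt0 (leq_trans (ltn_ord j)).
have a0 : 2^-1 <= (n - j)%:R / 2 :> R by rewrite ler_peMl ?invr_ge0// ler1n.
apply: le_trans (lgcumulant_bound _ a0) _.
rewrite invf_div exprMn mulrA; apply: ler_wpM2l => //.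
have y1 : ((n - j)%:R^-1 : R) <= 1 by rewrite invf_le1 ?ler1n// ltr0n.
by rewrite ler_wiXn2l// invr_ge0.
Qed.

(** Each summand is at least 1/x >= log(x + 1) - log x with x = n - j, and these differences
    telescope. *)
Lemma logdet_cumulant1_ge_ln n p : (p <= n)%N ->
  ln n.+1%:R - ln (n - p + 1)%:R <= logdet_cumulant n p 1.
Proof.
elim: p => [|p IH] pn; first by rewrite subn0 addn1 subrr /logdet_cumulant big_ord0.
rewrite /logdet_cumulant big_ord_recr/=.
have np : (0 < n - p)%N by rewrite subn_gt0.
have x0 : 0 < (n - p)%:R :> R by rewrite ltr0n.
have -> : (n - p.+1 + 1)%N = (n - p)%N by rewrite subnS addn1 prednK.
apply: (@le_trans _ _ (ln n.+1%:R - ln (n - p + 1)%:R + (n - p)%:R^-1)).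
  rewrite -addrA lerD2l lerNl opprD opprK lerBlDr.
  have -> : (n - p + 1)%:R = (n - p)%:R * (1 + (n - p)%:R^-1) :> R.
    by rewrite natrD mulrDr mulr1 divff// gt_eqF.
  rewrite lnM ?posrE// ?addr_gt0 ?invr_gt0// lerD2l.
  by apply: le_ln1Dx; rewrite (@lt_le_trans _ _ 0) ?ltrN10// invr_ge0 ltW.
apply: lerD; first exact/IH/ltnW.
apply: le_trans (lgcumulant1_ge _); last by rewrite divr_gt0.
by rewrite lef_pV2 ?posrE ?divr_gt0// ler_pdivrMr// ler_peMr ?(ltW x0)// ler1n.
Qed.

Lemma gain_le l : (0 < l)%N -> (gain l.+2 <= l)%N.
Proof. by rewrite /gain /= negbK; case: l => [|[|l]] // _; case: odd. Qed.

Lemma standardized_cumulant_bound_far (kap : R) n p i (eps := (Num.sqrt (p%:R * n%:R))^-1) :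
  0 < kap -> (0 < p <= n)%N -> kap * n%:R <= (n - p)%:R / 2 -> (2 <= i)%N ->
  `|logdet_cumulant n p i / Num.sqrt (logdet_cumulant n p 1) ^+ i.+1| <=
  3 * i`!%:R * kap^-1 ^+ i * eps ^+ gain i.+1.
Proof.
move=> kap0 /andP[p0 pn] kapn; have n0 : (0 < n)%N by rewrite (leq_trans p0).
case: i => [//|l]; rewrite ltnS => l0.
have bS := logdet_cumulant_bound_far kap0 n0 pn kapn (ltn0Sn l).
set M := 3 * _ * _ in bS *; have M0 : 0 <= M.
  by rewrite !mulr_ge0// exprn_ge0// invr_ge0 ltW.
have nR : 0 < n%:R :> R by rewrite ltr0n.
have pR : 0 < p%:R :> R by rewrite ltr0n.
(* In terms of [r] and [n] one has p = r^2 n and eps = 1/(r n), so the homogeneity count becomes an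
   identity of monomials. *)
pose r : R := Num.sqrt (p%:R / n%:R).
have r0 : 0 < r by rewrite sqrtr_gt0 divr_gt0.
have r2 : p%:R = r ^+ 2 * n%:R by rewrite sqr_sqrtr ?divfK ?gt_eqF// divr_ge0.
have rq : r <= Num.sqrt (logdet_cumulant n p 1).
  by rewrite ler_wsqrtr// logdet_cumulant1_ge.
have q0 := lt_le_trans r0 rq.
have epsE : eps = (r * n%:R)^-1.
  by rewrite /eps r2 -mulrA -expr2 -exprMn sqrtr_sqr ger0_norm// mulr_ge0// ltW.
have e01 : 0 <= eps <= 1.
  rewrite invr_ge0 sqrtr_ge0/= invf_le1 ?sqrtr_gt0 ?mulr_gt0//.
  by rewrite -[leLHS]sqrtr1 ler_wsqrtr// -natrM ler1n muln_gt0 p0.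
apply: (@le_trans _ _ (M * eps ^+ l)); last first.
  by case/andP: e01 => e0 e1; rewrite ler_wpM2l// ler_wiXn2l// gain_le.
rewrite normrM [X in _ * X]ger0_norm ?invr_ge0 ?exprn_ge0 ?sqrtr_ge0//.
apply: (@le_trans _ _ (p%:R * (M * n%:R^-1 ^+ l.+1) / r ^+ l.+2)).
  apply: ler_pM => //.
  rewrite lef_pV2 ?posrE ?exprn_gt0// lerXn2r ?nnegrE//; exact: ltW.
rewrite epsE [in leRHS]invfM r2 -exprVn exprMn !exprS expr0.
have r0' := gt_eqF r0; have n0' := gt_eqF nR.
clearbody r M; move: ((n%:R : R)^-1 ^+ l) (r^-1 ^+ l) (n%:R : R) n0' => y z x x0.
by rewrite le_eqVlt; apply/orP; left; apply/eqP; field; rewrite r0' x0.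
Qed.

(** The numerator is bounded and the variance is at least [L]; as [L >= 1], the exponent
    [i + 1 >= 3] may be lowered to the gain. *)
Lemma standardized_cumulant_bound n p i (L : R := ln (n%:R / (n - p + 1)%:R)) :
  (0 < n)%N -> (p <= n)%N -> 1 <= L -> (2 <= i)%N ->
  `|logdet_cumulant n p i / Num.sqrt (logdet_cumulant n p 1) ^+ i.+1| <=
  3 * i`!%:R * 2 ^+ i * 2 * (Num.sqrt L)^-1 ^+ gain i.+1.
Proof.
move=> n0 pn L1 i2.
have bS := logdet_cumulant_bound pn i2.
set M := 3 * _ * _ * _ in bS *; have M0 : 0 <= M by rewrite !mulr_ge0// exprn_ge0.
have LS : L <= logdet_cumulant n p 1.
  apply: le_trans (logdet_cumulant1_ge_ln pn).
  rewrite /L ln_div ?posrE ?ltr0n ?addn1// lerD2r ler_ln ?posrE ?ltr0n// ler_nat.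
  exact: leqnSn.
have L0 : 0 < L by rewrite (lt_le_trans _ L1).
have q0 : 0 < Num.sqrt L by rewrite sqrtr_gt0.
have rq : Num.sqrt L <= Num.sqrt (logdet_cumulant n p 1) by rewrite ler_wsqrtr.
have q1 := lt_le_trans q0 rq.
apply: (@le_trans _ _ (M * (Num.sqrt L)^-1 ^+ i.+1)); last first.
  rewrite ler_wpM2l// ler_wiXn2l ?invr_ge0 ?sqrtr_ge0//.
    by rewrite invf_le1// -sqrtr1 ler_wsqrtr.
  by rewrite /gain; case: odd => //=; rewrite ltnS ltnW.
rewrite normrM [X in _ * X]ger0_norm ?invr_ge0 ?exprn_ge0 ?sqrtr_ge0// exprVn.
apply: ler_pM => //.
rewrite lef_pV2 ?posrE ?exprn_gt0// lerXn2r ?nnegrE//; exact: ltW.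
Qed.

Lemma expectation_standard_normal d (T : measurableType d) (Q : probability T R)
    (N : {RV Q >-> measurableTypeR R}) k : standard_normal Q N ->
  ('E_Q[fun w => (N w ^+ k)%R] = (normal_moment k)%:E)%E.
Proof.
move=> hN; rewrite unlock.
suff hQ : has_moments Q N normal_moment by have [_] := hQ k.
have mN : measurable_fun setT (N : T -> R) := measurable_funP N.
apply: (has_moments_law mN _ has_moments_standard_normal) => phi mphi phi0.
transitivity (\int[distribution Q N]_x phi x)%E.
  by rewrite ge0_integral_distribution.
by apply: eq_measure_integral => A mA _; exact: hN.
Qed.

(** Common to both regimes, which enter only through [eps] and [M]. [C] precedes the dimensions and
    the probability spaces, which makes the final constant independent of n. *)
Lemma moment_gap_le k (M : nat -> R) : ~~ odd k -> (forall i, 0 <= M i) ->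
  exists2 C, 0 <= C & forall p n (eps : R) d (T : measurableType d) (P : probability T R)
    (X : 'I_p.+1 -> {RV P >-> Rn R n}) d' (T' : measurableType d') (Q : probability T' R)
    (N : {RV Q >-> measurableTypeR R}),
  (0 < p <= n)%N -> mutually_independent P X -> (forall i, standard_gaussian P (X i)) ->
  standard_normal Q N -> 0 <= eps <= 1 ->
  (forall i, (2 <= i)%N -> `|logdet_cumulant n p i / Num.sqrt (logdet_cumulant n p 1) ^+ i.+1| <=
    M i * eps ^+ gain i.+1) ->
  (`| 'E_P[fun w => (standardize P (fun w => ln (simplex_volume (fun i => X i w))) w ^+ k)%R]
    - 'E_Q[fun w => (N w ^+ k)%R] | <= (C * eps ^+ 2)%:E)%E.
Proof.
move=> ek M0; pose K := \sum_(i < k) M i.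
have K0 : 0 <= K by rewrite sumr_ge0.
have [C C0 CE] := moment_gap_bound k K0 (@normal_moment0 R) (@is_cumulant_normal_moment R).
exists C => // p n eps d T P X d' T' Q N /andP[p0 pn] Xind Xgauss hN e01 cM.
have S10 : 0 < logdet_cumulant n p 1.
  apply: lt_le_trans (logdet_cumulant1_ge pn).
  by rewrite divr_gt0 ?ltr0n// (leq_trans p0).
have [zeta [e [hz z0 ce [e0 e1] eE]]] := standardized_ln_simplex_volume pn Xind Xgauss S10.
rewrite (expectation_standard_normal _ hN) unlock.
have [_ ->] := hz k; rewrite -EFinB lee_fin.
have -> : 2%N = gain k by rewrite /gain ek.
apply: (CE _ _ _ e01 z0 ce e0 e1) => // i /andP[i2 ik].
rewrite eE//; apply: le_trans (cM i i2) _; rewrite ler_wpM2r//.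
  by rewrite exprn_ge0//; case/andP: e01.
by rewrite /K (bigD1 (Ordinal ik))//= lerDl sumr_ge0.
Qed.

End StandardizedMoments.

(** * The growth conditions on the dimension *)

Section Regimes.
Context {R : realType}.

Lemma littleo_nat_near (u v : nat -> R) (a : R) : 0 < a ->
  ((u : nat -> R^o) =o_\oo (v : nat -> R^o)) -> \forall n \near \oo, `|u n| <= a * `|v n|.
Proof. by move=> a0 /eqoP; apply. Qed.

Lemma far_from_full_dimension (p : nat -> nat) :
  (forall n : nat, (1 <= n)%N -> (1 <= p n <= n)%N) ->
  ((((fun n : nat => (p n)%:R : R^o) =o_\oo (fun n : nat => n%:R : R^o)) \/
    (exists c : R, 0 < c < 1 /\
      (fun n : nat => (p n)%:R : R^o) ~_\oo (fun n : nat => c * n%:R : R^o)))) ->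
  exists2 kap : R, 0 < kap & \forall n \near \oo, kap * n%:R <= (n - p n)%:R / 2.
Proof.
move=> hp [po|[c [/andP[c0 c1] /eqaddoP pc]]].
  exists 4^-1; first by rewrite invr_gt0.
  have h2 : 0 < 2^-1 :> R by rewrite invr_gt0.
  have H := littleo_nat_near h2 po.
  near=> n; have n0 : (0 < n)%N by near: n; exact: nbhs_infty_gt.
  have /andP[_ pn] := hp n n0.
  have : `|(p n)%:R| <= 2^-1 * `|n%:R| :> R by near: n.
  rewrite !ger0_norm// natrB//; lra.
exists ((1 - c) / 4); first by rewrite divr_gt0// subr_gt0.
(* The asymptotic error is relative to [c * n], hence the division by [c]; it leaves p <= (1 + c) n
   / 2. *)
have e0 : 0 < (1 - c) / 2 / c by rewrite !divr_gt0// subr_gt0.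
have H := pc _ e0.
near=> n; have n0 : (0 < n)%N by near: n; exact: nbhs_infty_gt.
have /andP[_ pn] := hp n n0.
have : `|(p n)%:R - c * n%:R| <= (1 - c) / 2 / c * `|c * n%:R| by near: n.
rewrite (ger0_norm (mulr_ge0 (ltW c0) (ler0n _ n))) mulrA divfK ?gt_eqF//.
move/(le_trans (ler_norm _)); rewrite natrB//; lra.
Unshelve. all: by end_near. Qed.

Lemma near_full_dimension (p : nat -> nat) :
  ((fun n : nat => (n - p n)%N%:R : R^o) =o_\oo (fun n : nat => n%:R : R^o)) ->
  \forall n \near \oo, 1 <= ln (n%:R / (n - p n + 1)%N%:R : R).
Proof.
(* Both [n - p] and 1 are eventually at most n/(2e), so [n - p + 1] is at most n/e. *)
move=> po; have e0 : 0 < (2 * expR 1)^-1 :> R by rewrite invr_gt0 mulr_gt0// expR_gt0.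
have H := littleo_nat_near e0 po.
near=> n; have n0 : (0 < n)%N by near: n; exact: nbhs_infty_gt.
have : `|(n - p n)%:R| <= (2 * expR 1)^-1 * `|n%:R| :> R by near: n.
have : 2 * expR 1 <= n%:R :> R by near: n; exact: nbhs_infty_ger.
rewrite !ger0_norm// => nl nd.
have y0 : 0 < (n - p n + 1)%:R :> R by rewrite ltr0n addn1.
have nR : 0 < n%:R :> R by rewrite ltr0n.
rewrite -[leLHS](@expRK R) ler_ln ?posrE ?expR_gt0 ?divr_gt0// ler_pdivlMr// natrD.
move: nd; rewrite mulrC ler_pdivlMr ?mulr_gt0 ?expR_gt0// mulrC; lra.
Unshelve. all: by end_near. Qed.

End Regimes.
Unset Implicit Arguments.

Theorem mainTheorem12 (R : realType) (p : nat -> nat)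
  (hp : forall n : nat, (1 <= n)%N -> (1 <= p n <= n)%N)
  (d : nat -> measure_display) (T : forall n : nat, measurableType (d n))
  (P : forall n : nat, probability (T n) R)
  (X : forall n : nat, 'I_(p n).+1 -> {RV (P n) >-> Rn R n})
  (hXindep : forall n : nat, (1 <= n)%N -> mutually_independent (P n) (X n))
  (hXgauss : forall n : nat, (1 <= n)%N ->
     forall i : 'I_(p n).+1, standard_gaussian (P n) (X n i))
  (d' : measure_display) (T' : measurableType d') (Q : probability T' R)
  (N : {RV Q >-> measurableTypeR R}) (hN : standard_normal Q N)
  (k : nat) (hk_pos : (0 < k)%N) (hk_even : ~~ odd k) :
  let logVS (n : nat) : T n -> R :=
    fun w => ln (simplex_volume (fun i => X n i w)) in
  let Z (n : nat) : T n -> R := standardize (P n) (logVS n) in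
  let moment_gap (n : nat) : \bar R :=
    `| 'E_(P n)[fun w => (Z n w ^+ k)%R] - 'E_Q[fun w => (N w ^+ k)%R] |%E in
  ((((fun n : nat => (p n)%:R : R^o) =o_\oo (fun n : nat => n%:R : R^o)) \/
    (exists c : R, 0 < c < 1 /\
      (fun n : nat => (p n)%:R : R^o) ~_\oo (fun n : nat => c * n%:R : R^o))) ->
   exists C1 : R, \forall n \near \oo,
     (moment_gap n <= (C1 * (1 / ((p n)%:R * n%:R)))%R%:E)%E)
  /\
  (((fun n : nat => (n - p n)%N%:R : R^o) =o_\oo (fun n : nat => n%:R : R^o)) ->
   exists C1 : R, \forall n \near \oo,
     (moment_gap n <= (C1 * (1 / ln (n%:R / (n - p n + 1)%N%:R)))%R%:E)%E).

Proof.
move=> logVS Z moment_gap; split=> [/(far_from_full_dimension hp)[kap kap0 far]|/near_full_dimension full].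
  have M0 i : 0 <= 3 * i`!%:R * kap^-1 ^+ i.
    by rewrite !mulr_ge0// exprn_ge0// invr_ge0 ltW.
  have [C C0 CE] := moment_gap_le hk_even M0.
  exists C; near=> n.
  have n0 : (0 < n)%N by near: n; exact: nbhs_infty_gt.
  have /andP[p0 pn] := hp n n0.
  have kn : kap * n%:R <= (n - p n)%:R / 2 by near: n.
  have pnR : 1 <= (p n)%:R * n%:R :> R by rewrite -natrM ler1n muln_gt0 p0.
  (* [eps] squared is the claimed rate; [eps <= 1] holds because p n >= 1. *)
  pose eps : R := (Num.sqrt ((p n)%:R * n%:R))^-1.
  have e01 : 0 <= eps <= 1.
    rewrite invr_ge0 sqrtr_ge0/= invf_le1 ?sqrtr_gt0 ?(lt_le_trans _ pnR)//.
    by rewrite -[leLHS]sqrtr1 ler_wsqrtr.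
  have -> : 1 / ((p n)%:R * n%:R) = eps ^+ 2.
    by rewrite /eps exprVn sqr_sqrtr ?div1r// (le_trans _ pnR).
  apply: (CE _ _ _ _ _ _ _ _ _ _ _ (hp n n0) (hXindep n n0) (hXgauss n n0) hN e01) => i i2.
  exact: standardized_cumulant_bound_far kap0 (hp n n0) kn i2.
have M0 i : 0 <= 3 * i`!%:R * 2 ^+ i * 2 :> R by rewrite !mulr_ge0// exprn_ge0.
have [C C0 CE] := moment_gap_le hk_even M0.
exists C; near=> n.
have n0 : (0 < n)%N by near: n; exact: nbhs_infty_gt.
have /andP[p0 pn] := hp n n0.
have L1 : 1 <= ln (n%:R / (n - p n + 1)%N%:R : R) by near: n.
set L := ln _ in L1 *; pose eps : R := (Num.sqrt L)^-1.
have e01 : 0 <= eps <= 1.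
  rewrite invr_ge0 sqrtr_ge0/= invf_le1 ?sqrtr_gt0 ?(lt_le_trans _ L1)//.
  by rewrite -[leLHS]sqrtr1 ler_wsqrtr.
have -> : 1 / L = eps ^+ 2.
  by rewrite /eps exprVn sqr_sqrtr ?div1r// (le_trans _ L1).
apply: (CE _ _ _ _ _ _ _ _ _ _ _ (hp n n0) (hXindep n n0) (hXgauss n n0) hN e01) => i i2.
exact: standardized_cumulant_bound n0 pn L1 i2.
Unshelve. all: by end_near. Qed.
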